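(* Let $\mathbb{K}$ be a field and let $\mathcal{T}$ be a realized $\mathbb{K}$-linear triangulated category with a full strong exceptional sequence $\langle E_1,\dots,E_n\rangle$ such that $\bigoplus_{i\in\mathbb{Z}}\operatorname{Hom}(X,Y[i])$ is a finite-dimensional $\mathbb{K}$-vector space for any $X,Y\in\mathcal{T}$. Then $\mathcal{T}$ is equivalent, as a triangulated category, to $\operatorname{D}^{\operatorname{b}}(\operatorname{mod-}A)$, where $A=\operatorname{End}\left(\bigoplus_{i=1}^n E_i\right)$.
   Context: Exceptional sequences: an object $E$ of a $\mathbb{K}$-linear triangulated category $\mathcal{T}$ is exceptional if $\operatorname{Hom}(E,E[m])$ equals $\mathbb{K}$ for $m=0$ and $0$ for $m\neq 0$. An exceptional sequence is a sequence $E_1,\dots,E_n$ of exceptional objects with $\operatorname{Hom}(E_i,E_j[m])=0$ for all $i>j$ and all $m\in\mathbb{Z}$. It is full if $\mathcal{T}$ is generated by $E_1,\dots,E_n$, i.e. $\mathcal{T}$ is (exactly equivalent to) the smallest full triangulated subcategory of $\mathcal{T}$ containing them. It is strong if $\operatorname{Hom}(E_i,E_j[m])=0$ for all $i,j$ and all $m\neq 0$. Hearts: a t-structure on a triangulated category $\mathcal{S}$ is a full subcategory $\mathcal{S}^{\le 0}$ with $\mathcal{S}^{\le 0}[1]\subset\mathcal{S}^{\le 0}$ such that every $E\in\mathcal{S}$ fits in a distinguished triangle $A\to E\to B\to A[1]$ with $A\in\mathcal{S}^{\le 0}$ and $B\in\mathcal{S}^{\ge 1}:=(\mathcal{S}^{\le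 0})^{\bot}=\{Y \in \mathcal{S}\mid\operatorname{Hom}(X,Y)=0\ \forall X\in\mathcal{S}^{\le 0}\}$. With $\mathcal{S}^{\le i}=\mathcal{S}^{\le 0}[-i]$ and $\mathcal{S}^{\ge j}=\mathcal{S}^{\ge 1}[-j+1]$, it is bounded if $\mathcal{S}=\bigcup_{i,j}(\mathcal{S}^{\le i}\cap\mathcal{S}^{\ge j})$; its heart is the abelian category $\mathcal{S}^{\le 0}\cap\mathcal{S}^{\ge 0}$. ''Heart on $\mathcal{S}$'' means heart of a bounded t-structure on $\mathcal{S}$. Realized: given a heart $\mathcal{A}$ on a triangulated category $\mathcal{S}$, a realization functor of $\mathcal{A}$ in $\mathcal{S}$ is an exact functor $\mathsf{real}:\operatorname{D}^{\operatorname{b}}(\mathcal{A})\to\mathcal{S}$ whose restriction to $\mathcal{A}$ is $\operatorname{id}_{\mathcal{A}}$. A triangulated category $\mathcal{T}$ is realized if for every full triangulated subcategory $\mathcal{S}\subset\mathcal{T}$ and every heart $\mathcal{A}$ on $\mathcal{S}$ there exists a realization functor $\mathsf{real}:\operatorname{D}^{\operatorname{b}}(\mathcal{A})\to\mathcal{S}$. $\operatorname{mod-}A$ is the category of finite-dimensional right $A$-modules and $\operatorname{D}^{\operatorname{b}}$ denotes the bounded derived category. All categories are assumed locally small. *)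

(* Defs.v *)
From HB Require Import structures.
From mathcomp Require Import all_boot all_order all_algebra.
From mathcomp Require Import zify boolp.

Set Implicit Arguments.
Unset Strict Implicit.
Unset Printing Implicit Defensive.

Import GRing.Theory.
Local Open Scope ring_scope.

Record kcat (K : fieldType) := KCat {
  Ob :> Type;
  Mor : Ob -> Ob -> lmodType K;
  idm : forall X, Mor X X;
  comp : forall X Y Z, Mor Y Z -> Mor X Y -> Mor X Z;
  compA : forall X Y Z W (h : Mor Z W) (g : Mor Y Z) (f : Mor X Y),
    comp h (comp g f) = comp (comp h g) f;
  comp1m : forall X Y (f : Mor X Y), comp (idm Y) f = f;
  compm1 : forall X Y (f : Mor X Y), comp f (idm X) = f;
  compDl : forall X Y Z (g g' : Mor Y Z) (f : Mor X Y),
    comp (g + g') f = comp g f + comp g' f;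
  compDr : forall X Y Z (g : Mor Y Z) (f f' : Mor X Y),
    comp g (f + f') = comp g f + comp g f';
  compZl : forall X Y Z (c : K) (g : Mor Y Z) (f : Mor X Y),
    comp (c *: g) f = c *: comp g f;
  compZr : forall X Y Z (c : K) (g : Mor Y Z) (f : Mor X Y),
    comp g (c *: f) = c *: comp g f
}.

Arguments Mor {K C} X Y : rename.
Arguments idm {K C} X : rename.
Arguments comp {K C X Y Z} g f : rename.

Declare Scope kcat_scope.
Delimit Scope kcat_scope with C.
Local Open Scope kcat_scope.
Notation "g ∘ f" := (comp g f) (at level 40, left associativity) : kcat_scope.

Section KcatBasics.
Variables (K : fieldType) (C : kcat K).

Lemma comp0m (X Y Z : C) (f : Mor X Y) : (0 : Mor Y Z) ∘ f = 0.
Proof. by have := compZl 0 (0 : Mor Y Z) f; rewrite !scale0r. Qed.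

Lemma compm0 (X Y Z : C) (g : Mor Y Z) : g ∘ (0 : Mor X Y) = 0.
Proof. by have := compZr 0 g (0 : Mor X Y); rewrite !scale0r. Qed.

Definition is_iso (X Y : C) (f : Mor X Y) : Prop :=
  exists g : Mor Y X, g ∘ f = idm X /\ f ∘ g = idm Y.

Definition iso_ob (X Y : C) : Prop := exists f : Mor X Y, is_iso f.

Definition is_zero (Z : C) : Prop :=
  forall X : C, (forall f : Mor Z X, f = 0) /\ (forall f : Mor X Z, f = 0).

Definition is_biproduct (n : nat) (E : 'I_n -> C) (X : C)
    (inj : forall i, Mor (E i) X) (proj : forall i, Mor X (E i)) : Prop :=
  [/\ forall i, proj i ∘ inj i = idm (E i),
      forall i j, i != j -> proj j ∘ inj i = 0
    & \sum_(i < n) (inj i ∘ proj i) = idm X].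

Definition additive_cat : Prop :=
  (exists Z : C, is_zero Z) /\
  (forall E : 'I_2 -> C, exists X inj proj, @is_biproduct 2 E X inj proj).

Definition iso_closed (P : C -> Prop) : Prop :=
  forall X Y, iso_ob X Y -> P X -> P Y.

Definition is_kernel (X Y Z : C) (f : Mor X Y) (i : Mor Z X) : Prop :=
  f ∘ i = 0 /\
  forall W (g : Mor W X), f ∘ g = 0 -> exists! h : Mor W Z, i ∘ h = g.

Definition is_cokernel (X Y Q : C) (f : Mor X Y) (p : Mor Y Q) : Prop :=
  p ∘ f = 0 /\
  forall W (g : Mor Y W), g ∘ f = 0 -> exists! h : Mor Q W, h ∘ p = g.

End KcatBasics.

(** Functors are additive; linearity over [K] is the separate property
    [klinear]. *)
Record functor (K : fieldType) (C D : kcat K) := Functor {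
  fob :> C -> D;
  fmap : forall X Y : C, Mor X Y -> Mor (fob X) (fob Y);
  fmap1 : forall X : C, fmap (idm X) = idm (fob X);
  fmapM : forall (X Y Z : C) (g : Mor Y Z) (f : Mor X Y),
    fmap (g ∘ f) = fmap g ∘ fmap f;
  fmapD : forall (X Y : C) (f g : Mor X Y), fmap (f + g) = fmap f + fmap g
}.

Arguments fmap {K C D} F {X Y} f : rename.

Section Functors.
Variable K : fieldType.

Definition klinear (C D : kcat K) (F : functor C D) : Prop :=
  forall (c : K) (X Y : C) (f : Mor X Y), fmap F (c *: f) = c *: fmap F f.

Definition id_functor (C : kcat K) : functor C C.
Proof. by exists (fun X => X) (fun X Y f => f). Defined.

Definition comp_functor (C D E : kcat K) (G : functor D E) (F : functor C D) :
  functor C E.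
Proof.
exists (fun X => G (F X)) (fun X Y f => fmap G (fmap F f)).
- by move=> X; rewrite !fmap1.
- by move=> X Y Z g f; rewrite !fmapM.
- by move=> X Y f g; rewrite !fmapD.
Defined.

Definition nat_iso (C D : kcat K) (F G : functor C D) : Prop :=
  exists eta : forall X, Mor (F X) (G X),
    (forall X, is_iso (eta X)) /\
    (forall X Y (f : Mor X Y), eta Y ∘ fmap F f = fmap G f ∘ eta X).

Definition is_equivalence (C D : kcat K) (F : functor C D) : Prop :=
  exists G : functor D C,
    nat_iso (comp_functor F G) (id_functor D) /\
    nat_iso (comp_functor G F) (id_functor C).

Definition full_subcat (C : kcat K) (P : C -> Prop) : kcat K.
Proof.
exists {X : C | P X} (fun X Y => Mor (sval X) (sval Y)) (fun X => idm (sval X))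
  (fun X Y Z g f => g ∘ f).
- by move=> *; exact: compA.
- by move=> *; exact: comp1m.
- by move=> *; exact: compm1.
- by move=> *; exact: compDl.
- by move=> *; exact: compDr.
- by move=> *; exact: compZl.
- by move=> *; exact: compZr.
Defined.

Definition incl_functor (C : kcat K) (P : C -> Prop) :
  functor (full_subcat P) C.
Proof. by exists (fun X => sval X) (fun X Y f => f). Defined.

Definition restr_functor (C : kcat K) (P : C -> Prop) (F : functor C C)
    (PF : forall X, P X -> P (F X)) : functor (full_subcat P) (full_subcat P).
Proof.
exists (fun X => exist _ (F (sval X)) (PF _ (svalP X)) : full_subcat P)
  (fun X Y (f : @Mor K C (sval X) (sval Y)) => fmap F f).
- by move=> X; exact: fmap1.
- by move=> X Y Z g f; exact: fmapM.
- by move=> X Y f g; exact: fmapD.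
Defined.

End Functors.

(** Morphisms of [loc W] are formal expressions in the morphisms of [C] and
    formal inverses of the members of [W], modulo the smallest congruence
    making [loc W] a [K]-linear category, [loc_functor] a [K]-linear functor,
    and the formal inverses two-sided inverses.  See [loc_liftK] and
    [loc_nat] for the universal property. *)
Section Localization.
Variables (K : fieldType) (C : kcat K).
Variable W : forall X Y : C, Mor X Y -> Prop.

Inductive expr : C -> C -> Type :=
| Emb X Y (f : Mor X Y) : expr X Y
| Inv X Y (s : Mor X Y) (Ws : W s) : expr Y X
| Comp X Y Z (g : expr Y Z) (f : expr X Y) : expr X Z
| Add X Y (f g : expr X Y) : expr X Y
| Scale X Y (c : K) (f : expr X Y) : expr X Y.

Inductive eqv : forall X Y, expr X Y -> expr X Y -> Prop :=
| eqv_refl X Y (f : expr X Y) : eqv f f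
| eqv_sym X Y (f g : expr X Y) : eqv f g -> eqv g f
| eqv_trans X Y (f g h : expr X Y) : eqv f g -> eqv g h -> eqv f h
| eqv_Comp X Y Z (g g' : expr Y Z) (f f' : expr X Y) :
    eqv g g' -> eqv f f' -> eqv (Comp g f) (Comp g' f')
| eqv_Add X Y (f f' g g' : expr X Y) :
    eqv f f' -> eqv g g' -> eqv (Add f g) (Add f' g')
| eqv_Scale X Y c (f f' : expr X Y) : eqv f f' -> eqv (Scale c f) (Scale c f')
| eqv_addA X Y (f g h : expr X Y) : eqv (Add f (Add g h)) (Add (Add f g) h)
| eqv_addC X Y (f g : expr X Y) : eqv (Add f g) (Add g f)
| eqv_add0 X Y (f : expr X Y) : eqv (Add (Emb 0) f) f
| eqv_addN X Y (f : expr X Y) : eqv (Add (Scale (-1) f) f) (Emb 0)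
| eqv_scaleA X Y a b (f : expr X Y) :
    eqv (Scale a (Scale b f)) (Scale (a * b) f)
| eqv_scale1 X Y (f : expr X Y) : eqv (Scale 1 f) f
| eqv_scaleDr X Y a (f g : expr X Y) :
    eqv (Scale a (Add f g)) (Add (Scale a f) (Scale a g))
| eqv_scaleDl X Y a b (f : expr X Y) :
    eqv (Scale (a + b) f) (Add (Scale a f) (Scale b f))
| eqv_compA X Y Z T (h : expr Z T) (g : expr Y Z) (f : expr X Y) :
    eqv (Comp h (Comp g f)) (Comp (Comp h g) f)
| eqv_comp1m X Y (f : expr X Y) : eqv (Comp (Emb (idm Y)) f) f
| eqv_compm1 X Y (f : expr X Y) : eqv (Comp f (Emb (idm X))) f
| eqv_compDl X Y Z (g g' : expr Y Z) (f : expr X Y) :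
    eqv (Comp (Add g g') f) (Add (Comp g f) (Comp g' f))
| eqv_compDr X Y Z (g : expr Y Z) (f f' : expr X Y) :
    eqv (Comp g (Add f f')) (Add (Comp g f) (Comp g f'))
| eqv_compZl X Y Z c (g : expr Y Z) (f : expr X Y) :
    eqv (Comp (Scale c g) f) (Scale c (Comp g f))
| eqv_compZr X Y Z c (g : expr Y Z) (f : expr X Y) :
    eqv (Comp g (Scale c f)) (Scale c (Comp g f))
| eqv_EmbM X Y Z (g : Mor Y Z) (f : Mor X Y) :
    eqv (Emb (g ∘ f)) (Comp (Emb g) (Emb f))
| eqv_EmbD X Y (f g : Mor X Y) : eqv (Emb (f + g)) (Add (Emb f) (Emb g))
| eqv_EmbZ X Y c (f : Mor X Y) : eqv (Emb (c *: f)) (Scale c (Emb f))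
| eqv_InvL X Y (s : Mor X Y) (Ws : W s) :
    eqv (Comp (Inv Ws) (Emb s)) (Emb (idm X))
| eqv_InvR X Y (s : Mor X Y) (Ws : W s) :
    eqv (Comp (Emb s) (Inv Ws)) (Emb (idm Y)).

Definition loc_mor (X Y : C) : Type :=
  {S : expr X Y -> Prop | exists f, S = eqv f}.

Definition cls X Y (f : expr X Y) : loc_mor X Y :=
  exist _ (eqv f) (ex_intro _ f erefl).

Definition rep X Y (q : loc_mor X Y) : expr X Y := sval (cid (svalP q)).

Lemma repK X Y (q : loc_mor X Y) : cls (rep q) = q.
Proof.
rewrite /rep; case: cid => f /= qE; case: q qE => S PS /= ES.
by rewrite /cls; apply: eq_exist; rewrite -ES.
Qed.

Lemma clsP X Y (f g : expr X Y) : cls f = cls g <-> eqv f g.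
Proof.
split=> [/(f_equal sval) /= ->|fg]; first exact: eqv_refl.
rewrite /cls; apply: eq_exist; apply: funext => h; apply: propext.
split=> [|gh].
- exact/eqv_trans/eqv_sym.
- exact: eqv_trans gh.
Qed.

Lemma cls_rep X Y (f : expr X Y) : eqv (rep (cls f)) f.
Proof. by apply/clsP; rewrite repK. Qed.

Definition loc_add X Y (p q : loc_mor X Y) := cls (Add (rep p) (rep q)).
Definition loc_scale X Y c (p : loc_mor X Y) := cls (Scale c (rep p)).
Definition loc_comp X Y Z (q : loc_mor Y Z) (p : loc_mor X Y) :=
  cls (Comp (rep q) (rep p)).

Lemma loc_addE X Y (f g : expr X Y) : loc_add (cls f) (cls g) = cls (Add f g).
Proof. by apply/clsP; apply: eqv_Add; exact: cls_rep. Qed.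

Lemma loc_scaleE X Y c (f : expr X Y) : loc_scale c (cls f) = cls (Scale c f).
Proof. by apply/clsP; apply: eqv_Scale; exact: cls_rep. Qed.

Lemma loc_compE X Y Z (g : expr Y Z) (f : expr X Y) :
  loc_comp (cls g) (cls f) = cls (Comp g f).
Proof. by apply/clsP; apply: eqv_Comp; exact: cls_rep. Qed.

Section LocLmod.
Variables X Y : C.

HB.instance Definition _ := gen_eqMixin (loc_mor X Y).
HB.instance Definition _ := gen_choiceMixin (loc_mor X Y).

Fact loc_addA : associative (@loc_add X Y).
Proof.
move=> p q r; rewrite -(repK p) -(repK q) -(repK r) !loc_addE.
by apply/clsP; exact: eqv_addA.
Qed.

Fact loc_addC : commutative (@loc_add X Y).
Proof.
by move=> p q; rewrite -(repK p) -(repK q) !loc_addE; apply/clsP/eqv_addC.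
Qed.

Fact loc_add0 : left_id (cls (Emb 0)) (@loc_add X Y).
Proof. by move=> p; rewrite -(repK p) !loc_addE; apply/clsP/eqv_add0. Qed.

Fact loc_addN : left_inverse (cls (Emb 0)) (loc_scale (-1)) (@loc_add X Y).
Proof.
by move=> p; rewrite -(repK p) loc_scaleE loc_addE; apply/clsP/eqv_addN.
Qed.

HB.instance Definition _ := GRing.isZmodule.Build (loc_mor X Y)
  loc_addA loc_addC loc_add0 loc_addN.

Fact loc_scaleA a b (p : loc_mor X Y) :
  loc_scale a (loc_scale b p) = loc_scale (a * b) p.
Proof. by rewrite -(repK p) !loc_scaleE; apply/clsP/eqv_scaleA. Qed.

Fact loc_scale1 : left_id 1 (@loc_scale X Y).
Proof. by move=> p; rewrite -(repK p) !loc_scaleE; apply/clsP/eqv_scale1. Qed.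

Fact loc_scaleDr : right_distributive (@loc_scale X Y) +%R.
Proof.
move=> a p q; rewrite -(repK p) -(repK q) /GRing.add /=.
by rewrite !(loc_addE, loc_scaleE); apply/clsP/eqv_scaleDr.
Qed.

Fact loc_scaleDl (p : loc_mor X Y) : {morph (@loc_scale X Y)^~ p : a b / a + b}.
Proof.
move=> a b; rewrite -(repK p) [in RHS]/GRing.add /=.
by rewrite !(loc_addE, loc_scaleE); apply/clsP/eqv_scaleDl.
Qed.

HB.instance Definition _ := GRing.Zmodule_isLmodule.Build K (loc_mor X Y)
  loc_scaleA loc_scale1 loc_scaleDr loc_scaleDl.

End LocLmod.

Definition loc : kcat K.
Proof.
exists C (fun X Y => loc_mor X Y : lmodType K) (fun X => cls (Emb (idm X)))
  loc_comp.
- move=> X Y Z T h g f; rewrite -(repK h) -(repK g) -(repK f) !loc_compE.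
  exact/clsP/eqv_compA.
- by move=> X Y f; rewrite -(repK f) !loc_compE; apply/clsP/eqv_comp1m.
- by move=> X Y f; rewrite -(repK f) !loc_compE; apply/clsP/eqv_compm1.
- move=> X Y Z g g' f; rewrite -(repK g) -(repK g') -(repK f) /GRing.add /=.
  by rewrite !(loc_compE, loc_addE); apply/clsP/eqv_compDl.
- move=> X Y Z g f f'; rewrite -(repK g) -(repK f) -(repK f') /GRing.add /=.
  by rewrite !(loc_compE, loc_addE); apply/clsP/eqv_compDr.
- move=> X Y Z c g f; rewrite -(repK g) -(repK f) /GRing.scale /=.
  by rewrite !(loc_compE, loc_scaleE); apply/clsP/eqv_compZl.
- move=> X Y Z c g f; rewrite -(repK g) -(repK f) /GRing.scale /=.
  by rewrite !(loc_compE, loc_scaleE); apply/clsP/eqv_compZr.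
Defined.

Definition loc_functor : functor C loc.
Proof.
refine (@Functor K C loc (fun X => X)
  (fun (X Y : C) (f : Mor X Y) => cls (Emb f)) _ _ _) => //=.
- by move=> X Y Z g f; rewrite loc_compE; apply/clsP/eqv_EmbM.
- move=> X Y f g; rewrite [in RHS]/GRing.add /= loc_addE.
  exact/clsP/eqv_EmbD.
Defined.

Lemma loc_functor_klinear : klinear loc_functor.
Proof.
move=> c X Y f; rewrite [in RHS]/GRing.scale /= loc_scaleE.
exact/clsP/eqv_EmbZ.
Qed.

Lemma loc_functor_iso X Y (s : Mor X Y) : W s -> is_iso (fmap loc_functor s).
Proof.
move=> Ws; exists (cls (Inv Ws) : @Mor K loc Y X).
by split; rewrite /= loc_compE; apply/clsP; [exact: eqv_InvL|exact: eqv_InvR].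
Qed.

Section Lift.
Variables (D : kcat K) (F : functor C D).
Hypotheses (Flin : klinear F)
           (FW : forall X Y (s : Mor X Y), W s -> is_iso (fmap F s)).

Fixpoint expr_eval X Y (e : expr X Y) : Mor (F X) (F Y) :=
  match e with
  | Emb _ _ f => fmap F f
  | Inv _ _ _ Ws => sval (cid (FW Ws))
  | Comp _ _ _ g f => expr_eval g ∘ expr_eval f
  | Add _ _ f g => expr_eval f + expr_eval g
  | Scale _ _ c f => c *: expr_eval f
  end.

Lemma fmap0 X Y : fmap F (0 : Mor X Y) = 0.
Proof. by have := Flin 0 (0 : Mor X Y); rewrite !scale0r. Qed.

Lemma expr_eval_eqv X Y (e e' : expr X Y) :
  eqv e e' -> expr_eval e = expr_eval e'.
Proof.
elim=> //= {X Y e e'}.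
- by move=> X Y f g h _ -> _ ->.
- by move=> X Y Z g g' f f' _ -> _ ->.
- by move=> X Y f f' g g' _ -> _ ->.
- by move=> X Y c f f' _ ->.
- by move=> *; rewrite addrA.
- by move=> *; rewrite addrC.
- by move=> *; rewrite fmap0 add0r.
- by move=> *; rewrite fmap0 scaleN1r addNr.
- by move=> *; rewrite scalerA.
- by move=> *; rewrite scale1r.
- by move=> *; rewrite scalerDr.
- by move=> *; rewrite scalerDl.
- by move=> *; rewrite compA.
- by move=> *; rewrite fmap1 comp1m.
- by move=> *; rewrite fmap1 compm1.
- by move=> *; rewrite compDl.
- by move=> *; rewrite compDr.
- by move=> *; rewrite compZl.
- by move=> *; rewrite compZr.
- by move=> *; rewrite fmapM.
- by move=> *; rewrite fmapD.
- by move=> X Y s Ws; case: cid => t [/= -> _]; rewrite fmap1.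
- by move=> X Y s Ws; case: cid => t [/= _ ->]; rewrite fmap1.
Qed.

Definition loc_lift : functor loc D.
Proof.
exists (fun X : loc => F X)
  (fun (X Y : loc) (q : loc_mor X Y) => expr_eval (rep q)).
- by move=> X /=; rewrite (expr_eval_eqv (cls_rep _)) /= fmap1.
- by move=> X Y Z g f /=; rewrite (expr_eval_eqv (cls_rep _)).
- by move=> X Y f g; rewrite (expr_eval_eqv (cls_rep _)).
Defined.

Lemma loc_lift_klinear : klinear loc_lift.
Proof. by move=> c X Y f; rewrite /= (expr_eval_eqv (cls_rep _)). Qed.

Lemma loc_liftK X Y (f : Mor X Y) :
  fmap loc_lift (fmap loc_functor f) = fmap F f.
Proof. by rewrite /= (expr_eval_eqv (cls_rep _)). Qed.

End Lift.

Lemma loc_nat (D : kcat K) (G G' : functor loc D)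
    (eta : forall X : C, Mor (G X) (G' X)) :
  (forall (X Y : C) (f : Mor X Y),
     eta Y ∘ fmap G (fmap loc_functor f) =
     fmap G' (fmap loc_functor f) ∘ eta X) ->
  forall (X Y : loc) (f : Mor X Y), eta Y ∘ fmap G f = fmap G' f ∘ eta X.
Proof.
move=> nat X Y f.
rewrite -(repK f); elim: (rep f) => {X Y f} [X Y f|X Y s Ws|X Y Z g IHg f IHf|
  X Y f IHf g IHg|X Y c f IHf].
- exact: nat.
- set i : @Mor K loc Y X := cls (Inv Ws).
  pose j : @Mor K loc X Y := fmap loc_functor s.
  have ij : i ∘ j = @idm K loc X by rewrite /= loc_compE; apply/clsP/eqv_InvL.
  have ji : j ∘ i = @idm K loc Y by rewrite /= loc_compE; apply/clsP/eqv_InvR.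
  rewrite -[LHS]comp1m -(fmap1 G') -ij (fmapM G' i j) -compA (compA (fmap G' j)).
  by rewrite -nat -[_ ∘ fmap G i]compA -(fmapM G j i) ji fmap1 compm1.
- rewrite -(loc_compE g f) (fmapM G (cls g : @Mor K loc _ _) (cls f)).
  by rewrite (fmapM G' (cls g : @Mor K loc _ _) (cls f)) compA IHg -!compA IHf.
- rewrite -(loc_addE f g) (fmapD G (cls f : @Mor K loc _ _) (cls g)).
  rewrite (fmapD G' (cls f : @Mor K loc _ _) (cls g)) compDr compDl.
  by rewrite IHf IHg.
- have -> : cls (Scale c f) =
      fmap loc_functor (c *: idm Y) ∘ (cls f : @Mor K loc X Y).
    rewrite (loc_functor_klinear c (idm Y)) (fmap1 loc_functor Y).
    by rewrite compZl comp1m -loc_scaleE.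
  by rewrite !fmapM compA nat -!compA IHf.
Qed.

End Localization.

Arguments loc_functor {K C} W.

(** The data of a triangulated category; the axioms are [triangulated]. *)
Record tridata (K : fieldType) := TriData {
  tcat :> kcat K;
  shift : functor tcat tcat;
  unshift : functor tcat tcat;
  dist : forall X Y Z : tcat,
    Mor X Y -> Mor Y Z -> Mor Z (shift X) -> Prop
}.

Arguments shift {K} T : rename.
Arguments unshift {K} T : rename.
Arguments dist {K T X Y Z} f g h : rename.

Definition iso_tri (K : fieldType) (C : kcat K) (S : functor C C)
    (X Y Z : C) (f : Mor X Y) (g : Mor Y Z) (h : Mor Z (S X))
    (X' Y' Z' : C) (f' : Mor X' Y') (g' : Mor Y' Z') (h' : Mor Z' (S X')) :=
  exists (a : Mor X X') (b : Mor Y Y') (c : Mor Z Z'),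
    [/\ is_iso a, is_iso b & is_iso c] /\
    [/\ b ∘ f = f' ∘ a, c ∘ g = g' ∘ b & fmap S a ∘ h = h' ∘ c].

Section Triangulated.
Variables (K : fieldType) (T : tridata K).

Definition shiftn (m : int) (X : T) : T :=
  match m with
  | Posz n => iter n (shift T) X
  | Negz n => iter n.+1 (unshift T) X
  end.

Definition dist_iso : Prop :=
  forall (X Y Z : T) (f : Mor X Y) (g : Mor Y Z) (h : Mor Z (shift T X))
         (X' Y' Z' : T) (f' : Mor X' Y') (g' : Mor Y' Z')
         (h' : Mor Z' (shift T X')),
    iso_tri f g h f' g' h' -> dist f g h -> dist f' g' h'.

Definition dist_id : Prop :=
  forall X Z : T, is_zero Z ->
    dist (idm X) (0 : Mor X Z) (0 : Mor Z (shift T X)).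

Definition dist_ext : Prop :=
  forall (X Y : T) (f : Mor X Y),
    exists (Z : T) (g : Mor Y Z) (h : Mor Z (shift T X)), dist f g h.

Definition dist_rot : Prop :=
  forall (X Y Z : T) (f : Mor X Y) (g : Mor Y Z) (h : Mor Z (shift T X)),
    dist f g h <-> dist g h (- fmap (shift T) f).

Definition dist_mor : Prop :=
  forall (X Y Z : T) (f : Mor X Y) (g : Mor Y Z) (h : Mor Z (shift T X))
         (X' Y' Z' : T) (f' : Mor X' Y') (g' : Mor Y' Z')
         (h' : Mor Z' (shift T X')) (a : Mor X X') (b : Mor Y Y'),
    dist f g h -> dist f' g' h' -> b ∘ f = f' ∘ a ->
    exists c : Mor Z Z', c ∘ g = g' ∘ b /\ fmap (shift T) a ∘ h = h' ∘ c.

Definition dist_octahedron : Prop :=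
  forall (X Y Z X' Y' Z' : T) (f : Mor X Y) (g : Mor Y Z)
         (a : Mor Y Z') (b : Mor Z' (shift T X))
         (c : Mor Z X') (d : Mor X' (shift T Y))
         (e : Mor Z Y') (k : Mor Y' (shift T X)),
    dist f a b -> dist g c d -> dist (g ∘ f) e k ->
    exists (u : Mor Z' Y') (v : Mor Y' X'),
      dist u v (fmap (shift T) a ∘ d) /\
      [/\ u ∘ a = e ∘ g, k ∘ u = b, v ∘ e = c &
          d ∘ v = fmap (shift T) f ∘ k].

Record triangulated : Prop := Triangulated {
  tri_additive : additive_cat T;
  tri_shift_lin : klinear (shift T);
  tri_shiftK : nat_iso (comp_functor (shift T) (unshift T)) (id_functor T);
  tri_unshiftK : nat_iso (comp_functor (unshift T) (shift T)) (id_functor T);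
  tri_iso : dist_iso;
  tri_id : dist_id;
  tri_ext : dist_ext;
  tri_rot : dist_rot;
  tri_mor : dist_mor;
  tri_oct : dist_octahedron
}.

End Triangulated.

Arguments shiftn {K T} m X.

Section ExactFunctors.
Variable K : fieldType.

Definition exact_functor (S T : tridata K) (F : functor S T) : Prop :=
  exists theta : forall X : S, Mor (F (shift S X)) (shift T (F X)),
    [/\ forall X, is_iso (theta X),
        forall (X Y : S) (f : Mor X Y),
          theta Y ∘ fmap F (fmap (shift S) f) =
          fmap (shift T) (fmap F f) ∘ theta X
      & forall (X Y Z : S) (f : Mor X Y) (g : Mor Y Z) (h : Mor Z (shift S X)),
          dist f g h -> dist (fmap F f) (fmap F g) (theta X ∘ fmap F h)].

Definition tri_equivalent (S T : tridata K) : Prop :=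
  exists F : functor S T, exact_functor F /\ is_equivalence F.

(** Full triangulated subcategories are taken closed under isomorphism. *)
Record tri_subcat (T : tridata K) := TriSubcat {
  in_sub :> T -> Prop;
  sub_iso : iso_closed in_sub;
  sub_zero : forall Z : T, is_zero Z -> in_sub Z;
  sub_shift : forall X : T, in_sub X -> in_sub (shift T X);
  sub_unshift : forall X : T, in_sub X -> in_sub (unshift T X);
  sub_cone : forall (X Y Z : T) (f : Mor X Y) (g : Mor Y Z)
                    (h : Mor Z (shift T X)),
    dist f g h -> in_sub X -> in_sub Y -> in_sub Z
}.

Definition sub_tridata (T : tridata K) (S : tri_subcat T) : tridata K :=
  @TriData K (full_subcat S) (restr_functor (@sub_shift T S))
    (restr_functor (@sub_unshift T S))
    (fun X Y Z f g h => @dist K T (sval X) (sval Y) (sval Z) f g h).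

End ExactFunctors.

Section TStructures.
Variables (K : fieldType) (S : tridata K).
Variable le0 : S -> Prop.

Definition ge1 (Y : S) : Prop :=
  forall X : S, le0 X -> forall f : Mor X Y, f = 0.

Definition t_le (i : int) (X : S) : Prop :=
  exists Y : S, le0 Y /\ iso_ob X (shiftn (- i) Y).

Definition t_ge (j : int) (X : S) : Prop :=
  exists Y : S, ge1 Y /\ iso_ob X (shiftn (- j + 1) Y).

Record t_structure : Prop := TStructure {
  t_iso : iso_closed le0;
  t_shift : forall X : S, le0 X -> le0 (shift S X);
  t_triangle : forall E : S,
    exists (A B : S) (f : Mor A E) (g : Mor E B) (h : Mor B (shift S A)),
      [/\ dist f g h, le0 A & ge1 B]
}.

Definition t_bounded : Prop :=
  forall X : S, exists i j : int, t_le i X /\ t_ge j X.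

Definition in_heart (X : S) : Prop := t_le 0 X /\ t_ge 0 X.

End TStructures.

(** A differential has a component [cd i j] for all degrees [i] and [j], which
    vanishes unless [j = i + 1]; this avoids transports along equalities of
    degrees. *)
Record cplx (K : fieldType) (A : kcat K) := Cplx {
  cob :> int -> A;
  cd : forall i j : int, Mor (cob i) (cob j);
  cd_shape : forall i j : int, j != i + 1 -> cd i j = 0;
  cd_sq : forall i j k : int, cd j k ∘ cd i j = 0;
  cd_bounded : exists N : nat, forall i : int, (N < `|i|)%N -> is_zero (cob i)
}.

Arguments cd {K A} X i j : rename.

Section ChainMaps.
Variables (K : fieldType) (A : kcat K).

Record cmap (X Y : cplx A) := CMap {
  cm :> forall i : int, Mor (X i) (Y i);
  cmP : forall i j : int, cm j ∘ cd X i j = cd Y i j ∘ cm i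
}.

Lemma cmap_eq (X Y : cplx A) (f g : cmap X Y) : (forall i, f i = g i) -> f = g.
Proof.
case: f g => [f Pf] [g Pg] /= fg.
have E : f = g by apply: functional_extensionality_dep.
by subst g; congr CMap; exact: Prop_irrelevance.
Qed.

Section CMapLmod.
Variables X Y : cplx A.

HB.instance Definition _ := gen_eqMixin (cmap X Y).
HB.instance Definition _ := gen_choiceMixin (cmap X Y).

Definition cmap0 : cmap X Y.
Proof. by exists (fun i => 0) => i j; rewrite comp0m compm0. Defined.

Definition cmap_add (f g : cmap X Y) : cmap X Y.
Proof.
by exists (fun i => f i + g i) => i j; rewrite compDl compDr !cmP.
Defined.

Definition cmap_scale (c : K) (f : cmap X Y) : cmap X Y.
Proof. by exists (fun i => c *: f i) => i j; rewrite compZl compZr cmP. Defined.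

Fact cmap_addA : associative cmap_add.
Proof. by move=> f g h; apply: cmap_eq => i /=; rewrite addrA. Qed.

Fact cmap_addC : commutative cmap_add.
Proof. by move=> f g; apply: cmap_eq => i /=; rewrite addrC. Qed.

Fact cmap_add0 : left_id cmap0 cmap_add.
Proof. by move=> f; apply: cmap_eq => i /=; rewrite add0r. Qed.

Fact cmap_addN : left_inverse cmap0 (cmap_scale (-1)) cmap_add.
Proof. by move=> f; apply: cmap_eq => i /=; rewrite scaleN1r addNr. Qed.

HB.instance Definition _ := GRing.isZmodule.Build (cmap X Y)
  cmap_addA cmap_addC cmap_add0 cmap_addN.

Fact cmap_scaleA a b (f : cmap X Y) :
  cmap_scale a (cmap_scale b f) = cmap_scale (a * b) f.
Proof. by apply: cmap_eq => i /=; rewrite scalerA. Qed.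

Fact cmap_scale1 : left_id 1 cmap_scale.
Proof. by move=> f; apply: cmap_eq => i /=; rewrite scale1r. Qed.

Fact cmap_scaleDr : right_distributive cmap_scale +%R.
Proof. by move=> a f g; apply: cmap_eq => i /=; rewrite scalerDr. Qed.

Fact cmap_scaleDl (f : cmap X Y) : {morph cmap_scale^~ f : a b / a + b}.
Proof. by move=> a b; apply: cmap_eq => i /=; rewrite scalerDl. Qed.

HB.instance Definition _ := GRing.Zmodule_isLmodule.Build K (cmap X Y)
  cmap_scaleA cmap_scale1 cmap_scaleDr cmap_scaleDl.

End CMapLmod.

Definition cmap_id (X : cplx A) : cmap X X.
Proof. by exists (fun i => idm (X i)) => i j; rewrite comp1m compm1. Defined.

Definition cmap_comp (X Y Z : cplx A) (g : cmap Y Z) (f : cmap X Y) : cmap X Z.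
Proof.
by exists (fun i => g i ∘ f i) => i j; rewrite -compA cmP compA cmP compA.
Defined.

Definition Cb : kcat K.
Proof.
exists (cplx A) (fun X Y => cmap X Y : lmodType K) cmap_id cmap_comp.
- by move=> X Y Z T h g f; apply: cmap_eq => i /=; rewrite compA.
- by move=> X Y f; apply: cmap_eq => i /=; rewrite comp1m.
- by move=> X Y f; apply: cmap_eq => i /=; rewrite compm1.
- by move=> X Y Z g g' f; apply: cmap_eq => i /=; rewrite compDl.
- by move=> X Y Z g f f'; apply: cmap_eq => i /=; rewrite compDr.
- by move=> X Y Z c g f; apply: cmap_eq => i /=; rewrite compZl.
- by move=> X Y Z c g f; apply: cmap_eq => i /=; rewrite compZr.
Defined.

Definition cplx_shift (k : int) (X : cplx A) : cplx A.
Proof.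
exists (fun i => X (i + k)) (fun i j => (-1) ^+ `|k|%N *: cd X (i + k) (j + k)).
- move=> i j ij; rewrite cd_shape ?scaler0 // addrAC.
  by apply: contra_neq ij; exact: addIr.
- by move=> i j l; rewrite compZl compZr cd_sq !scaler0.
- have [N XN] := cd_bounded X; exists (N + `|k|)%N => i Ni; apply: XN.
  rewrite -(ltn_add2r `|k|) (leq_trans Ni) //.
  by have := leqD_dist (i + k) 0 k; lia.
Defined.

Definition cmap_shift (k : int) (X Y : cplx A) (f : cmap X Y) :
  cmap (cplx_shift k X) (cplx_shift k Y).
Proof.
by exists (fun i => f (i + k)) => i j /=; rewrite compZl compZr cmP.
Defined.

Definition Cb_shift (k : int) : functor Cb Cb.
Proof.
exists (fun X : Cb => cplx_shift k X : Cb)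
  (fun (X Y : Cb) (f : cmap X Y) => cmap_shift k f).
- by move=> X; exact: cmap_eq.
- by move=> X Y Z g f; exact: cmap_eq.
- by move=> X Y f g; exact: cmap_eq.
Defined.

Lemma Cb_shift_klinear k : klinear (Cb_shift k).
Proof. by move=> c X Y f; exact: cmap_eq. Qed.

(** [H], with [p : Z -> H], is the cohomology of [M' -a-> M -b-> M'']:
    [iota] is a kernel of [b], [a'] is the factorization of [a] through
    [iota], and [p] is a cokernel of [a']. *)
Definition is_cohomology (M' M M'' : A) (a : Mor M' M) (b : Mor M M'')
    (Z H : A) (iota : Mor Z M) (a' : Mor M' Z) (p : Mor Z H) : Prop :=
  [/\ is_kernel b iota, iota ∘ a' = a & is_cokernel a' p].

Definition quasi_iso (X Y : Cb) (f : Mor X Y) : Prop :=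
  forall i j k : int, j = i + 1 -> k = j + 1 ->
  exists (ZX HX ZY HY : A)
         (iX : Mor ZX (X j)) (aX : Mor (X i) ZX) (pX : Mor ZX HX)
         (iY : Mor ZY (Y j)) (aY : Mor (Y i) ZY) (pY : Mor ZY HY)
         (z : Mor ZX ZY) (phi : Mor HX HY),
    [/\ is_cohomology (cd X i j) (cd X j k) iX aX pX,
        is_cohomology (cd Y i j) (cd Y j k) iY aY pY,
        iY ∘ z = (f : cmap X Y) j ∘ iX, phi ∘ pX = pY ∘ z & is_iso phi].

Lemma scale_sign_eq0 (V : lmodType K) (n : nat) (v : V) :
  (-1) ^+ n *: v = 0 -> v = 0.
Proof. by move=> /(f_equal ( *:%R ((-1) ^+ n))); rewrite signrZK scaler0. Qed.

Lemma is_cohomology_sign (n : nat) (M' M M'' : A) (a : Mor M' M) (b : Mor M M'')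
    (Z H : A) (iota : Mor Z M) (a' : Mor M' Z) (p : Mor Z H) :
  is_cohomology a b iota a' p ->
  is_cohomology ((-1) ^+ n *: a) ((-1) ^+ n *: b) iota ((-1) ^+ n *: a') p.
Proof.
move=> [[bi ker] ia [pa coker]]; split.
- split=> [|W g]; first by rewrite compZl bi scaler0.
  by rewrite compZl => /scale_sign_eq0 /ker.
- by rewrite compZr ia.
- split=> [|W g]; first by rewrite compZr pa scaler0.
  by rewrite compZr => /scale_sign_eq0 /coker.
Qed.

Lemma quasi_iso_shift (k : int) (X Y : Cb) (f : Mor X Y) :
  quasi_iso f -> quasi_iso (fmap (Cb_shift k) f).
Proof.
move=> qf i j l ij jl.
have [||ZX [HX [ZY [HY [iX [aX [pX [iY [aY [pY [z [phi [cX cY iz pz iphi]]]]]]]]]]]]]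
  := qf (i + k) (j + k) (l + k); try by [rewrite ij addrAC|rewrite jl addrAC].
exists ZX, HX, ZY, HY, iX, ((-1) ^+ `|k|%N *: aX), pX.
exists iY, ((-1) ^+ `|k|%N *: aY), pY, z, phi.
by split=> //; exact: is_cohomology_sign.
Qed.

(** [C], with [u] and [v], is the mapping cone of [f]: in degree [i] it is the
    direct sum of [X (i + 1)] and [Y i], with inclusions [s i], [u i] and
    projections [v i], [p i].  As [u] and [v] are chain maps, the last condition
    determines the differential as [[-d_X, 0; f, d_Y]]. *)
Definition is_cone (X Y C : cplx A) (f : cmap X Y) (u : cmap Y C)
    (v : cmap C (cplx_shift 1 X)) : Prop :=
  exists (s : forall i, Mor (X (i + 1)) (C i)) (p : forall i, Mor (C i) (Y i)),
  forall i,
    [/\ p i ∘ u i = idm (Y i), v i ∘ s i = idm (X (i + 1)),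
        p i ∘ s i = 0, v i ∘ u i = 0 & u i ∘ p i + s i ∘ v i = idm (C i)] /\
    p (i + 1) ∘ cd C i (i + 1) = cd Y i (i + 1) ∘ p i + f (i + 1) ∘ v i.

Definition stalk_cplx (Z : A) (Z0 : is_zero Z) (X : A) : cplx A.
Proof.
exists (fun i => if i is Posz 0 then X else Z) (fun i j => 0).
- by [].
- by move=> *; rewrite comp0m.
- by exists 0%N => - [[|n]|n].
Defined.

Definition stalk_cmap (Z : A) (Z0 : is_zero Z) (X Y : A) (f : Mor X Y) :
  cmap (stalk_cplx Z0 X) (stalk_cplx Z0 Y).
Proof.
exists (fun i => match i return Mor (if i is Posz 0 then X else Z)
                                    (if i is Posz 0 then Y else Z) with
                 | Posz 0 => f
                 | _ => idm Z
                 end).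
by move=> i j /=; rewrite comp0m compm0.
Defined.

Definition stalk_functor (Z : A) (Z0 : is_zero Z) : functor A Cb.
Proof.
exists (fun X => stalk_cplx Z0 X : Cb)
  (fun X Y (f : Mor X Y) => stalk_cmap Z0 f : @Mor K Cb _ _).
- by move=> X; apply: cmap_eq => - [[|n]|n].
- by move=> X Y W g f; apply: cmap_eq => - [[|n]|n] //=; rewrite comp1m.
- by move=> X Y f g; apply: cmap_eq => - [[|n]|n] //=;
    exact: etrans (proj1 (Z0 _) _) (esym (proj1 (Z0 _) _)).
Defined.

End ChainMaps.

(** The ordinary localization of bounded complexes at quasi-isomorphisms is
    already [K]-linear, so it agrees with the linear localization used here.
    Homotopic chain maps become equal in it, so no prior passage to the homotopy
    category is needed. *)
Section Derived.
Variables (K : fieldType) (A : kcat K).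

Definition Db_cat : kcat K := loc (@quasi_iso K A).

Definition Db_functor : functor (Cb A) Db_cat := loc_functor (@quasi_iso K A).

Lemma Db_shift_klinear k : klinear (comp_functor Db_functor (Cb_shift A k)).
Proof.
by move=> c X Y f; rewrite [LHS](f_equal _ (Cb_shift_klinear k c f)) loc_functor_klinear.
Qed.

Lemma Db_shift_iso k (X Y : Cb A) (s : Mor X Y) :
  quasi_iso s -> is_iso (fmap (comp_functor Db_functor (Cb_shift A k)) s).
Proof. by move=> qs; apply: loc_functor_iso; exact: quasi_iso_shift. Qed.

Definition Db_shift (k : int) : functor Db_cat Db_cat :=
  loc_lift (@Db_shift_klinear k) (@Db_shift_iso k).

Definition Db_dist (X Y Z : Db_cat) (f : Mor X Y) (g : Mor Y Z)
    (h : Mor Z (Db_shift 1 X)) : Prop :=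
  exists (X' Y' C : Cb A) (f' : Mor X' Y') (u : Mor Y' C)
         (v : Mor C (Cb_shift A 1 X')),
    is_cone f' u v /\
    @iso_tri K Db_cat (Db_shift 1) X Y Z f g h X' Y' C
      (fmap Db_functor f') (fmap Db_functor u) (fmap Db_functor v).

Definition Db : tridata K := @TriData K Db_cat (Db_shift 1) (Db_shift (-1)) Db_dist.

End Derived.

Section Realized.
Variable K : fieldType.

(** [P] is viewed inside its derived category through stalk complexes in degree
    [0]; "restricts to the identity" is read up to natural isomorphism. *)
Definition is_realization (S : tridata K) (P : S -> Prop)
    (real : functor (Db (full_subcat P)) S) : Prop :=
  exact_functor real /\
  exists (Z : full_subcat P) (Z0 : is_zero Z),
    nat_iso
      (comp_functor real
        (comp_functor (Db_functor (full_subcat P)) (stalk_functor Z0)))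
      (incl_functor P).

Definition realized (T : tridata K) : Prop :=
  forall (S : tri_subcat T) (le0 : sub_tridata S -> Prop),
    t_structure le0 -> t_bounded le0 ->
    exists real : functor (Db (full_subcat (in_heart le0))) (sub_tridata S),
      is_realization real.

End Realized.

Definition lmod_iso (K : fieldType) (U V : lmodType K) : Prop :=
  exists f : {linear U -> V}, bijective f.

Section Exceptional.
Variables (K : fieldType) (T : tridata K).

Definition exceptional (E : T) : Prop :=
  lmod_iso K^o (Mor E (shiftn 0 E)) /\
  forall m : int, m != 0 -> forall f : Mor E (shiftn m E), f = 0.

Variables (n : nat) (E : 'I_n -> T).

Definition exceptional_sequence : Prop :=
  (forall i, exceptional (E i)) /\
  (forall i j : 'I_n, (j < i)%N ->
     forall (m : int) (f : Mor (E i) (shiftn m (E j))), f = 0).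

Definition full_sequence : Prop :=
  forall S : tri_subcat T, (forall i, S (E i)) -> forall X : T, S X.

Definition strong_sequence : Prop :=
  forall (i j : 'I_n) (m : int), m != 0 ->
    forall f : Mor (E i) (shiftn m (E j)), f = 0.

End Exceptional.

(** [dsum_fin_dim V]: the direct sum of the [V i], that is the space of the
    finitely supported families, has a finite generating family. *)
Section DirectSum.
Variables (K : fieldType) (V : int -> lmodType K).

Definition fin_supp (v : forall i, V i) : Prop :=
  exists N : nat, forall i : int, (N < `|i|)%N -> v i = 0.

Definition dsum_fin_dim : Prop :=
  exists (m : nat) (b : 'I_m -> forall i, V i),
    (forall k, fin_supp (b k)) /\
    forall v, fin_supp v ->
      exists c : 'I_m -> K, forall i, v i = \sum_(k < m) c k *: b k i.

End DirectSum.

(** Unital associative algebras, possibly zero. *)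
Record kalg (K : fieldType) := KAlg {
  asort :> lmodType K;
  amul : asort -> asort -> asort;
  aone : asort;
  amulA : associative amul;
  amul1l : left_id aone amul;
  amul1r : right_id aone amul;
  amulDl : left_distributive amul +%R;
  amulDr : right_distributive amul +%R;
  amulZl : forall c a b, amul (c *: a) b = c *: amul a b;
  amulZr : forall c a b, amul a (c *: b) = c *: amul a b
}.

(** The product is composition, so that [Mor X Y] is a right module. *)
Definition End_alg (K : fieldType) (C : kcat K) (X : C) : kalg K.
Proof.
exists (Mor X X) (fun a b => a ∘ b) (idm X).
- by move=> a b c; exact: compA.
- by move=> a; exact: comp1m.
- by move=> a; exact: compm1.
- by move=> a b c; exact: compDl.
- by move=> a b c; exact: compDr.
- by move=> *; exact: compZl.
- by move=> *; exact: compZr.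
Defined.

Record rmod_str (K : fieldType) (A : kalg K) (V : vectType K) := RModStr {
  act : V -> A -> V;
  act1 : forall v, act v (aone A) = v;
  actM : forall v a b, act v (amul a b) = act (act v a) b;
  actDl : forall v w a, act (v + w) a = act v a + act w a;
  actDr : forall v a b, act v (a + b) = act v a + act v b;
  actZl : forall c v a, act (c *: v) a = c *: act v a;
  actZr : forall c v a, act v (c *: a) = c *: act v a
}.

Record rmod (K : fieldType) (A : kalg K) := RMod {
  msort :> vectType K;
  mstr : rmod_str A msort
}.

Definition mact (K : fieldType) (A : kalg K) (V : rmod A) : V -> A -> V :=
  act (mstr V).

Section ModCat.
Import VectorInternalTheory.
Variables (K : fieldType) (A : kalg K).

Record rmor (V W : rmod A) := RMor {
  rfun :> 'Hom(V, W);
  rfunP : forall v a, rfun (mact v a) = mact (rfun v) a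
}.

Lemma rmor_eq (V W : rmod A) (f g : rmor V W) : (forall v, f v = g v) -> f = g.
Proof.
case: f g => [f Pf] [g Pg] /= fg; have E : f = g by exact/lfunP.
by subst g; congr RMor; exact: Prop_irrelevance.
Qed.

Lemma mact0 (V : rmod A) a : mact (0 : V) a = 0.
Proof. by have := actZl (mstr V) 0 (0 : V) a; rewrite !scale0r. Qed.

Section RMorLmod.
Variables V W : rmod A.

HB.instance Definition _ := gen_eqMixin (rmor V W).
HB.instance Definition _ := gen_choiceMixin (rmor V W).

Definition rmor0 : rmor V W.
Proof. by exists 0 => v a; rewrite !zero_lfunE mact0. Defined.

Definition rmor_add (f g : rmor V W) : rmor V W.
Proof.
by exists (rfun f + rfun g) => v a; rewrite !add_lfunE !rfunP /mact actDl.
Defined.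

Definition rmor_scale (c : K) (f : rmor V W) : rmor V W.
Proof. by exists (c *: rfun f) => v a; rewrite !scale_lfunE rfunP /mact actZl. Defined.

Fact rmor_addA : associative rmor_add.
Proof. by move=> f g h; apply: rmor_eq => v /=; rewrite addrA. Qed.

Fact rmor_addC : commutative rmor_add.
Proof. by move=> f g; apply: rmor_eq => v /=; rewrite addrC. Qed.

Fact rmor_add0 : left_id rmor0 rmor_add.
Proof. by move=> f; apply: rmor_eq => v /=; rewrite add0r. Qed.

Fact rmor_addN : left_inverse rmor0 (rmor_scale (-1)) rmor_add.
Proof. by move=> f; apply: rmor_eq => v /=; rewrite scaleN1r addNr. Qed.

HB.instance Definition _ := GRing.isZmodule.Build (rmor V W)
  rmor_addA rmor_addC rmor_add0 rmor_addN.

Fact rmor_scaleA a b (f : rmor V W) :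
  rmor_scale a (rmor_scale b f) = rmor_scale (a * b) f.
Proof. by apply: rmor_eq => v /=; rewrite scalerA. Qed.

Fact rmor_scale1 : left_id 1 rmor_scale.
Proof. by move=> f; apply: rmor_eq => v /=; rewrite scale1r. Qed.

Fact rmor_scaleDr : right_distributive rmor_scale +%R.
Proof. by move=> a f g; apply: rmor_eq => v /=; rewrite scalerDr. Qed.

Fact rmor_scaleDl (f : rmor V W) : {morph rmor_scale^~ f : a b / a + b}.
Proof. by move=> a b; apply: rmor_eq => v /=; rewrite scalerDl. Qed.

HB.instance Definition _ := GRing.Zmodule_isLmodule.Build K (rmor V W)
  rmor_scaleA rmor_scale1 rmor_scaleDr rmor_scaleDl.

End RMorLmod.

Definition rmor_id (V : rmod A) : rmor V V.
Proof. by exists \1%VF => v a; rewrite !id_lfunE. Defined.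

Definition rmor_comp (U V W : rmod A) (g : rmor V W) (f : rmor U V) : rmor U W.
Proof. by exists (rfun g \o rfun f)%VF => v a; rewrite !comp_lfunE !rfunP. Defined.

(** A category of all [rmod A] would not be small enough for the morphisms of
    its localization to form an [lmodType], so [mod_cat] is its full subcategory
    of the modules with underlying space [K^n]; by [std_rmodP] the inclusion is
    an equivalence. *)
Record std_rmod := StdRMod {
  sdim : nat;
  sstr : rmod_str A 'rV[K]_sdim
}.

Definition rmod_of (V : std_rmod) : rmod A := RMod (sstr V).

Lemma std_rmodP (V : rmod A) :
  exists (W : std_rmod) (f : rmor (rmod_of W) V), bijective f.
Proof.
pose n := dim V.
pose phi : V -> 'rV[K]_n := v2r.
pose psi : 'rV[K]_n -> V := r2v.
have phiK : cancel phi psi by exact: v2rK.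
have psiK : cancel psi phi by exact: r2vK.
have phiD : {morph phi : x y / x + y} by move=> x y; rewrite /phi linearD.
have phiZ c : {morph phi : x / c *: x} by move=> x; rewrite /phi linearZ.
have psiD : {morph psi : x y / x + y} by move=> x y; rewrite /psi linearD.
have psiZ c : {morph psi : x / c *: x} by move=> x; rewrite /psi linearZ.
pose ac v a := phi (mact (psi v) a).
have ac1 v : ac v (aone A) = v by rewrite /ac /mact act1 psiK.
have acM v a b : ac v (amul a b) = ac (ac v a) b.
  by rewrite /ac /mact phiK actM.
have acDl v w a : ac (v + w) a = ac v a + ac w a.
  by rewrite /ac /mact psiD actDl phiD.
have acDr v a b : ac v (a + b) = ac v a + ac v b.
  by rewrite /ac /mact actDr phiD.
have acZl c v a : ac (c *: v) a = c *: ac v a.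
  by rewrite /ac /mact psiZ actZl phiZ.
have acZr c v a : ac v (c *: a) = c *: ac v a.
  by rewrite /ac /mact actZr phiZ.
pose W := StdRMod (RModStr ac1 acM acDl acDr acZl acZr).
pose f : 'Hom('rV[K]_n, V) := linfun (@r2v K V : {linear 'rV[K]_(dim V) -> V}).
have fE v : f v = psi v by exact: lfunE.
have fP (v : rmod_of W) a : f (mact v a) = mact (f v : V) a.
  by rewrite !fE /mact /= phiK.
exists W, (@RMor (rmod_of W) V f fP); exists phi => v /=.
- by rewrite fE psiK.
- by rewrite fE phiK.
Qed.

Definition mod_cat : kcat K.
Proof.
exists std_rmod (fun V W => rmor (rmod_of V) (rmod_of W) : lmodType K)
  (fun V => rmor_id (rmod_of V)) (fun U V W g f => rmor_comp g f).
- by move=> U V W X h g f; apply: rmor_eq => v; rewrite /= !comp_lfunE.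
- by move=> U V f; apply: rmor_eq => v; rewrite /= comp_lfunE id_lfunE.
- by move=> U V f; apply: rmor_eq => v; rewrite /= comp_lfunE id_lfunE.
- move=> U V W g g' f; apply: rmor_eq => v.
  by rewrite /= !(comp_lfunE, add_lfunE).
- move=> U V W g f f'; apply: rmor_eq => v.
  by rewrite /= !(comp_lfunE, add_lfunE) linearD.
- move=> U V W c g f; apply: rmor_eq => v.
  by rewrite /= !(comp_lfunE, scale_lfunE).
- move=> U V W c g f; apply: rmor_eq => v.
  by rewrite /= !(comp_lfunE, scale_lfunE) linearZ.
Defined.

End ModCat.

(* Main.v *)
(** The t-structure with aisle [{X | Hom(E_i, X[m]) = 0 for m > 0}] has its
    truncation triangles built by hand: coning off one map [E_j[a] -> X], [a >= 0],
    at a time, for [j] from [n] down to [1], terminates because the [Hom]-spaces are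
    finite-dimensional, and strongness keeps the cocone in the aisle. Its heart
    consists of the [X] with [Hom(S, X[m]) = 0] for [m <> 0], and [Hom(S, -)]
    identifies it with [mod-A]; so the realization functor gives an exact functor
    [G : Db(mod-A) -> T].

    Let [P] be a bounded complex of direct summands of powers of [A]. Devissage along
    brutal truncations, first in [Z] and then in [P], shows that homotopy classes of
    chain maps [P -> Z] are the morphisms [G P -> G Z]: for modules placed in single
    degrees this is the equivalence with the heart and the vanishing of
    [Hom(S, X[m])]. Three facts follow without calculus of fractions. A morphism
    [P -> Z] of the derived category is a chain map, since a quasi-isomorphism is
    inverted by [G] and the inverse lifts. The [G P] form a triangulated subcategory
    containing the [E_i], hence are all of [T]. A chain map [p : P -> Z] with [G p]
    invertible is a quasi-isomorphism, by testing on shifts of [A]. Thus lifting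
    objects [X] of [T] to complexes [P] with [G P = X] is a quasi-inverse of [G]. *)

From HB Require Import structures.
From mathcomp Require Import all_boot all_order all_algebra.
From mathcomp Require Import zify boolp.
Require Import Defs.

Set Implicit Arguments.
Unset Strict Implicit.
Unset Printing Implicit Defensive.

Import Order.TTheory GRing.Theory.
Local Open Scope ring_scope.
Local Open Scope kcat_scope.

(** * Linear categories *)

(** Morphisms of [Db] are classes of formal expressions, which cannot be analysed directly. The
    proof is therefore arranged so that only morphisms out of bounded complexes of projectives are
    compared. Ext groups of the heart are never matched with Hom groups of [T], and finite global
    dimension of [A] is never proved. Instead, fullness of the sequence makes every object of [T]
    the image of a complex of projectives. Applied to [G M], this yields a chain map [P -> M]
    inverted by [G], which is a finite projective resolution of [M].

    Each part of the hypothesis on the sequence has its own task in the truncations. Since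
    [End(E_k)] consists of scalars, coning off a nonzero [E_k[a] -> X] creates no new map from a
    shift of [E_k]. The vanishing of Hom from [E_i] to shifts of [E_j] for [j < i] protects the
    indices already treated, and strongness protects the degrees that must not change. Finite
    dimension also bounds the t-structure and provides the finite covers by powers of [S] on which
    the equivalence of the heart with modules rests. *)

Section Kcat.
Variables (K : fieldType) (C : kcat K).
Implicit Types X Y Z W : C.

Lemma compNm X Y Z (g : Mor Y Z) (f : Mor X Y) : (- g) ∘ f = - (g ∘ f).
Proof. by rewrite -scaleN1r compZl scaleN1r. Qed.

Lemma compmN X Y Z (g : Mor Y Z) (f : Mor X Y) : g ∘ (- f) = - (g ∘ f).
Proof. by rewrite -scaleN1r compZr scaleN1r. Qed.

Lemma compBl X Y Z (g g' : Mor Y Z) (f : Mor X Y) :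
  (g - g') ∘ f = g ∘ f - g' ∘ f.
Proof. by rewrite compDl compNm. Qed.

Lemma compBr X Y Z (g : Mor Y Z) (f f' : Mor X Y) :
  g ∘ (f - f') = g ∘ f - g ∘ f'.
Proof. by rewrite compDr compmN. Qed.

Lemma comp_suml X Y Z (n : nat) (g : 'I_n -> Mor Y Z) (f : Mor X Y) :
  (\sum_(i < n) g i) ∘ f = \sum_(i < n) (g i ∘ f).
Proof. by elim/big_rec2: _ => [|i y1 y2 _ <-]; rewrite ?comp0m ?compDl. Qed.

Lemma comp_sumr X Y Z (n : nat) (g : Mor Y Z) (f : 'I_n -> Mor X Y) :
  g ∘ (\sum_(i < n) f i) = \sum_(i < n) (g ∘ f i).
Proof. by elim/big_rec2: _ => [|i y1 y2 _ <-]; rewrite ?compm0 ?compDr. Qed.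

Lemma is_iso_id X : is_iso (idm X).
Proof. by exists (idm X); rewrite comp1m. Qed.

Lemma is_iso_comp X Y Z (g : Mor Y Z) (f : Mor X Y) :
  is_iso g -> is_iso f -> is_iso (g ∘ f).
Proof.
move=> [g' [g'g gg']] [f' [f'f ff']]; exists (f' ∘ g'); split.
- by rewrite compA -(compA f') g'g compm1.
- by rewrite compA -(compA g) ff' compm1.
Qed.

Lemma iso_ob_refl X : iso_ob X X.
Proof. by exists (idm X); exact: is_iso_id. Qed.

Lemma iso_ob_sym X Y : iso_ob X Y -> iso_ob Y X.
Proof. by move=> [f [g [gf fg]]]; exists g, f. Qed.

Lemma iso_ob_trans X Y Z : iso_ob X Y -> iso_ob Y Z -> iso_ob X Z.
Proof. by move=> [f fi] [g gi]; exists (g ∘ f); exact: is_iso_comp. Qed.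

Lemma iso_cancell X Y Z (f : Mor Y Z) (g h : Mor X Y) :
  is_iso f -> f ∘ g = f ∘ h -> g = h.
Proof.
by move=> [f' [f'f _]] /(f_equal (comp f')); rewrite !compA f'f !comp1m.
Qed.

Lemma iso_cancelr X Y Z (f : Mor X Y) (g h : Mor Y Z) :
  is_iso f -> g ∘ f = h ∘ f -> g = h.
Proof.
by move=> [f' [_ ff']] /(f_equal (comp^~ f')); rewrite -!compA ff' !compm1.
Qed.

Definition hom_zero X Y : Prop := forall f : Mor X Y, f = 0.

Lemma hom_zero_isol X X' Y : iso_ob X X' -> hom_zero X Y -> hom_zero X' Y.
Proof. by move=> [f fi] XY g; apply: (iso_cancelr fi); rewrite comp0m. Qed.

Lemma hom_zero_isor X Y Y' : iso_ob Y Y' -> hom_zero X Y -> hom_zero X Y'.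
Proof.
move=> /iso_ob_sym [f fi] XY g; apply: (iso_cancell fi).
by rewrite compm0.
Qed.

Lemma is_zero_idm Z : idm Z = 0 -> is_zero Z.
Proof.
by move=> Z0 X; split=> f; [rewrite -(compm1 f)|rewrite -(comp1m f)];
  rewrite Z0 ?compm0 ?comp0m.
Qed.

Lemma hom_zerol Z X : is_zero Z -> hom_zero Z X.
Proof. by move=> Z0 f; exact: (proj1 (Z0 X)). Qed.

Lemma hom_zeror X Z : is_zero Z -> hom_zero X Z.
Proof. by move=> Z0 f; exact: (proj2 (Z0 X)). Qed.

Lemma is_zero_iso X Y : iso_ob X Y -> is_zero X -> is_zero Y.
Proof.
move=> XY X0; apply: is_zero_idm.
exact: (hom_zero_isol XY (hom_zerol X0)).
Qed.

Lemma iso_zero X Y : is_zero X -> is_zero Y -> iso_ob X Y.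
Proof.
move=> X0 Y0; exists 0, 0.
by rewrite comp0m (hom_zerol X0 (idm X)) comp0m (hom_zerol Y0 (idm Y)).
Qed.

(** [P] is a direct summand of a finite power of [U]. *)
Definition in_add (U P : C) : Prop :=
  exists (m : nat) (s : 'I_m -> Mor U P) (t : 'I_m -> Mor P U),
    \sum_(l < m) (s l ∘ t l) = idm P.

Lemma in_add_self U : in_add U U.
Proof. by exists 1%N, (fun=> idm U), (fun=> idm U); rewrite big_ord1 comp1m. Qed.

Lemma in_add_retract U P Q (i : Mor P Q) (r : Mor Q P) :
  r ∘ i = idm P -> in_add U Q -> in_add U P.
Proof.
move=> ri [m [s [t st]]]; exists m, (fun l => r ∘ s l), (fun l => t l ∘ i).
rewrite (eq_bigr (fun l => r ∘ (s l ∘ t l) ∘ i)) => [|l _]; last by rewrite !compA.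
by rewrite -comp_suml -comp_sumr st compm1.
Qed.

Lemma in_add_iso U P Q : iso_ob P Q -> in_add U Q -> in_add U P.
Proof. by move=> [f [g [gf _]]]; exact: in_add_retract gf. Qed.

Lemma in_add_zero U P : is_zero P -> in_add U P.
Proof.
move=> P0; exists 0%N, (fun=> 0), (fun=> 0).
by rewrite big_ord0 (hom_zerol P0 (idm P)).
Qed.

Lemma in_add_sum U P Q R (i : Mor P R) (j : Mor Q R) (p : Mor R P) (q : Mor R Q) :
  i ∘ p + j ∘ q = idm R -> in_add U P -> in_add U Q -> in_add U R.
Proof.
move=> ijR [m [s [t st]]] [m' [s' [t' st']]].
exists (m + m')%N.
exists (fun l => match split l with inl a => i ∘ s a | inr b => j ∘ s' b end).
exists (fun l => match split l with inl a => t a ∘ p | inr b => t' b ∘ q end).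
rewrite big_split_ord /= -ijR; congr (_ + _).
- rewrite (eq_bigr (fun l => i ∘ (s l ∘ t l) ∘ p)) => [|l _].
    by rewrite -comp_suml -comp_sumr st compm1.
  by rewrite (unsplitK (inl l)) !compA.
- rewrite (eq_bigr (fun l => j ∘ (s' l ∘ t' l) ∘ q)) => [|l _].
    by rewrite -comp_suml -comp_sumr st' compm1.
  by rewrite (unsplitK (inr l)) !compA.
Qed.

Lemma hom_zero_addl U P X : in_add U P -> hom_zero U X -> hom_zero P X.
Proof.
move=> [m [s [t st]]] UX f; rewrite -(compm1 f) -st comp_sumr big1 // => l _.
by rewrite compA (UX (f ∘ s l)) comp0m.
Qed.

Lemma additive_sum2 : additive_cat C -> forall X Y, exists R
    (i : Mor X R) (j : Mor Y R) (p : Mor R X) (q : Mor R Y),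
  [/\ p ∘ i = idm X, q ∘ j = idm Y, q ∘ i = 0, p ∘ j = 0 &
      i ∘ p + j ∘ q = idm R].
Proof.
move=> [_ sum2] X Y; pose F (i : 'I_2) := if i == ord0 then X else Y.
have [R [inj [proj [qi qi0 iqY]]]] := sum2 F.
pose o1 : 'I_2 := lift ord0 ord0.
exists R, (inj ord0), (inj o1), (proj ord0), (proj o1); split.
- exact: (qi ord0).
- exact: (qi o1).
- exact: (qi0 ord0 o1).
- exact: (qi0 o1 ord0).
- by rewrite -iqY big_ord_recl big_ord1.
Qed.

Lemma additive_biproduct : additive_cat C -> forall n (E : 'I_n -> C),
  exists X inj proj, @is_biproduct K C n E X inj proj.
Proof.
move=> addC; have [[Z Z0] _] := addC; elim=> [|n IHn] E.
  have no (T : 'I_0 -> Type) i : T i by case: i.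
  exists Z, (no _), (no _); split=> [[]//|[]//|].
  by rewrite big_ord0 (hom_zerol Z0 (idm Z)).
have [X [inj [proj [pi pi0 ipX]]]] := IHn (fun i => E (lift ord0 i)).
have [Y [j0 [j1 [q0 [q1 [q0j0 q1j1 q1j0 q0j1 jqY]]]]]] :=
  additive_sum2 addC (E ord0) X.
(* The type [Mor (E i) Y] depends on [i], so the split into [ord0] and [lift ord0 k] needs a
   transport along an equation; [I0], [P0], [IS] and [PS] remove it once and for all. *)
pose I (i : 'I_n.+1) : Mor (E i) Y :=
  match unliftP ord0 i in unlift_spec _ _ o with
  | UnliftSome k e => ecast z (Mor (E z) Y) (esym e) (j1 ∘ inj k)
  | UnliftNone e => ecast z (Mor (E z) Y) (esym e) j0
  end.
pose P (i : 'I_n.+1) : Mor Y (E i) :=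
  match unliftP ord0 i in unlift_spec _ _ o with
  | UnliftSome k e => ecast z (Mor Y (E z)) (esym e) (proj k ∘ q1)
  | UnliftNone e => ecast z (Mor Y (E z)) (esym e) q0
  end.
have I0 : I ord0 = j0.
  rewrite /I; case: (unliftP ord0 ord0) => [k e|e]; first by case/eqP: (neq_lift ord0 k).
  by rewrite (eq_irrelevance e erefl).
have P0 : P ord0 = q0.
  rewrite /P; case: (unliftP ord0 ord0) => [k e|e]; first by case/eqP: (neq_lift ord0 k).
  by rewrite (eq_irrelevance e erefl).
have IS k : I (lift ord0 k) = j1 ∘ inj k.
  rewrite /I; case: (unliftP ord0 (lift ord0 k)) => [k' e|e].
    have kk' := lift_inj e; subst k'.
    by rewrite (eq_irrelevance e erefl).
  by case/eqP: (neq_lift ord0 k).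
have PS k : P (lift ord0 k) = proj k ∘ q1.
  rewrite /P; case: (unliftP ord0 (lift ord0 k)) => [k' e|e].
    have kk' := lift_inj e; subst k'.
    by rewrite (eq_irrelevance e erefl).
  by case/eqP: (neq_lift ord0 k).
exists Y, I, P; split=> [i|i j|].
- case: (unliftP ord0 i) => [k ->|->]; rewrite ?I0 ?P0 ?IS ?PS //.
  by rewrite compA -(compA (proj k)) q1j1 compm1.
- case: (unliftP ord0 i) => [k ->|->]; case: (unliftP ord0 j) => [l ->|->];
    rewrite ?I0 ?P0 ?IS ?PS //.
  + move=> kl; rewrite compA -(compA (proj l)) q1j1 compm1 pi0 //.
  + by rewrite compA q0j1 comp0m.
  + by rewrite -compA q1j0 compm0.
- rewrite big_ord_recl I0 P0 -jqY; congr (_ + _).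
  rewrite (eq_bigr (fun l => j1 ∘ (inj l ∘ proj l) ∘ q1)) => [|l _].
    by rewrite -comp_suml -comp_sumr ipX compm1.
  by rewrite IS PS !compA.
Qed.

End Kcat.

Section Functors.
Variables (K : fieldType) (C D : kcat K) (F : functor C D).

Lemma functor0 (X Y : C) : fmap F (0 : Mor X Y) = 0.
Proof.
have := fmapD F (0 : Mor X Y) 0; rewrite addr0 => /(f_equal (+%R^~ (- fmap F 0))).
by rewrite addrK subrr.
Qed.

Lemma functorN (X Y : C) (f : Mor X Y) : fmap F (- f) = - fmap F f.
Proof. by apply/eqP; rewrite -addr_eq0 -fmapD addNr functor0. Qed.

Lemma functorB (X Y : C) (f g : Mor X Y) : fmap F (f - g) = fmap F f - fmap F g.
Proof. by rewrite fmapD functorN. Qed.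

Lemma functor_sum (X Y : C) n (f : 'I_n -> Mor X Y) :
  fmap F (\sum_(i < n) f i) = \sum_(i < n) fmap F (f i).
Proof. by elim/big_rec2: _ => [|i y1 y2 _ <-]; rewrite ?functor0 ?fmapD. Qed.

Lemma functor_iso (X Y : C) (f : Mor X Y) : is_iso f -> is_iso (fmap F f).
Proof. by move=> [g [gf fg]]; exists (fmap F g); rewrite -!fmapM gf fg !fmap1. Qed.

Lemma functor_iso_ob (X Y : C) : iso_ob X Y -> iso_ob (F X) (F Y).
Proof. by move=> [f fi]; exists (fmap F f); exact: functor_iso. Qed.

Lemma functor_zero (Z : C) : is_zero Z -> is_zero (F Z).
Proof. by move=> Z0; apply: is_zero_idm; rewrite -fmap1 (hom_zerol Z0 (idm Z)) functor0. Qed.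

Lemma functor_add (U P : C) : in_add U P -> in_add (F U) (F P).
Proof.
move=> [m [s [t st]]]; exists m, (fun l => fmap F (s l)), (fun l => fmap F (t l)).
by rewrite -fmap1 -st functor_sum; apply: eq_bigr => l _; rewrite fmapM.
Qed.

Definition faithful := forall (X Y : C) (f : Mor X Y), fmap F f = 0 -> f = 0.
Definition full := forall (X Y : C) (g : Mor (F X) (F Y)), exists f, fmap F f = g.

Lemma faithful_inj : faithful ->
  forall (X Y : C) (f g : Mor X Y), fmap F f = fmap F g -> f = g.
Proof. by move=> ff X Y f g fg; apply/subr0_eq/ff; rewrite functorB fg subrr. Qed.

Lemma ff_iso : faithful -> full ->
  forall (X Y : C) (f : Mor X Y), is_iso (fmap F f) -> is_iso f.
Proof.
move=> fa fu X Y f [g [gf fg]]; have [g' g'g] := fu _ _ g.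
exists g'; split; apply: (faithful_inj fa);
  by rewrite fmapM fmap1 g'g.
Qed.

Lemma ff_iso_ob : faithful -> full -> forall X Y : C, iso_ob (F X) (F Y) -> iso_ob X Y.
Proof.
move=> fa fu X Y [g gi]; have [f fg] := fu _ _ g.
by exists f; apply: (ff_iso fa fu); rewrite fg.
Qed.

End Functors.

Section Equivalences.
Variables (K : fieldType) (C D : kcat K) (F : functor C D) (G : functor D C).

Lemma nat_iso_faithful : nat_iso (comp_functor G F) (id_functor C) -> faithful F.
Proof.
move=> [eta [etai etan]] X Y f f0; apply: (iso_cancelr (etai X)).
by have := etan X Y f; rewrite /= f0 functor0 compm0 comp0m.
Qed.

End Equivalences.

(** The preimage is the conjugate of [G g] by [eta]. Naturality identifies its image with [g] only
    after applying [G], and the second isomorphism makes [G] faithful. *)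
Lemma nat_iso_full (K : fieldType) (C D : kcat K) (F : functor C D) (G : functor D C) :
  nat_iso (comp_functor G F) (id_functor C) ->
  nat_iso (comp_functor F G) (id_functor D) -> full F.
Proof.
move=> GF FG X Y g; have [eta [etai etan]] := GF.
have [e [eX1 eX2]] := etai X.
exists (eta Y ∘ fmap G g ∘ e); apply/(faithful_inj (nat_iso_faithful FG)).
apply: (iso_cancell (etai Y)); apply: (iso_cancelr (f := e)).
  by exists (eta X).
by have /= -> := etan _ _ (eta Y ∘ fmap G g ∘ e);
  rewrite -!compA eX2 compm1.
Qed.

(** * Triangles *)

Local Notation "X [1]" := (fob (shift _) X) (at level 8, format "X [1]").
Local Notation "f ⟦1⟧" := (fmap (shift _) f) (at level 8, format "f ⟦1⟧").

Section Triangles.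
Variables (K : fieldType) (T : tridata K) (T_tri : triangulated T).
Implicit Types X Y Z W : T.

Lemma shift_faithful : faithful (shift T).
Proof. exact: (nat_iso_faithful (tri_unshiftK T_tri)). Qed.

Lemma shift_full : full (shift T).
Proof. exact: (nat_iso_full (tri_unshiftK T_tri) (tri_shiftK T_tri)). Qed.

Lemma shift_unshift X : iso_ob (unshift T X)[1] X.
Proof. by have [eta [etai _]] := tri_shiftK T_tri; exists (eta X); exact: etai. Qed.

Lemma dist_rotl X Y Z (f : Mor X Y) (g : Mor Y Z) (h : Mor Z X[1]) :
  dist f g h -> dist g h (- f⟦1⟧).
Proof. by move=> /(tri_rot T_tri). Qed.

Lemma exists_zero : exists Z : T, is_zero Z.
Proof. exact: (proj1 (tri_additive T_tri)). Qed.

Lemma dist_comp0 X Y Z (f : Mor X Y) (g : Mor Y Z) (h : Mor Z X[1]) :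
  dist f g h -> g ∘ f = 0.
Proof.
move=> D; have [O O0] := exists_zero.
have [|c [<- _]] := tri_mor T_tri (a := idm X) (b := f) (tri_id T_tri X O0) D => //.
by rewrite compm0.
Qed.

(** The axiom [dist_mor] supplies a map between third terms, so both the trivial triangle on [W] and
    the given one are rotated. The map found goes from [W[1]] to [X[1]], and fullness of the shift
    brings it back. *)
Lemma dist_lift X Y Z (f : Mor X Y) (g : Mor Y Z) (h : Mor Z X[1]) W (y : Mor W Y) :
  dist f g h -> g ∘ y = 0 -> exists x, f ∘ x = y.
Proof.
move=> D gy0; have [O O0] := exists_zero.
have DW := dist_rotl (tri_id T_tri W O0).
have [|c [_]] := tri_mor T_tri (a := y) (b := 0 : Mor O Z) DW (dist_rotl D).
  by rewrite comp0m.
have [x <-] := shift_full c.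
rewrite fmap1 compmN compm1 compNm -fmapM => /oppr_inj fx.
by exists x; apply: (faithful_inj shift_faithful).
Qed.

Lemma dist_lift2 X Y Z (f : Mor X Y) (g : Mor Y Z) (h : Mor Z X[1]) W (z : Mor W Z) :
  dist f g h -> h ∘ z = 0 -> exists y, g ∘ y = z.
Proof. by move=> /dist_rotl; exact: dist_lift. Qed.

Lemma dist_lift3 X Y Z (f : Mor X Y) (g : Mor Y Z) (h : Mor Z X[1]) W (x : Mor W X[1]) :
  dist f g h -> f⟦1⟧ ∘ x = 0 -> exists z, h ∘ z = x.
Proof.
by move=> /dist_rotl/dist_rotl D fx0; apply: (dist_lift D);
  rewrite compNm fx0 oppr0.
Qed.

Lemma dist_ext_along X Y Z (f : Mor X Y) (g : Mor Y Z) (h : Mor Z X[1]) W (y : Mor Y W) :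
  dist f g h -> y ∘ f = 0 -> exists z, z ∘ g = y.
Proof.
move=> D yf0; have [O O0] := exists_zero.
have DW : dist (0 : Mor O W) (idm W) (0 : Mor W O[1]).
  apply/(tri_rot T_tri); rewrite functor0 oppr0.
  exact: (tri_id T_tri W (functor_zero (shift T) O0)).
have [|c [cg _]] := tri_mor T_tri (a := 0 : Mor X O) (b := y) D DW.
  by rewrite compm0.
by exists c; rewrite cg comp1m.
Qed.

Lemma dist_ext_along2 X Y Z (f : Mor X Y) (g : Mor Y Z) (h : Mor Z X[1]) W
    (z : Mor Z W) :
  dist f g h -> z ∘ g = 0 -> exists x, x ∘ h = z.
Proof. by move=> /dist_rotl; exact: dist_ext_along. Qed.

(** The five lemma by hand: the two halves show that [c ∘ -] is injective and surjective on maps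
    from every [W]. A preimage of the identity is a right inverse, and injectivity makes it
    two-sided. *)
Lemma dist_iso3 X Y Z (f : Mor X Y) (g : Mor Y Z) (h : Mor Z X[1])
    X' Y' Z' (f' : Mor X' Y') (g' : Mor Y' Z') (h' : Mor Z' X'[1])
    (a : Mor X X') (b : Mor Y Y') (c : Mor Z Z') :
  dist f g h -> dist f' g' h' -> is_iso a -> is_iso b ->
  b ∘ f = f' ∘ a -> c ∘ g = g' ∘ b -> a⟦1⟧ ∘ h = h' ∘ c -> is_iso c.
Proof.
move=> D D' ai bi bf cg ah; have a1i := functor_iso (shift T) ai.
have inj W (w : Mor W Z) : c ∘ w = 0 -> w = 0.
  move=> cw0; have hw0 : h ∘ w = 0.
    by apply: (iso_cancell a1i); rewrite compA ah -compA cw0 !compm0.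
  have [y yw] := dist_lift2 D hw0; subst w.
  have [|x' x'y] := dist_lift (y := b ∘ y) D'; first by rewrite compA -cg -compA.
  have [a' [_ aa']] := ai.
  have yE : y = f ∘ (a' ∘ x').
    apply: (iso_cancell bi).
    by rewrite -x'y compA bf !compA -(compA f') aa' compm1.
  by rewrite yE compA (dist_comp0 D) comp0m.
have surj W (w' : Mor W Z') : exists w, c ∘ w = w'.
  have [a1' [_ aa1']] := a1i.
  have [|w hw] := dist_lift3 (x := a1' ∘ (h' ∘ w')) D.
    apply: (iso_cancell (functor_iso (shift T) bi)).
    rewrite compA -fmapM bf fmapM !compA -(compA f'⟦1⟧) aa1' compm1 compm0.
    have := dist_comp0 (dist_rotl (dist_rotl D')).
    rewrite compNm => /(f_equal -%R); rewrite opprK oppr0 => ->.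
    by rewrite comp0m.
  have [|y' gy'] := dist_lift2 (z := c ∘ w - w') D'.
    by rewrite compBr compA -ah -compA hw compA aa1' comp1m subrr.
  have [b' [_ bb']] := bi.
  exists (w - g ∘ (b' ∘ y')).
  by rewrite compBr compA cg compA -(compA g') bb' compm1 gy' opprB addrC subrK.
have [s cs] := surj _ (idm Z').
exists s; split=> //; apply/subr0_eq/inj.
by rewrite compBr compA cs comp1m compm1 subrr.
Qed.

Lemma exists_cocone Y Z (g : Mor Y Z) :
  exists X (f : Mor X Y) (h : Mor Z X[1]), dist f g h.
Proof.
have [C [c [d D]]] := tri_ext T_tri g.
have [i ii] := shift_unshift C; have [j [ji ij]] := ii.
(* Rotation introduces [- f⟦1⟧], so the sign is put into [f] in order to cancel it. *)
have [f fE] := shift_full (- (d ∘ i)).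
exists (unshift T C), f, (j ∘ c); apply/(tri_rot T_tri).
apply: (tri_iso T_tri) D; exists (idm Y), (idm Z), j; split.
  by split; [exact: is_iso_id|exact: is_iso_id|exists i].
by split; rewrite ?comp1m ?compm1 // fmap1 comp1m fE opprK -compA ij compm1.
Qed.

Lemma hom_zero_shift X Y : hom_zero X[1] Y[1] <-> hom_zero X Y.
Proof.
split=> XY f; first by apply: shift_faithful; exact: XY.
by have [g <-] := shift_full f; rewrite (XY g) functor0.
Qed.

Lemma shiftnS a X : iso_ob (shiftn a X)[1] (shiftn (a + 1) X).
Proof.
case: a => n.
  rewrite (_ : Posz n + 1 = Posz n.+1); last by lia.
  exact: iso_ob_refl.
case: n => [|n]; first exact: shift_unshift.
rewrite (_ : Negz n.+1 + 1 = Negz n); last by lia.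
exact: shift_unshift.
Qed.

Lemma shift_reflect X Y : iso_ob X[1] Y[1] -> iso_ob X Y.
Proof. exact: (ff_iso_ob shift_faithful shift_full). Qed.

Lemma shiftn_iso a X Y : iso_ob X Y -> iso_ob (shiftn a X) (shiftn a Y).
Proof.
move=> XY; case: a => n /=; first by elim: n => //= n IHn; exact: functor_iso_ob.
by elim: n => [|n IHn]; apply: functor_iso_ob.
Qed.

(** Since [shiftn] is defined by cases on the sign, consecutive shifts are related by [shiftnS] only
    up to isomorphism. Inductions on a shift thus go one step up or down from [0]. *)
Lemma int_ind2 (P : int -> Prop) :
  P 0 -> (forall a, P a -> P (a + 1)) -> (forall a, P (a + 1) -> P a) ->
  forall a, P a.
Proof.
move=> P0 PS Pp; elim/int_rec=> // n Pn; first by rewrite intS addrC; exact: PS.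
by apply: Pp; rewrite intS opprD addrC addrA subrr add0r.
Qed.

Lemma shiftnD a b X : iso_ob (shiftn a (shiftn b X)) (shiftn (a + b) X).
Proof.
elim/int_ind2: a => [|a IHa|a IHa]; first by rewrite add0r; exact: iso_ob_refl.
- apply: (iso_ob_trans (iso_ob_sym (shiftnS a _))).
  apply: (iso_ob_trans (functor_iso_ob (shift T) IHa)).
  by rewrite addrAC; exact: shiftnS.
- apply: shift_reflect; apply: (iso_ob_trans (shiftnS a _)).
  apply: (iso_ob_trans IHa); rewrite addrAC.
  exact: (iso_ob_sym (shiftnS _ _)).
Qed.

Lemma hom_zero_shiftnS a b X Y :
  hom_zero (shiftn (a + 1) X) (shiftn (b + 1) Y) <->
  hom_zero (shiftn a X) (shiftn b Y).
Proof.
apply: iff_trans (hom_zero_shift _ _); split=> XY.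
- apply: hom_zero_isol (iso_ob_sym (shiftnS a X)) _.
  exact: hom_zero_isor (iso_ob_sym (shiftnS b Y)) _.
- apply: hom_zero_isol (shiftnS a X) _.
  exact: hom_zero_isor (shiftnS b Y) _.
Qed.

Lemma hom_zero_shiftn c a b X Y :
  hom_zero (shiftn (a + c) X) (shiftn (b + c) Y) <->
  hom_zero (shiftn a X) (shiftn b Y).
Proof.
elim/int_ind2: c => [|c IHc|c <-]; first by rewrite !addr0.
- by rewrite !addrA hom_zero_shiftnS.
- by rewrite !addrA hom_zero_shiftnS.
Qed.

Lemma hom_zero_shiftr a W Y :
  hom_zero (shiftn (a + 1) W) Y[1] <-> hom_zero (shiftn a W) Y.
Proof. exact: (@hom_zero_shiftnS a 0 W Y). Qed.

Lemma shift_linear_bij X Y :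
  exists f : {linear Mor X Y -> Mor X[1] Y[1]}, bijective f.
Proof.
pose f (x : Mor X Y) : Mor X[1] Y[1] := x⟦1⟧.
have fL : linear f by move=> c x y; rewrite /f fmapD (tri_shift_lin T_tri).
pose fl : {linear _ -> _} := HB.pack f (GRing.isLinear.Build _ _ _ _ f fL).
exists fl; pose g y := sval (cid (@shift_full X Y y)).
have fg : cancel g fl by move=> y; rewrite /g; case: cid.
exists g => // x; apply: (faithful_inj shift_faithful).
exact: fg.
Qed.

End Triangles.

(** * Linear isomorphisms between Hom-spaces *)

Section LmodIso.
Variable K : fieldType.

Lemma lmod_iso_sym (U V : lmodType K) : lmod_iso U V -> lmod_iso V U.
Proof.
move=> [f [g fg gf]]; have gL : linear g.
  by move=> c x y; apply: (can_inj fg); rewrite gf linearP !gf.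
by exists (HB.pack g (GRing.isLinear.Build _ _ _ _ g gL) : {linear _ -> _}), f.
Qed.

Lemma lmod_iso_trans (U V W : lmodType K) : lmod_iso U V -> lmod_iso V W -> lmod_iso U W.
Proof.
move=> [f fb] [g gb]; exists (g \o f : {linear _ -> _}).
exact: bij_comp.
Qed.

Lemma hom_lmod_iso (C : kcat K) (X X' Y Y' : C) :
  iso_ob X X' -> iso_ob Y Y' -> lmod_iso (Mor X Y) (Mor X' Y').
Proof.
move=> [f [f' [f'f ff']]] [g [g' [g'g gg']]].
pose h (x : Mor X Y) : Mor X' Y' := g ∘ x ∘ f'.
have hL : linear h by move=> c x y; rewrite /h compDr compDl compZr compZl.
exists (HB.pack h (GRing.isLinear.Build _ _ _ _ h hL) : {linear _ -> _}).
exists (fun x => g' ∘ x ∘ f) => x /=; rewrite /h.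
- by rewrite !compA g'g comp1m -compA f'f compm1.
- by rewrite !compA gg' comp1m -compA ff' compm1.
Qed.

Lemma hom_shiftn_iso (T : tridata K) (T_tri : triangulated T) (X Y : T) (c a b : int) :
  lmod_iso (Mor (shiftn a X) (shiftn b Y)) (Mor (shiftn (a + c) X) (shiftn (b + c) Y)).
Proof.
have step a' b' : lmod_iso (Mor (shiftn a' X) (shiftn b' Y))
    (Mor (shiftn (a' + 1) X) (shiftn (b' + 1) Y)).
  apply: lmod_iso_trans (shift_linear_bij T_tri _ _) _.
  exact: hom_lmod_iso (shiftnS T_tri _ _) (shiftnS T_tri _ _).
elim/int_ind2: c => [|c IHc|c IHc].
- by rewrite !addr0; apply: hom_lmod_iso; exact: iso_ob_refl.
- by rewrite !addrA; exact: lmod_iso_trans IHc (step _ _).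
- apply: lmod_iso_trans IHc _; rewrite !addrA.
  exact: lmod_iso_sym (step _ _).
Qed.

End LmodIso.

(** * The t-structure of a strong exceptional sequence *)

Lemma family_at (K : fieldType) (V : int -> lmodType K) (a : int) (v : V a) :
  exists w : forall i, V i, w a = v /\ forall i, i != a -> w i = 0.
Proof.
exists (fun i => if i =P a is ReflectT e then ecast j (V j) (esym e) v else 0).
split=> [|i ia]; first by case: eqP => // e; rewrite (eq_irrelevance e erefl).
by case: eqP => // e; rewrite e eqxx in ia.
Qed.

Section FinDim.
Variables (K : fieldType) (V : int -> lmodType K).

Lemma fin_supp_at a (w : forall i, V i) : (forall i, i != a -> w i = 0) -> fin_supp w.
Proof.
by move=> w0; exists `|a|%N => i ai; apply: w0; apply: contraTneq ai => ->; rewrite ltnn.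
Qed.

Lemma dsum_fin_dim_at : dsum_fin_dim V -> exists (m N : nat) (b : 'I_m -> forall i, V i),
  (forall k i, (N < `|i|)%N -> b k i = 0) /\
  forall i (v : V i), exists c : 'I_m -> K, v = \sum_(k < m) c k *: b k i.
Proof.
move=> [m [b [bfin bspan]]]; pose N k := sval (cid (bfin k)).
have NP k i : (N k < `|i|)%N -> b k i = 0 by rewrite /N; case: cid => M /= bM; exact: bM.
exists m, (\max_(k < m) N k)%N, b; split=> [k i Ni|i v].
  by apply: NP; apply: leq_ltn_trans Ni; exact: leq_bigmax.
have [w [wi w0]] := family_at v.
have [c cE] := bspan w (fin_supp_at w0).
by exists c; rewrite -wi cE.
Qed.

Lemma dsum_fin_dim_bounded : dsum_fin_dim V ->
  exists N : nat, forall i, (N < `|i|)%N -> forall v : V i, v = 0.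
Proof.
move=> /dsum_fin_dim_at [m [N [b [b0 bspan]]]]; exists N => i Ni v.
have [c ->] := bspan i v.
by rewrite big1 // => k _; rewrite b0 ?scaler0.
Qed.

End FinDim.

Section TStructure.
Variables (K : fieldType) (T : tridata K) (T_tri : triangulated T).
Variables (n : nat) (E : 'I_n -> T).
Hypotheses (E_exc : exceptional_sequence E) (E_full : full_sequence E)
           (E_strong : strong_sequence E)
           (T_fin : forall X Y : T, dsum_fin_dim (fun i : int => Mor X (shiftn i Y))).
Implicit Types X Y Z : T.

(** [Es i a] is [E_i[a]], so maps [Es i a -> X] are maps [E_i -> X[-a]]. *)
Definition Es (i : 'I_n) (a : int) : T := shiftn a (E i).

Lemma Es_strong i j a b : a != b -> hom_zero (Es i a) (Es j b).
Proof.
move=> ab; have := proj2 (hom_zero_shiftn T_tri a 0 (b - a) (E i) (E j)).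
rewrite add0r subrK; apply; apply: E_strong.
by rewrite subr_eq0 eq_sym.
Qed.

Lemma Es_exc (i j : 'I_n) a b : (j < i)%N -> hom_zero (Es i a) (Es j b).
Proof.
move=> ji; have := proj2 (hom_zero_shiftn T_tri a 0 (b - a) (E i) (E j)).
by rewrite add0r subrK; apply; apply: (proj2 E_exc).
Qed.

Lemma Es_shift i a : iso_ob (Es i a)[1] (Es i (a + 1)).
Proof. exact: shiftnS. Qed.

Lemma hom_zero_strong_shift i j a b : b != a + 1 -> hom_zero (Es i b) (Es j a)[1].
Proof. by move=> ba; exact: (hom_zero_isor (iso_ob_sym (Es_shift j a)) (Es_strong ba)). Qed.

Lemma hom_zero_exc_shift (i j : 'I_n) a b : (j < i)%N -> hom_zero (Es i b) (Es j a)[1].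
Proof. by move=> ji; exact: (hom_zero_isor (iso_ob_sym (Es_shift j a)) (Es_exc ji)). Qed.

Lemma Es_end i a (f : Mor (Es i a) (Es i a)) : exists c, f = c *: idm _.
Proof.
have : lmod_iso K^o (Mor (Es i a) (Es i a)).
  apply: lmod_iso_trans (proj1 (proj1 E_exc i)) _.
  have := hom_shiftn_iso T_tri (E i) (E i) a 0 0.
  by rewrite add0r.
move=> [phi [psi phiK psiK]]; pose u : K := psi (idm _); pose v : K := psi f.
have [u0|u0] := eqVneq u 0.
  exists 0; rewrite scale0r -(compm1 f) -(psiK (idm _)) -/u u0.
  by rewrite (_ : phi 0 = 0) ?compm0 ?linear0.
exists (v / u).
have -> : f = phi ((v / u) *: (u : K^o)) by rewrite /GRing.scale /= divfK // psiK.
by rewrite linearZ /= psiK.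
Qed.

(** A nonzero [r] forces [b = a + 1], and then [r] is a scalar multiple of an isomorphism because
    [End(E_k)] is one-dimensional; so [f⟦1⟧ ∘ r = 0] would give [f = 0]. This makes every map from a
    shift of [E_k] to the cone of [f] lift to [X]. *)
Lemma Es_connecting k a b X (f : Mor (Es k a) X) (r : Mor (Es k b) (Es k a)[1]) :
  f != 0 -> f⟦1⟧ ∘ r = 0 -> r = 0.
Proof.
move=> f0 fr0; have [ba|] := eqVneq b (a + 1); last by move=> /hom_zero_strong_shift; apply.
subst b; have [i [j [ji ij]]] := Es_shift k a.
have [c cE] := Es_end (i ∘ r).
have rE : r = c *: j by rewrite -(comp1m r) -ji -compA cE compZr compm1.
have [c0|c0] := eqVneq c 0; first by rewrite rE c0 scale0r.
case/eqP: f0; apply: (shift_faithful T_tri).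
apply: (iso_cancelr (f := j)); first by exists i.
apply: (@scalerI _ _ c) => //.
by rewrite -compZr -rE fr0 comp0m scaler0.
Qed.

Definition Es_le0 X : Prop := forall i a, a < 0 -> hom_zero (Es i a) X.
(** Orthogonality is only asked against the generators [E_i[a]] with [a >= 0]; [Es_le0_ge1] extends
    it to the whole aisle. *)
Definition Es_ge1 X : Prop := forall i a, 0 <= a -> hom_zero (Es i a) X.

(** The maps [X -> B] whose cocone lies in [Es_le0] and which are universal
    for maps to [Es_ge1]. *)
Definition approx X B (g : Mor X B) : Prop :=
  [/\ forall i a (x : Mor (Es i a) X), a < 0 -> g ∘ x = 0 -> x = 0,
      forall i a (z : Mor (Es i a) B), a <= 0 -> exists x, g ∘ x = z &
      forall Y (y : Mor X Y), Es_ge1 Y -> exists z, z ∘ g = y].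

Lemma approx_id X : approx (idm X).
Proof.
split=> [i a x _|i a z _|Y y _]; first by rewrite comp1m.
- by exists z; rewrite comp1m.
- by exists y; rewrite compm1.
Qed.

Lemma approx_comp X Y Z (g : Mor Y Z) (f : Mor X Y) :
  approx f -> approx g -> approx (g ∘ f).
Proof.
move=> [f1 f2 f3] [g1 g2 g3]; split=> [i a x a0|i a z a0|W y W1].
- by rewrite -compA => /(g1 _ _ _ a0)/(f1 _ _ _ a0).
- have [y <-] := g2 _ _ z a0; have [x <-] := f2 _ _ y a0.
  by exists x; rewrite compA.
- have [z <-] := f3 _ y W1; have [w <-] := g3 _ z W1.
  by exists w; rewrite compA.
Qed.

(** By strongness, maps from [Es i b] to [Es k a] live in [b = a], and those to its shift in
    [b = a + 1]. With [0 <= a], the former miss [b < 0] and the latter miss [b <= 0], which explains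
    the two different bounds in [approx]. The third clause is [Es_connecting], the fourth the
    vanishing in an exceptional sequence. *)
Lemma approx_cone X k a (f : Mor (Es k a) X) : 0 <= a -> f != 0 ->
  exists B (g : Mor X B),
  [/\ approx g, g ∘ f = 0,
      forall b (z : Mor (Es k b) B), exists x, g ∘ x = z &
      forall (i : 'I_n) b, (k < i)%N -> hom_zero (Es i b) X -> hom_zero (Es i b) B].
Proof.
move=> a0 f0; have [B [g [h D]]] := tri_ext T_tri f.
exists B, g; split.
- split=> [i b x b0|i b z b0|Y y Y1].
  + move=> /(dist_lift T_tri D) [y <-].
    by rewrite (Es_strong (a := b) _ y) ?compm0 //; lia.
  + apply: (dist_lift2 T_tri D); apply: hom_zero_strong_shift; lia.
  + by apply: (dist_ext_along T_tri D); apply: Y1.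
- exact: (dist_comp0 T_tri D).
- move=> b z; apply: (dist_lift2 T_tri D); apply: (Es_connecting f0).
  have := dist_comp0 T_tri (dist_rotl T_tri (dist_rotl T_tri D)).
  by rewrite compNm compA => /(f_equal -%R); rewrite opprK oppr0 => ->; rewrite comp0m.
- move=> i b ki X0 z; have [|x <-] := dist_lift2 T_tri D (z := z).
    exact: hom_zero_exc_shift.
  by rewrite (X0 x) compm0.
Qed.

(** The maps [el i] with [i] in [s] span [Hom(E_k[a], X)] for every [a >= 0]. An
    induction principle over all degrees avoids comparing spans across degrees. *)
Definition spanned k (I : eqType) (deg : I -> int) (s : seq I) X
    (el : forall i, Mor (Es k (deg i)) X) : Prop :=
  forall P : (forall a, Mor (Es k a) X -> Prop),
    (forall a, P a 0) -> (forall a c x y, P a x -> P a y -> P a (c *: x + y)) ->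
    (forall i, i \in s -> P (deg i) (el i)) -> forall a, 0 <= a -> forall x, P a x.

Lemma exists_spanned k X : exists (I : eqType) (deg : I -> int) (s : seq I)
    (el : forall i, Mor (Es k (deg i)) X),
  spanned s el /\ forall i, 0 <= deg i.
Proof.
have [m [N [b [b0 bspan]]]] := dsum_fin_dim_at (T_fin (E k) X).
have iso a : lmod_iso (Mor (E k) (shiftn (- a) X)) (Mor (Es k a) X).
  by have := hom_shiftn_iso T_tri (E k) X a 0 (- a); rewrite add0r addNr.
pose phi a := sval (cid (iso a)).
have phi_bij a : bijective (phi a) := svalP (cid (iso a)).
(* One element for each generating family and each degree from [0] to [N]: [spanned] concerns
   [a >= 0], and the families vanish beyond [N]. *)
exists ('I_m * 'I_N.+1)%type, (fun p : 'I_m * 'I_N.+1 => Posz p.2), (enum {: 'I_m * 'I_N.+1}).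
exists (fun p : 'I_m * 'I_N.+1 => phi (Posz p.2) (b p.1 (- Posz p.2))); split=> // P P0 PD PE.
move=> [a|//] _ x; have [psi psiK psiK'] := phi_bij a.
rewrite -(psiK' x); have [c ->] := bspan _ (psi x).
rewrite linear_sum /=; elim/big_rec: _ => // q y _ Py.
rewrite linearZ; apply: PD => //.
have [aN|aN] := ltnP a N.+1; last by rewrite b0 ?linear0 // abszN.
exact: (PE (q, Ordinal aN)) (mem_enum _ _).
Qed.

(** Coning off [E_k[a] -> X] creates no maps from [E_i] for [i > k], so the [E_k]
    are treated in decreasing order of [k]; each cone shortens the spanning list. *)
Lemma approx_kill (k : 'I_n) X : (forall (i : 'I_n) a, (k < i)%N -> 0 <= a -> hom_zero (Es i a) X) ->
  exists B (g : Mor X B), approx g /\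
    forall (i : 'I_n) a, (k <= i)%N -> 0 <= a -> hom_zero (Es i a) B.
Proof.
have [I [deg [s [el [sp deg0]]]]] := exists_spanned k X.
elim: s X el sp => [|j s IHs] X el sp X0.
  exists X, (idm X); split=> [|i a]; first exact: approx_id.
  rewrite leq_eqVlt => /orP[/eqP/val_inj <-|]; last exact: X0.
  move=> a0; apply: (sp (fun a x => x = 0)) => // a' c x y -> ->.
  by rewrite scaler0 addr0.
have [el0|el0] := eqVneq (el j) 0.
  apply: (IHs X el) => // P P0 PD PE; apply: sp => // i.
  by rewrite inE => /orP[/eqP ->|/PE //]; rewrite el0.
have [X1 [g [ga gel gsurj gvan]]] := approx_cone (deg0 j) el0.
have [||B [h [ha B0]]] := IHs X1 (fun i => g ∘ el i).
- move=> P P0 PD PE a a0 z; have [x <-] := gsurj _ z.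
  apply: (sp (fun a x => P a (g ∘ x))) => // [a'|a' c x' y Px Py|i].
  + by rewrite compm0.
  + by rewrite compDr compZr; apply: PD.
  + by rewrite inE => /orP[/eqP ->|/PE //]; rewrite gel.
- by move=> i a ki a0; apply: gvan => //; apply: X0.
by exists B, (h ∘ g); split=> //; exact: approx_comp.
Qed.

Lemma exists_approx X : exists B (g : Mor X B), approx g /\ Es_ge1 B.
Proof.
have main m : (m <= n)%N -> exists B (g : Mor X B), approx g /\
    forall (i : 'I_n) a, (n - m <= i)%N -> 0 <= a -> hom_zero (Es i a) B.
  elim: m => [|m IHm] mn.
    exists X, (idm X); split=> [|i a]; first exact: approx_id.
    by rewrite subn0 leqNgt ltn_ord.
  have [B [g [ga B0]]] := IHm (ltnW mn).
  have kn : (n - m.+1 < n)%N by lia.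
  have [|B' [g' [ga' B'0]]] := @approx_kill (Ordinal kn) B.
    by move=> i a /= ki; apply: B0; lia.
  by exists B', (g' ∘ g); split=> [|i a]; [exact: approx_comp|exact: B'0].
have [B [g [ga B0]]] := main n (leqnn n).
by exists B, g; split=> // i a; apply: B0; rewrite subnn.
Qed.

(** The objects with no nonzero map to any shift of [B] form a triangulated subcategory containing
    all [E_i]. Fullness puts [B] itself into it, so the identity of [B] is zero. *)
Lemma Es_generate B : (forall i a, hom_zero (Es i a) B) -> is_zero B.
Proof.
move=> B0.
have tr X Y b : hom_zero X[1] (shiftn (b + 1) Y) <-> hom_zero X (shiftn b Y).
  exact: (hom_zero_shiftnS T_tri 0 b X Y).
pose P X := forall b, hom_zero X (shiftn b B).
have Piso : iso_closed P by move=> X Y XY PX b; exact: hom_zero_isol XY (PX b).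
have Pzero Z : is_zero Z -> P Z by move=> Z0 b; exact: hom_zerol.
have Pshift X : P X -> P X[1] by move=> PX b; rewrite -(subrK 1 b) tr.
have Punshift X : P X -> P (unshift T X).
  move=> PX b; rewrite -tr; apply: hom_zero_isol (iso_ob_sym (shift_unshift T_tri X)) _.
  exact: PX.
have Pcone X Y Z (f : Mor X Y) (g : Mor Y Z) (h : Mor Z X[1]) :
    dist f g h -> P X -> P Y -> P Z.
  move=> D PX PY b z; have [|x <-] := dist_ext_along2 T_tri D (z := z); first exact: PY.
  by rewrite (Pshift _ PX b x) comp0m.
have PE i : P (E i).
  move=> b; have := proj1 (hom_zero_shiftn T_tri (- b) 0 b (E i) B).
  by rewrite add0r subrr; apply; exact: B0.
have PB : P B := @E_full (TriSubcat Piso Pzero Pshift Punshift Pcone) PE B.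
by apply: is_zero_idm; exact: (PB (0 : int) (idm B)).
Qed.

(** Any such map factors through the approximation [B] of [X]. Maps [E_i[a] -> B] vanish for
    [a >= 0] by construction, and for [a < 0] because they lift to [X]; hence [B] is zero. *)
Lemma Es_le0_ge1 X Y : Es_le0 X -> Es_ge1 Y -> hom_zero X Y.
Proof.
move=> X0 Y1 y; have [B [g [[_ gsurj gfac] B1]]] := exists_approx X.
have [z <-] := gfac _ y Y1.
suff B0 : is_zero B by rewrite (hom_zerol B0 z) comp0m.
apply: Es_generate => i a b; have [a0|a0] := leP 0 a; first exact: B1.
have [x <-] := gsurj _ _ b (ltW a0).
by rewrite (X0 _ _ a0 x) compm0.
Qed.

Lemma Es_truncate X : exists A B (f : Mor A X) (g : Mor X B) (h : Mor B A[1]),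
  [/\ dist f g h, Es_le0 A & Es_ge1 B].
Proof.
have [B [g [[ginj gsurj _] B1]]] := exists_approx X.
have [A [f [h D]]] := exists_cocone T_tri g.
exists A, B, f, g, h; split=> // i a a0 x.
have fx0 : f ∘ x = 0.
  by apply: (ginj _ _ _ a0); rewrite compA (dist_comp0 T_tri D) comp0m.
apply: (shift_faithful T_tri).
have [|z hz] := dist_lift3 T_tri D (x := x⟦1⟧); first by rewrite -fmapM fx0 functor0.
have [i1 [j1 [ji ij]]] := Es_shift i a.
(* Here [a < 0] only gives [a + 1 <= 0], which is why [approx] requires surjectivity in degree [0]
   as well. *)
have [|y gy] := gsurj i (a + 1) (z ∘ j1); first by lia.
rewrite -hz -(compm1 z) -ji (compA z) -gy !compA (_ : h ∘ g = 0) ?comp0m //.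
exact: (dist_comp0 T_tri (dist_rotl T_tri D)).
Qed.

Lemma Es_bounded X : exists N : nat, forall i a, (N < `|a|)%N -> hom_zero (Es i a) X.
Proof.
have bd i : exists N : nat, forall a, (N < `|a|)%N -> hom_zero (Es i a) X.
  have [N NP] := dsum_fin_dim_bounded (T_fin (E i) X).
  exists N => a Na; have := proj2 (hom_zero_shiftn T_tri a 0 (- a) (E i) X).
  by rewrite add0r addNr; apply; apply: NP; rewrite abszN.
exists (\max_(i < n) sval (cid (bd i)))%N => i a Na.
apply: (svalP (cid (bd i))); apply: leq_ltn_trans Na.
exact: (leq_bigmax (F := fun i => sval (cid (bd i)))).
Qed.

End TStructure.

(** * The heart *)

Section ShiftFunctor.
Variables (K : fieldType) (T : tridata K).

Fixpoint iter_map (F : functor T T) n (X Y : T) (f : Mor X Y) :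
    Mor (iter n F X) (iter n F Y) :=
  if n is m.+1 then fmap F (iter_map F m f) else f.

Definition shiftn_map a (X Y : T) : Mor X Y -> Mor (shiftn a X) (shiftn a Y) :=
  match a return Mor X Y -> Mor (shiftn a X) (shiftn a Y) with
  | Posz n => @iter_map (shift T) n X Y
  | Negz n => @iter_map (unshift T) n.+1 X Y
  end.

Lemma iter_map1 F n (X : T) : iter_map F n (idm X) = idm _.
Proof. by elim: n => //= n ->; rewrite fmap1. Qed.

Lemma iter_mapM F n (X Y Z : T) (g : Mor Y Z) (f : Mor X Y) :
  iter_map F n (g ∘ f) = iter_map F n g ∘ iter_map F n f.
Proof. by elim: n => //= n ->; rewrite fmapM. Qed.

Lemma iter_mapD F n (X Y : T) (f g : Mor X Y) :
  iter_map F n (f + g) = iter_map F n f + iter_map F n g.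
Proof. by elim: n => //= n ->; rewrite fmapD. Qed.

Definition shiftn_functor (a : int) : functor T T.
Proof.
exists (shiftn a) (shiftn_map a).
- by case: a => m X; exact: iter_map1.
- by case: a => m X Y Z g f; exact: iter_mapM.
- by case: a => m X Y f g; exact: iter_mapD.
Defined.

Lemma hom_zero_biproduct n (E : 'I_n -> T) (S : T) inj proj a X :
  @is_biproduct K T n E S inj proj ->
  hom_zero (shiftn a S) X <-> forall i, hom_zero (shiftn a (E i)) X.
Proof.
have F1 Y : idm (shiftn a Y) = fmap (shiftn_functor a) (idm Y) by rewrite fmap1.
move=> [pi _ ip]; split=> [SX i f|EX f].
  rewrite -(compm1 f) F1 -(pi i) fmapM compA.
  by rewrite (SX (f ∘ fmap (shiftn_functor a) (proj i))) comp0m.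
rewrite -(compm1 f) F1 -ip functor_sum comp_sumr.
rewrite big1 // => i _; rewrite fmapM compA.
by rewrite (EX i (f ∘ fmap (shiftn_functor a) (inj i))) comp0m.
Qed.

(** The hypothesis [realized] speaks of full triangulated subcategories, so [T] is viewed as the
    subcategory of all its objects. Objects become pairs, while morphisms stay the same. *)
Definition all_sub : tri_subcat T.
Proof. by exists (fun=> True). Defined.

Definition to_all (X : T) : sub_tridata all_sub := exist _ X I.

Lemma sval_shiftn a (X : sub_tridata all_sub) : sval (shiftn a X) = shiftn a (sval X).
Proof.
by case: a => m; [|rewrite /shiftn]; elim: m => //= m IHm; rewrite -IHm.
Qed.

Lemma iso_ob_all (X Y : sub_tridata all_sub) : iso_ob X Y <-> iso_ob (sval X) (sval Y).
Proof. by []. Qed.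

End ShiftFunctor.

Section Heart.
Variables (K : fieldType) (T : tridata K) (T_tri : triangulated T).
Variables (n : nat) (E : 'I_n -> T).
Hypotheses (E_exc : exceptional_sequence E) (E_full : full_sequence E)
           (E_strong : strong_sequence E)
           (T_fin : forall X Y : T, dsum_fin_dim (fun i : int => Mor X (shiftn i Y))).
Variables (S : T) (inj : forall i : 'I_n, Mor (E i) S)
          (proj : forall i : 'I_n, Mor S (E i)).
Hypothesis S_sum : is_biproduct inj proj.
Implicit Types X Y Z : T.

Definition le0_all (X : sub_tridata (all_sub T)) : Prop := Es_le0 E (sval X).

Lemma le0_all_tstructure : t_structure le0_all.
Proof.
split=> [X Y XY X0 i a a0|X X0 i a a0|X].
- exact: (hom_zero_isor (proj1 (iso_ob_all _ _) XY) (X0 i a a0)).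
- rewrite -(subrK 1 a); apply/(hom_zero_shiftr T_tri); apply: X0; lia.
- have [A [B [f [g [h [D A0 B1]]]]]] :=
    Es_truncate T_tri E_exc E_strong T_fin (sval X).
  exists (to_all A), (to_all B), f, g, h; split=> // Y Y0.
  exact: (Es_le0_ge1 T_tri E_exc E_full E_strong T_fin Y0 B1).
Qed.

Lemma hom_zero_EsD a b i X : hom_zero (Es E i a) (shiftn b X) <-> hom_zero (Es E i (a - b)) X.
Proof.
have := hom_zero_shiftn T_tri b (a - b) 0 (E i) X.
by rewrite subrK add0r.
Qed.

Lemma le0_all_bounded : t_bounded le0_all.
Proof.
move=> X; have [N NP] := Es_bounded T_tri E T_fin (sval X).
have iso a b : a = - b -> iso_ob (sval X) (shiftn a (shiftn b (sval X))).
  move=> ->; apply: iso_ob_sym; have := shiftnD T_tri (- b) b (sval X).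
  by rewrite addNr.
exists (Posz N), (- Posz N); split.
- exists (to_all (shiftn N (sval X))); split=> [i a a0|].
    by apply/hom_zero_EsD; apply: NP; lia.
  by apply/iso_ob_all; rewrite sval_shiftn; exact: (iso _ _ erefl).
(* The extra [-1] matches the [+1] in [t_ge]: for [a >= 0] the relevant degree is [a + N + 1], which
   exceeds the bound [N]. *)
- exists (to_all (shiftn (- Posz N - 1) (sval X))); split=> [Y Y0|].
    apply: (Es_le0_ge1 T_tri E_exc E_full E_strong T_fin Y0) => i a a0.
    by apply/hom_zero_EsD; apply: NP; lia.
  by apply/iso_ob_all; rewrite sval_shiftn; apply: (iso (- - Posz N + 1) (- Posz N - 1)); lia.
Qed.

Definition heart X : Prop := forall a, a != 0 -> hom_zero (shiftn a S) X.

Lemma heartE X : heart X <-> forall i a, a != 0 -> hom_zero (Es E i a) X.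
Proof.
split=> [hX i a a0|hX a a0]; first exact: (proj1 (hom_zero_biproduct a X S_sum) (hX a a0) i).
by apply/(hom_zero_biproduct _ _ S_sum) => i; exact: hX.
Qed.

Lemma heart_summand i : heart (E i).
Proof. by apply/heartE => j a a0; apply: (Es_strong T_tri E_strong (b := 0)). Qed.

Lemma heart_generator : heart S.
Proof.
move=> a a0 f; rewrite -(comp1m f) -(let: And3 _ _ e := S_sum in e) comp_suml big1 // => i _.
by rewrite -compA (heart_summand a0 (proj i ∘ f)) compm0.
Qed.

(** The desuspension of [Y] lies in [Es_ge1]. In a triangle [N -> Q -> X -> N[1]] this kills the
    maps [X -> Y] that factor through [N[1]], so maps out of [X] are determined on [Q]. *)
Lemma heart_orth X Y : Es_le0 E X -> heart Y -> hom_zero X[1] Y.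
Proof.
move=> X0 /heartE hY; apply: (hom_zero_isor (shift_unshift T_tri Y)).
apply/(hom_zero_shift T_tri); apply: (Es_le0_ge1 T_tri E_exc E_full E_strong T_fin X0).
move=> i a a0; apply/(hom_zero_shiftr T_tri).
by apply: (hom_zero_isor (iso_ob_sym (shift_unshift T_tri Y))); apply: hY; lia.
Qed.

Lemma in_heart_all (X : sub_tridata (all_sub T)) : in_heart le0_all X <-> heart (sval X).
Proof.
have Es1 i a Y : hom_zero (Es E i a) Y[1] <-> hom_zero (Es E i (a - 1)) Y.
  by have := hom_zero_shiftr T_tri (a - 1) (E i) Y; rewrite subrK.
split=> [[[Y [Y0 XY]] [Z [Z1 XZ]]]|/heartE hX].
  have YX : iso_ob (sval Y) (sval X) := iso_ob_sym XY.
  have ZX : iso_ob (sval Z)[1] (sval X) := iso_ob_sym XZ.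
  apply/heartE => i a a0; have [a_lt|a_gt] : a < 0 \/ 0 < a by lia.
    exact: (hom_zero_isor YX (Y0 i a a_lt)).
  apply: (hom_zero_isor ZX); apply/Es1 => f.
  apply: (Z1 (to_all (Es E i (a - 1)))) => j b b0.
  by apply: (Es_strong T_tri E_strong); lia.
split.
- exists X; split; last exact: iso_ob_refl.
  by move=> i a a0; apply: hX; lia.
- exists (to_all (unshift T (sval X))); split; last first.
    exact: (iso_ob_sym (shift_unshift T_tri (sval X))).
  move=> Y Y0; apply: (Es_le0_ge1 T_tri E_exc E_full E_strong T_fin Y0) => i a a0.
  apply/(hom_zero_shiftr T_tri).
  apply: (hom_zero_isor (iso_ob_sym (shift_unshift T_tri (sval X)))).
  by apply: hX; lia.
Qed.

Lemma heart_fin X : exists m (b : 'I_m -> Mor S X),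
  forall v, exists c : 'I_m -> K, v = \sum_(l < m) c l *: b l.
Proof.
have [m [N [b [_ bspan]]]] := dsum_fin_dim_at (T_fin S X).
by exists m, (fun l => b l 0) => v; exact: (bspan 0 v).
Qed.

Lemma heart_sum m Q (s : 'I_m -> Mor S Q) (t : 'I_m -> Mor Q S) :
  \sum_(l < m) (s l ∘ t l) = idm Q -> heart Q.
Proof.
move=> st a a0 f; rewrite -(comp1m f) -st comp_suml big1 // => l _.
by rewrite -compA (heart_generator a0 (t l ∘ f)) compm0.
Qed.

(** [Q] is the power of [S] indexed by a finite generating family of [Hom(S, X)]. Surjectivity of
    [p] on maps from [S] is what keeps the cocone [N] in the heart, so that [p] behaves as an
    epimorphism with kernel [N]. *)
Lemma heart_cover X : heart X -> exists m Q (s : 'I_m -> Mor S Q) (t : 'I_m -> Mor Q S)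
    (p : Mor Q X) N (i : Mor N Q) (h : Mor X N[1]),
  [/\ \sum_(l < m) (s l ∘ t l) = idm Q, dist i p h, heart N &
      forall e : Mor S X, exists e', p ∘ e' = e].
Proof.
move=> hX; have [m [b bspan]] := heart_fin X.
have [Q [s [t [ts ts0 st]]]] := additive_biproduct (tri_additive T_tri) (fun _ : 'I_m => S).
pose p := \sum_(l < m) (b l ∘ t l).
have ps l : p ∘ s l = b l.
  rewrite comp_suml (bigD1 l) //= -compA ts compm1 big1 ?addr0 // => k kl.
  by rewrite -compA ts0 ?compm0 // eq_sym.
have surj (e : Mor S X) : exists e', p ∘ e' = e.
  have [c ->] := bspan e; exists (\sum_(l < m) c l *: s l).
  by rewrite comp_sumr; apply: eq_bigr => l _; rewrite compZr ps.
have [N [i [h D]]] := exists_cocone T_tri p.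
exists m, Q, s, t, p, N, i, h; split=> // a a0 x.
have ix0 : i ∘ x = 0 by exact: (heart_sum st a0 (i ∘ x)).
apply: (shift_faithful T_tri).
have [|z <-] := dist_lift3 T_tri D (x := x⟦1⟧); first by rewrite -fmapM ix0 functor0.
have hp0 : h ∘ p = 0 by exact: (dist_comp0 T_tri (dist_rotl T_tri D)).
have [f [g [gf fg]]] := shiftnS T_tri a S.
(* The map [z] starts at [S[a + 1]], up to isomorphism, so it can be nonzero only for [a = -1]; in
   that case it lifts through [p], and [h ∘ p = 0]. *)
have [a1|a1] := eqVneq (a + 1) 0; last first.
  by rewrite -(compm1 z) -gf (compA z) (hX _ a1 (z ∘ g)) comp0m compm0.
rewrite a1 in f g gf fg *; have [e' pe'] := surj (z ∘ g).
by rewrite -(compm1 z) -gf (compA z) -pe' !compA hp0 !comp0m.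
Qed.

Lemma heart_faithful X Y (f : Mor X Y) : heart X -> heart Y ->
  (forall e : Mor S X, f ∘ e = 0) -> f = 0.
Proof.
move=> hX hY fe; have [m [Q [s [t [p [N [i [h [st D hN surj]]]]]]]]] := heart_cover hX.
have fp : f ∘ p = 0.
  rewrite -(compm1 (f ∘ p)) -st comp_sumr big1 // => l _.
  by rewrite compA -(compA f) fe comp0m.
have [z <-] := dist_ext_along2 T_tri D fp.
rewrite (heart_orth (X := N) _ hY z) ?comp0m // => j a a0.
by apply: (proj1 (heartE _) hN); lia.
Qed.

(** On the cover [Q] the values of [phi] on the copies of [S] define [g]. It kills the kernel [N],
    as can be tested on maps from [S] by [heart_faithful], and so descends to [X]. *)
Lemma heart_full X Y (phi : Mor S X -> Mor S Y) : heart X -> heart Y ->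
  (forall e e', phi (e + e') = phi e + phi e') ->
  (forall e (a : Mor S S), phi (e ∘ a) = phi e ∘ a) ->
  exists f : Mor X Y, forall e, f ∘ e = phi e.
Proof.
move=> hX hY phiD phiM; have [m [Q [s [t [p [N [i [h [st D hN surj]]]]]]]]] := heart_cover hX.
have phi0 : phi 0 = 0 by have := phiM 0 0; rewrite compm0 compm0.
pose g : Mor Q Y := \sum_(l < m) (phi (p ∘ s l) ∘ t l).
have gE e : g ∘ e = phi (p ∘ e).
  rewrite -[in RHS](comp1m e) -st comp_suml comp_sumr comp_suml.
  rewrite (big_morph phi phiD phi0); apply: eq_bigr => l _.
  by rewrite -compA -phiM !compA.
have gi : g ∘ i = 0.
  apply: heart_faithful => // e.
  by rewrite -compA gE compA (dist_comp0 T_tri D) comp0m phi0.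
have [f fp] := dist_ext_along T_tri D gi.
by exists f => e; have [e' <-] := surj e; rewrite compA fp gE.
Qed.

(** [C] lies in the aisle and [X] is its zeroth cohomology object, obtained by truncating the
    desuspension of [C] and shifting back. The shift turns the bounds [a < 0] and [a <= 0] of
    [approx] into [a <= 0] and [a <= 1], so degree [0] is fully controlled. *)
Lemma heart_approx C : (forall i a, a < 0 -> hom_zero (Es E i a) C) ->
  exists X (g : Mor C X), [/\ heart X, forall e : Mor S C, g ∘ e = 0 -> e = 0 &
    forall z : Mor S X, exists e, g ∘ e = z].
Proof.
move=> C0; have [B [g [[ginj gsurj _] B1]]] :=
  exists_approx T_tri E_exc E_strong T_fin (unshift T C).
have [u [v [vu uv]]] := shift_unshift T_tri C.
pose g' := g⟦1⟧ ∘ v.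
have g'inj i a (e : Mor (Es E i a) C) : a <= 0 -> g' ∘ e = 0 -> e = 0.
  rewrite -(subrK 1 a) in e *; move: (a - 1) e => {}a e a0 ge0.
  have [j [k [kj jk]]] := shiftnS T_tri a (E i).
  have [y yE] := shift_full T_tri (v ∘ e ∘ j).
  have y0 : y = 0.
    apply: ginj; first by lia.
    by apply: (shift_faithful T_tri); rewrite fmapM yE !compA ge0 comp0m.
  rewrite -(compm1 e) -jk -(comp1m (e ∘ _)) -uv (compA e) -(compA u) (compA v) (compA v).
  by rewrite -yE y0 functor0 comp0m compm0.
have g'surj i a (z : Mor (Es E i a) B[1]) : a <= 1 -> exists e, g' ∘ e = z.
  rewrite -(subrK 1 a) in z *; move: (a - 1) z => {}a z a0.
  have [j [k [kj jk]]] := shiftnS T_tri a (E i).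
  have [y yE] := shift_full T_tri (z ∘ j).
  have [|x gx] := gsurj i a y; first by lia.
  exists (u ∘ x⟦1⟧ ∘ k).
  by rewrite /g' !compA -(compA _ v u) vu compm1 -fmapM gx yE -compA jk compm1.
have [_ _ ip] := S_sum.
exists B[1], g'; split.
- apply/heartE => i a a0; have [a_lt|a_gt] : a < 0 \/ 0 < a by lia.
    move=> z; have [|e <-] := g'surj _ _ z; first by lia.
    by rewrite (C0 _ _ a_lt e) compm0.
  have := hom_zero_shiftr T_tri (a - 1) (E i) B; rewrite subrK => ->.
  by apply: B1; lia.
- move=> e ge0; rewrite -(compm1 e) -ip comp_sumr big1 // => i _.
  by rewrite compA (g'inj i 0 (e ∘ inj i)) ?comp0m // compA ge0 comp0m.
- move=> z; pose e i := sval (cid (g'surj i 0 (z ∘ inj i) isT)).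
  have eE i : g' ∘ e i = z ∘ inj i by rewrite /e; case: cid.
  exists (\sum_(i < n) (e i ∘ proj i)); rewrite comp_sumr -[RHS]compm1 -ip comp_sumr.
  by apply: eq_bigr => i _; rewrite !compA eE.
Qed.

(** A presentation of [M] is realized in [T]: [Q] is a power of [S] with one copy per coordinate of
    [M], and [al : Q1 -> Q] has as image on [Hom(S, -)] the kernel of [pi : Hom(S, Q) -> M]. If [C]
    is the cone of [al] and [X] its zeroth cohomology object, then [Hom(S, X)] is [Hom(S, C)], the
    cokernel of [al] on [Hom(S, -)], that is [M]. *)
Lemma heart_ess_surj (M : mod_cat (End_alg S)) :
  exists X (beta : 'rV[K]_(sdim M) -> Mor S X),
  [/\ heart X, bijective beta, forall c v w, beta (c *: v + w) = c *: beta v + beta w &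
      forall v (a : Mor S S), beta (act (sstr M) v a) = beta v ∘ a].
Proof.
pose d := sdim M; pose ac : 'rV[K]_d -> Mor S S -> 'rV[K]_d := act (sstr M).
have acD v a b : ac v (a + b) = ac v a + ac v b by exact: actDr.
have acDl v w a : ac (v + w) a = ac v a + ac w a by exact: actDl.
have acZ v c a : ac v (c *: a) = c *: ac v a by exact: actZr.
have acM v a b : ac v (a ∘ b) = ac (ac v a) b by exact: actM.
have ac1 v : ac v (idm S) = v by exact: act1.
have ac0 v : ac v 0 = 0 by have := acZ v 0 0; rewrite !scale0r.
have ac0l a : ac 0 a = 0 by apply: (@addIr _ (ac 0 a)); rewrite add0r -acDl addr0.
have [Q [s [t [ts ts0 st]]]] := additive_biproduct (tri_additive T_tri) (fun _ : 'I_d => S).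
pose x (l : 'I_d) : 'rV[K]_d := delta_mx 0 l.
pose pi (e : Mor S Q) : 'rV[K]_d := \sum_(l < d) ac (x l) (t l ∘ e).
have piP c e e' : pi (c *: e + e') = c *: pi e + pi e'.
  rewrite /pi scaler_sumr -big_split; apply: eq_bigr => l _ /=.
  by rewrite compDr compZr acD acZ.
have piM e a : pi (e ∘ a) = ac (pi e) a.
  rewrite /pi (big_morph (ac^~ a) (fun v w => acDl v w a) (ac0l a)).
  by apply: eq_bigr => l _; rewrite compA acM.
have pis l : pi (s l) = x l.
  rewrite /pi (bigD1 l) //= ts ac1 big1 ?addr0 // => k kl.
  by rewrite ts0 ?ac0 // eq_sym.
have pi0 : pi 0 = 0 by rewrite /pi big1 // => l _; rewrite compm0 ac0.
have piD e e' : pi (e + e') = pi e + pi e' by have := piP 1 e e'; rewrite !scale1r.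
have piZ c e : pi (c *: e) = c *: pi e by have := piP c e 0; rewrite pi0 !addr0.
have pi_sum m (F : 'I_m -> Mor S Q) : pi (\sum_(l < m) F l) = \sum_(l < m) pi (F l).
  exact: (big_morph pi piD pi0).
have pi_surj (v : 'rV[K]_d) : exists e, pi e = v.
  exists (\sum_(l < d) v 0 l *: s l); rewrite pi_sum [RHS]row_sum_delta.
  by apply: eq_bigr => l _; rewrite piZ pis.
(* The relations come from matrix algebra: the rows of [B] are the images under [pi] of generators
   of [Hom(S, Q)], so the rows of [kermx B] are coefficients of elements [k l] spanning the kernel
   of [pi]. *)
have [r [b bspan]] := heart_fin Q.
pose B : 'M[K]_(r, d) := \matrix_(j < r) pi (b j).
pose k (l : 'I_r) : Mor S Q := \sum_(j < r) kermx B l j *: b j.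
have pi_comb (c : 'rV[K]_r) : pi (\sum_(j < r) c 0 j *: b j) = c *m B.
  rewrite pi_sum mulmx_sum_row; apply: eq_bigr => j _.
  by rewrite piZ rowK.
have pik l : pi (k l) = 0.
  have -> : k l = \sum_(j < r) (row l (kermx B)) 0 j *: b j.
    by apply: eq_bigr => j _; rewrite [in RHS]mxE.
  by rewrite pi_comb -row_mul mulmx_ker row0.
have kspan e : pi e = 0 -> exists c : 'I_r -> K, e = \sum_(l < r) c l *: k l.
  have [c ->] := bspan e => pi_e.
  have cB : (\row_j c j) *m B = 0.
    by rewrite -pi_comb -[RHS]pi_e; congr pi; apply: eq_bigr => j _; rewrite mxE.
  have /submxP[D DE] : (\row_j c j <= kermx B)%MS by apply/sub_kermxP.
  exists (fun l => D 0 l); transitivity (\sum_(j < r) (\row_j c j) 0 j *: b j).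
    by apply: eq_bigr => j _; rewrite mxE.
  rewrite DE; under eq_bigr => j _ do rewrite mxE scaler_suml.
  rewrite exchange_big; apply: eq_bigr => l _ /=; rewrite /k scaler_sumr.
  by apply: eq_bigr => j _; rewrite scalerA.
have [Q1 [s1 [t1 [ts1 ts10 st1]]]] :=
  additive_biproduct (tri_additive T_tri) (fun _ : 'I_r => S).
pose al : Mor Q1 Q := \sum_(l < r) (k l ∘ t1 l).
have als l : al ∘ s1 l = k l.
  rewrite comp_suml (bigD1 l) //= -compA ts1 compm1 big1 ?addr0 // => j jl.
  by rewrite -compA ts10 ?compm0 // eq_sym.
have pi_al e : pi (al ∘ e) = 0.
  rewrite comp_suml pi_sum big1 // => l _.
  by rewrite -compA piM pik ac0l.
have al_ker e : pi e = 0 -> exists e', al ∘ e' = e.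
  move=> /kspan[c ->]; exists (\sum_(l < r) c l *: s1 l).
  by rewrite comp_sumr; apply: eq_bigr => l _; rewrite compZr als.
have [C [q [h D]]] := tri_ext T_tri al.
have hQ := heart_sum st; have hQ1 := heart_sum st1.
have S1 a : a <= 0 -> hom_zero (shiftn a S) Q1[1].
  by move=> a0; rewrite -(subrK 1 a); apply/(hom_zero_shiftr T_tri); apply: hQ1; lia.
have [|X [g [hX ginj gsurj]]] := @heart_approx C.
  move=> i a a0; move: i; apply/(hom_zero_biproduct _ _ S_sum) => z.
  have [|y <-] := dist_lift2 T_tri D (z := z); first by apply: S1; lia.
  by rewrite (hQ _ _ y) ?compm0 //; lia.
(* [e] is an arbitrary section of [pi], not a linear one. Two lifts of the same vector differ by
   something in the image of [al], which [q] kills; linearity and equivariance follow from this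
   independence. *)
pose e v := sval (cid (pi_surj v)).
have eE v : pi (e v) = v by rewrite /e; case: cid.
have wd e1 e2 : pi e1 = pi e2 -> g ∘ q ∘ e1 = g ∘ q ∘ e2.
  move=> e12; have [|e' e'E] := al_ker (e1 - e2).
    by rewrite -scaleN1r addrC piP e12 scaleN1r addNr.
  apply/subr0_eq; rewrite -compBr -e'E compA -(compA g) (dist_comp0 T_tri D).
  by rewrite compm0 comp0m.
exists X, (fun v => g ∘ q ∘ e v); split=> //.
- have z_lift (z : Mor S X) : exists e1, g ∘ q ∘ e1 = z.
    have [y <-] := gsurj z.
    have [|e1 <-] := dist_lift2 T_tri D (z := y); first by apply: (S1 0).
    by exists e1; rewrite compA.
  exists (fun z => pi (sval (cid (z_lift z)))) => [v|z].
  + case: cid => e1 /= e1E; rewrite -(eE v); apply/eqP; rewrite -subr_eq0.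
    have [|e' e'E] := dist_lift T_tri D (y := e1 - e v).
      by apply: ginj; rewrite compBr !compBr !compA e1E subrr.
    by rewrite -[_ - _]addrC -scaleN1r -piP scaleN1r addrC -e'E pi_al.
  + case: cid => e1 /= e1E; rewrite -[RHS]e1E; apply: wd.
    by rewrite eE.
- move=> c v w; rewrite -compZr -compDr; apply: wd.
  by rewrite piP !eE.
- by move=> v a; rewrite -[in RHS]compA; apply: wd; rewrite piM !eE.
Qed.

End Heart.
(** * Finite-dimensional modules *)

Section Basis.
Variables (K : fieldType) (V : lmodType K).

Definition lin_comb m (b : 'I_m -> V) (c : 'rV[K]_m) : V := \sum_(l < m) c 0 l *: b l.

Lemma lin_comb_linear m (b : 'I_m -> V) : linear (lin_comb b).
Proof.
move=> c x y; rewrite /lin_comb scaler_sumr -big_split; apply: eq_bigr => l _ /=.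
by rewrite !mxE scalerDl scalerA.
Qed.

HB.instance Definition _ m (b : 'I_m -> V) :=
  GRing.isLinear.Build K 'rV[K]_m V _ (lin_comb b) (lin_comb_linear b).

Lemma finite_basis m (b : 'I_m -> V) :
  (forall v, exists c : 'I_m -> K, v = \sum_(l < m) c l *: b l) ->
  exists (d : nat) (phi : {linear 'rV[K]_d -> V}), bijective phi.
Proof.
elim: m b => [|m IHm] b bspan; last have [[c [c0 cE]]|inj] :=
  pselect (exists c : 'rV[K]_m.+1, c != 0 /\ lin_comb b c = 0).
- exists 0%N, (lin_comb b); exists (fun=> 0) => [x|v]; first by rewrite [x]thinmx0.
  by have [c ->] := bspan v; rewrite /= /lin_comb !big_ord0.
- have /rV0Pn[i ci] := c0.
  apply: (IHm (fun l => b (lift i l))) => v; have [x ->] := bspan v.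
  have bi : b i = - \sum_(l < m) (c 0 (lift i l) / c 0 i) *: b (lift i l).
    have /eqP := cE; rewrite /lin_comb (bigD1_ord i) //= addr_eq0 => /eqP.
    move=> /(f_equal ( *:%R (c 0 i)^-1)); rewrite scalerA mulVf // scale1r => ->.
    rewrite scalerN scaler_sumr; congr (- _); apply: eq_bigr => l _.
    by rewrite scalerA mulrC.
  exists (fun l => x (lift i l) - x i * (c 0 (lift i l) / c 0 i)).
  rewrite (bigD1_ord i) //= bi scalerN scaler_sumr addrC -sumrB.
  by apply: eq_bigr => l _; rewrite scalerBl scalerA.
- exists m.+1, (lin_comb b).
  have surj v : exists c, lin_comb b c = v.
    have [c ->] := bspan v; exists (\row_l c l).
    by apply: eq_bigr => l _; rewrite mxE.
  have lin_inj : injective (lin_comb b).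
    move=> x y xy; apply/eqP; rewrite -subr_eq0; apply/negP => /negP xy0.
    by apply: inj; exists (x - y); split=> //; rewrite linearB /= xy subrr.
  have gP v : lin_comb b (sval (cid (surj v))) = v by case: cid.
  by exists (fun v => sval (cid (surj v))) => // x; apply: lin_inj.
Qed.

End Basis.

Section ModCat.
Variables (K : fieldType) (A : kalg K).
Implicit Types M N : mod_cat A.

Definition carrier M : vectType K := 'rV[K]_(sdim M).
Definition mac M : carrier M -> A -> carrier M := act (sstr M).

Definition ev M N (f : Mor M N) (v : carrier M) : carrier N :=
  rfun (f : rmor (rmod_of M) (rmod_of N)) v.

Lemma ev_linear M N (f : Mor M N) : linear (ev f).
Proof. by move=> c x y; rewrite /ev linearP. Qed.

HB.instance Definition _ M N (f : Mor M N) :=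
  GRing.isLinear.Build K (carrier M) (carrier N) _ (ev f) (ev_linear f).

Lemma ev_mac M N (f : Mor M N) v a : ev f (mac v a) = mac (ev f v) a.
Proof. exact: (rfunP (f : rmor (rmod_of M) (rmod_of N))). Qed.

Lemma ev_ext M N (f g : Mor M N) : (forall v, ev f v = ev g v) -> f = g.
Proof. by move=> fg; exact: (@rmor_eq K A (rmod_of M) (rmod_of N) f g fg). Qed.

Lemma ev_comp M N (P : mod_cat A) (g : Mor N P) (f : Mor M N) v : ev (g ∘ f) v = ev g (ev f v).
Proof. by rewrite /ev /= comp_lfunE. Qed.

Lemma ev_id M v : ev (idm M) v = v.
Proof. by rewrite /ev /= id_lfunE. Qed.

Lemma ev0 M N v : ev (0 : Mor M N) v = 0.
Proof. by rewrite /ev /= zero_lfunE. Qed.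

Lemma evD M N (f g : Mor M N) v : ev (f + g) v = ev f v + ev g v.
Proof. by rewrite /ev /= add_lfunE. Qed.

Lemma evZ M N c (f : Mor M N) v : ev (c *: f) v = c *: ev f v.
Proof. by rewrite /ev /= scale_lfunE. Qed.

Lemma exists_ev M N (f : carrier M -> carrier N) : linear f ->
  (forall v a, f (mac v a) = mac (f v) a) -> exists g : Mor M N, forall v, ev g v = f v.
Proof.
move=> fL fM; pose fl : {linear carrier M -> carrier N} :=
  HB.pack f (GRing.isLinear.Build _ _ _ _ f fL).
have lE v : linfun fl v = f v by rewrite lfunE.
have fP (v : rmod_of M) a : linfun fl (mact v a) = mact (linfun fl v : rmod_of N) a.
  by rewrite !lE; exact: fM.
by exists (@RMor K A (rmod_of M) (rmod_of N) (linfun fl) fP).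
Qed.

Record right_action (V : lmodType K) (ac : V -> A -> V) : Prop := RightAction {
  ra1 : forall v, ac v (aone A) = v;
  raM : forall v a b, ac v (amul a b) = ac (ac v a) b;
  raDl : forall v w a, ac (v + w) a = ac v a + ac w a;
  raDr : forall v a b, ac v (a + b) = ac v a + ac v b;
  raZl : forall c v a, ac (c *: v) a = c *: ac v a;
  raZr : forall c v a, ac v (c *: a) = c *: ac v a
}.

Lemma mac_right_action M : right_action (@mac M).
Proof.
split=> *; [exact: act1|exact: actM|exact: actDl|exact: actDr|exact: actZl|exact: actZr].
Qed.

(** [V] is a bare [lmodType], so that the lemma serves both for kernels, where [V] is a space of row
    vectors, and for [Hom(S, X)] with a chosen basis. *)
Lemma submodule (V : lmodType K) (ac : V -> A -> V) d (phi : {linear 'rV[K]_d -> V}) :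
  right_action ac -> injective phi -> (forall v a, exists w, phi w = ac (phi v) a) ->
  exists st : rmod_str A 'rV[K]_d, forall v a, phi (act st v a) = ac (phi v) a.
Proof.
move=> ra inj stable; pose op v a := sval (cid (stable v a)).
have opE v a : phi (op v a) = ac (phi v) a by rewrite /op; case: cid.
have op1 v : op v (aone A) = v by apply: inj; rewrite opE (ra1 ra).
have opM v a b : op v (amul a b) = op (op v a) b by apply: inj; rewrite !opE (raM ra).
have opDl v w a : op (v + w) a = op v a + op w a.
  by apply: inj; rewrite linearD !opE linearD (raDl ra).
have opDr v a b : op v (a + b) = op v a + op v b.
  by apply: inj; rewrite linearD !opE (raDr ra).
have opZl c v a : op (c *: v) a = c *: op v a.
  by apply: inj; rewrite linearZ !opE linearZ (raZl ra).
have opZr c v a : op v (c *: a) = c *: op v a.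
  by apply: inj; rewrite linearZ !opE (raZr ra).
by exists (RModStr op1 opM opDl opDr opZl opZr).
Qed.

Lemma quotient_module (V : lmodType K) (ac : V -> A -> V) d (q : {linear V -> 'rV[K]_d}) :
  right_action ac -> (forall w, exists v, q v = w) ->
  (forall v a, q v = 0 -> q (ac v a) = 0) ->
  exists st : rmod_str A 'rV[K]_d, forall v a, q (ac v a) = act st (q v) a.
Proof.
move=> ra surj stable; pose s w := sval (cid (surj w)).
have sE w : q (s w) = w by rewrite /s; case: cid.
pose op w a := q (ac (s w) a).
have opE v a : op (q v) a = q (ac v a).
  apply/eqP; rewrite -subr_eq0 -linearB -[- ac v a]scaleN1r -(raZl ra) -(raDl ra).
  by rewrite scaleN1r stable // linearB sE subrr.
have op1 v : op v (aone A) = v by rewrite /op (ra1 ra).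
have opM v a b : op v (amul a b) = op (op v a) b.
  by rewrite -(sE v) !opE (raM ra).
have opDl v w a : op (v + w) a = op v a + op w a.
  by rewrite -(sE v) -(sE w) -linearD !opE (raDl ra) linearD.
have opDr v a b : op v (a + b) = op v a + op v b by rewrite /op (raDr ra) linearD.
have opZl c v a : op (c *: v) a = c *: op v a.
  by rewrite -(sE v) -linearZ !opE (raZl ra) linearZ.
have opZr c v a : op v (c *: a) = c *: op v a by rewrite /op (raZr ra) linearZ.
by exists (RModStr op1 opM opDl opDr opZl opZr) => v a; rewrite -opE.
Qed.

Lemma factor_inj (Z M W : mod_cat A) (i : Mor Z M) (g : Mor W M) :
  injective (ev i) -> (forall w, exists z, ev i z = ev g w) -> exists! h, i ∘ h = g.
Proof.
move=> inj lift; pose h w := sval (cid (lift w)).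
have hE w : ev i (h w) = ev g w by rewrite /h; case: cid.
have [|v a|k kE] := @exists_ev W Z h.
- by move=> c x y; apply: inj; rewrite hE !linearP /= !hE.
- by apply: inj; rewrite hE !ev_mac hE.
exists k; split=> [|k' k'E]; first by apply: ev_ext => v; rewrite ev_comp kE.
by apply: ev_ext => v; apply: inj; rewrite -!ev_comp k'E ev_comp kE.
Qed.

Lemma factor_surj (N Q W : mod_cat A) (p : Mor N Q) (g : Mor N W) :
  (forall w, exists v, ev p v = w) -> (forall v, ev p v = 0 -> ev g v = 0) ->
  exists! h, h ∘ p = g.
Proof.
move=> surj ker; pose s w := sval (cid (surj w)).
have sE w : ev p (s w) = w by rewrite /s; case: cid.
have gs v : ev g (s (ev p v)) = ev g v.
  by apply/eqP; rewrite -subr_eq0 -linearB /= ker // linearB /= sE subrr.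
have [|v a|k kE] := @exists_ev Q W (fun w => ev g (s w)).
- move=> c x y; rewrite -linearP; apply/eqP; rewrite -subr_eq0 -linearB /= ker //.
  by rewrite linearB linearP /= !sE subrr.
- rewrite -ev_mac; apply/eqP; rewrite -subr_eq0 -linearB /= ker //.
  by rewrite linearB /= ev_mac !sE subrr.
exists k; split=> [|k' k'E]; first by apply: ev_ext => v; rewrite ev_comp kE gs.
by apply: ev_ext => w; rewrite -(sE w) -!ev_comp k'E ev_comp kE sE.
Qed.

Lemma mod_zero : exists Z : mod_cat A, is_zero Z.
Proof.
have ax (v w : 'rV[K]_0) : v = w by rewrite [v]thinmx0 [w]thinmx0.
have st : rmod_str A 'rV[K]_0 by exists (fun v _ => v) => *; exact: ax.
exists (StdRMod st); apply: is_zero_idm; apply: ev_ext => v; exact: ax.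
Qed.

Lemma mod_sum2 M N : exists (R : mod_cat A) (i : Mor M R) (j : Mor N R)
    (p : Mor R M) (q : Mor R N),
  [/\ p ∘ i = idm M, q ∘ j = idm N, q ∘ i = 0, p ∘ j = 0 & i ∘ p + j ∘ q = idm R].
Proof.
pose m := sdim M; pose n := sdim N.
pose op (v : 'rV[K]_(m + n)) a : 'rV[K]_(m + n) :=
  row_mx (mac (lsubmx v : carrier M) a) (mac (rsubmx v : carrier N) a).
have rM := mac_right_action M; have rN := mac_right_action N.
have op1 v : op v (aone A) = v by rewrite /op (ra1 rM) (ra1 rN) hsubmxK.
have opM v a b : op v (amul a b) = op (op v a) b.
  by rewrite /op row_mxKl row_mxKr (raM rM) (raM rN).
have opDl v w a : op (v + w) a = op v a + op w a.
  by rewrite /op add_row_mx; congr row_mx; rewrite linearD; [exact: (raDl rM)|exact: (raDl rN)].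
have opDr v a b : op v (a + b) = op v a + op v b.
  by rewrite /op add_row_mx; congr row_mx; [exact: (raDr rM)|exact: (raDr rN)].
have opZl c v a : op (c *: v) a = c *: op v a.
  by rewrite /op scale_row_mx; congr row_mx; rewrite linearZ; [exact: (raZl rM)|exact: (raZl rN)].
have opZr c v a : op v (c *: a) = c *: op v a.
  by rewrite /op scale_row_mx; congr row_mx; [exact: (raZr rM)|exact: (raZr rN)].
pose R : mod_cat A := StdRMod (RModStr op1 opM opDl opDr opZl opZr).
have M0 a : mac (0 : carrier M) a = 0.
  by have := raZl rM 0 0 a; rewrite !scale0r.
have N0 a : mac (0 : carrier N) a = 0.
  by have := raZl rN 0 0 a; rewrite !scale0r.
have [||i iE] := @exists_ev M R (fun v => row_mx v 0).
- by move=> c x y; rewrite scale_row_mx add_row_mx scaler0 addr0.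
- by move=> v a; rewrite /mac /= /op row_mxKl row_mxKr N0.
have [||j jE] := @exists_ev N R (fun v => row_mx 0 v).
- by move=> c x y; rewrite scale_row_mx add_row_mx scaler0 addr0.
- by move=> v a; rewrite /mac /= /op row_mxKl row_mxKr M0.
have [||p pE] := @exists_ev R M (fun v => lsubmx v).
- by move=> c x y; rewrite linearP.
- by move=> v a; rewrite {1}/mac /= /op row_mxKl.
have [||q qE] := @exists_ev R N (fun v => rsubmx v).
- by move=> c x y; rewrite linearP.
- by move=> v a; rewrite {1}/mac /= /op row_mxKr.
exists R, i, j, p, q; split; apply: ev_ext => v;
  rewrite ?evD !ev_comp ?ev_id ?ev0 ?iE ?jE ?pE ?qE ?iE ?jE ?row_mxKl ?row_mxKr //.
by rewrite add_row_mx addr0 add0r hsubmxK.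
Qed.

Lemma mod_kernel M N (f : Mor M N) : exists (Z : mod_cat A) (i : Mor Z M), is_kernel f i.
Proof.
pose F : 'M[K]_(sdim M, sdim N) := lin1_mx (ev f : {linear 'rV[K]_(sdim M) -> 'rV[K]_(sdim N)}).
have FE (v : 'rV[K]_(sdim M)) : v *m F = ev f v by rewrite mul_rV_lin1.
pose B := row_base (kermx F).
pose phi : {linear 'rV[K]_(\rank (kermx F)) -> 'rV[K]_(sdim M)} := mulmxr B.
have phi_inj : injective phi by apply: row_free_inj; exact: row_base_free.
have im_phi v : (exists w, phi w = v) <-> ev f v = 0.
  rewrite -FE; split=> [[w <-]|/eqP fv0].
    by apply/sub_kermxP; rewrite -(eq_row_base (kermx F)) submxMl.
  have /submxP[w wE] : (v <= B)%MS by rewrite eq_row_base; apply/sub_kermxP/eqP.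
  by exists w.
have [|st stE] := submodule (mac_right_action M) phi_inj.
  move=> v a; apply/im_phi; rewrite ev_mac (proj1 (im_phi _)); last by exists v.
  by have := raZl (mac_right_action N) 0 0 a; rewrite !scale0r.
pose Z : mod_cat A := StdRMod st.
have [||i iE] := @exists_ev Z M phi; first exact: linearP.
  by move=> v a; rewrite stE.
have i_inj : injective (ev i) by move=> v w; rewrite !iE; exact: phi_inj.
exists Z, i; split=> [|W g fg].
  by apply: ev_ext => v; rewrite ev_comp ev0 iE; apply/im_phi; exists v.
apply: factor_inj => // w; have [|z zE] := proj2 (im_phi (ev g w)).
  by rewrite -ev_comp fg ev0.
by exists z; rewrite iE.
Qed.

Lemma exists_exact_quotient M N (f : Mor M N) : exists (Q : mod_cat A) (p : Mor N Q),
  (forall w, exists v, ev p v = w) /\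
  (forall v, ev p v = 0 <-> exists w, ev f w = v).
Proof.
pose F : 'M[K]_(sdim M, sdim N) := lin1_mx (ev f : {linear 'rV[K]_(sdim M) -> 'rV[K]_(sdim N)}).
have FE (v : 'rV[K]_(sdim M)) : v *m F = ev f v by rewrite mul_rV_lin1.
pose B := col_base (cokermx F).
pose q : {linear 'rV[K]_(sdim N) -> 'rV[K]_(\rank (cokermx F))} := mulmxr B.
have q_surj w : exists v, q v = w.
  have /submxP[v vE] : (w <= B)%MS by apply: submx_full; exact: col_base_full.
  by exists v.
have q_ker v : q v = 0 <-> exists w, ev f w = v.
  split=> [qv0|[w <-]].
    have /submxP[w wE] : (v <= F)%MS.
      by rewrite submxE -(mulmx_base (cokermx F)) mulmxA [v *m _]qv0 mul0mx.
    by exists w; rewrite -FE wE.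
  (* [q] is multiplication by the column base of [cokermx F]; multiplying further by the injective
     row base recovers [cokermx F], which kills the image of [F]. *)
  apply: (row_free_inj (row_base_free (cokermx F))).
  by rewrite -mulmxA mulmx_base -FE -mulmxA mulmx_coker mulmx0 mul0mx.
have [|st stE] := quotient_module (mac_right_action N) q_surj.
  by move=> v a /q_ker[w <-]; apply/q_ker; exists (mac w a); rewrite ev_mac.
pose Q : mod_cat A := StdRMod st.
have [||p pE] := @exists_ev N Q q; first exact: linearP.
  by move=> v a; rewrite stE.
by exists Q, p; split=> [w|v]; [have [v <-] := q_surj w; exists v|rewrite pE].
Qed.

Lemma mod_cokernel M N (f : Mor M N) : exists (Q : mod_cat A) (p : Mor N Q), is_cokernel f p.
Proof.
have [Q [p [surj ker]]] := exists_exact_quotient f; exists Q, p; split=> [|W g gf].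
  by apply: ev_ext => v; rewrite ev_comp ev0; apply/ker; exists v.
apply: factor_surj => // v /ker[w <-].
by rewrite -ev_comp gf ev0.
Qed.

(** An abstract cokernel is known only through its universal property. Comparing it with the
    concrete quotient gives mutually compatible maps, through which surjectivity and exactness are
    transferred. *)
Lemma mod_cokernel_exact M N Q (f : Mor M N) (p : Mor N Q) : is_cokernel f p ->
  (forall w, exists v, ev p v = w) /\ (forall v, ev p v = 0 -> exists w, ev f w = v).
Proof.
move=> [pf univ]; have [Q' [p' [surj ker]]] := exists_exact_quotient f.
have p'f : p' ∘ f = 0 by apply: ev_ext => v; rewrite ev_comp ev0; apply/ker; exists v.
have [h [hp _]] := univ _ p' p'f.
have [|k [kp _]] := @factor_surj N Q' Q p' p surj.
  by move=> v /ker[w <-]; rewrite -ev_comp pf ev0.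
have kh : k ∘ h = idm Q.
  have [u [_ uniq]] := univ _ p pf.
  by rewrite -(uniq (idm Q)) ?comp1m // (uniq (k ∘ h)) // -compA hp.
split=> [w|v pv0]; last by apply/ker; rewrite -hp ev_comp pv0 linear0.
have [v vE] := surj (ev h w); exists v.
by rewrite -kp ev_comp vE -ev_comp kh ev_id.
Qed.

Lemma mod_iso M N (f : Mor M N) : injective (ev f) ->
  (forall w, exists v, ev f v = w) -> is_iso f.
Proof.
move=> inj surj; have [h [fh _]] := factor_inj inj (fun w => surj (ev (idm N) w)).
exists h; split=> //; apply: ev_ext => v; apply: inj.
by rewrite -ev_comp compA fh comp1m ev_id.
Qed.

End ModCat.
(** * Complexes and homotopies *)

Lemma int_succP (P : int -> Prop) : (forall k, P (k + 1)) -> forall i, P i.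
Proof. by move=> PS i; rewrite -(subrK 1 i). Qed.

(** Homotopies naturally define maps in degrees [k + 1]; the transport needed to index them by all
    [i] is confined to this lemma. *)
Lemma reindex_succ (V : int -> Type) (h : forall k, V (k + 1)) :
  exists g : forall i, V i, forall k, g (k + 1) = h k.
Proof.
exists (fun i => ecast z (V z) (subrK 1 i) (h (i - 1))) => k.
have : k + 1 - 1 = k by rewrite addrK.
move: (k + 1 - 1) (subrK 1 (k + 1)) => l e lk; subst l.
by rewrite (eq_irrelevance e erefl).
Qed.

Section Terms.
Variables (K : fieldType) (A : kcat K).

Definition cterm (X : Cb A) (i : int) : A := (X : cplx A) i.
Definition cdiff (X : Cb A) i j : Mor (cterm X i) (cterm X j) := cd (X : cplx A) i j.
Definition ccomp (X Y : Cb A) (f : Mor X Y) i : Mor (cterm X i) (cterm Y i) :=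
  cm (f : cmap X Y) i.
Definition cshift : functor (Cb A) (Cb A) := Cb_shift A 1.

End Terms.

Local Notation "X ⌊ i ⌋" := (cterm X i) (at level 2, left associativity, format "X ⌊ i ⌋").
Local Notation "f ⌈ i ⌉" := (ccomp f i) (at level 2, left associativity, format "f ⌈ i ⌉").
Local Notation "X ⟨1⟩" := (fob (cshift _) X) (at level 1, format "X ⟨1⟩").
Local Notation "f ⟪1⟫" := (fmap (cshift _) f) (at level 1, format "f ⟪1⟫").

Section Chains.
Variables (K : fieldType) (A : kcat K).
Implicit Types X Y Z C P : Cb A.

Lemma ccompD X Y (f g : Mor X Y) i : (f + g)⌈i⌉ = f⌈i⌉ + g⌈i⌉.
Proof. by []. Qed.
Lemma ccompN X Y (f : Mor X Y) i : (- f)⌈i⌉ = - f⌈i⌉.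
Proof. by rewrite -!scaleN1r. Qed.
Lemma ccompB X Y (f g : Mor X Y) i : (f - g)⌈i⌉ = f⌈i⌉ - g⌈i⌉.
Proof. by rewrite ccompD ccompN. Qed.
Lemma ccomp_id X i : (idm X)⌈i⌉ = idm (X⌊i⌋).
Proof. by []. Qed.
Lemma ccompM X Y Z (g : Mor Y Z) (f : Mor X Y) i : (g ∘ f)⌈i⌉ = g⌈i⌉ ∘ f⌈i⌉.
Proof. by []. Qed.
Lemma ccomp_diff X Y (f : Mor X Y) i j : f⌈j⌉ ∘ cdiff X i j = cdiff Y i j ∘ f⌈i⌉.
Proof. exact: cmP. Qed.
Lemma ccomp_ext X Y (f g : Mor X Y) : (forall i, f⌈i⌉ = g⌈i⌉) -> f = g.
Proof. exact: cmap_eq. Qed.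
Lemma cdiff_sq X i j k : cdiff X j k ∘ cdiff X i j = 0.
Proof. exact: cd_sq. Qed.
Lemma cdiff_shape X i j : j != i + 1 -> cdiff X i j = 0.
Proof. exact: cd_shape. Qed.
Lemma cterm_bounded X : exists N : nat, forall i : int, (N < `|i|)%N -> is_zero (X⌊i⌋).
Proof. exact: cd_bounded. Qed.

Lemma cshift_diff X i j : cdiff X⟨1⟩ i j = - cdiff X (i + 1) (j + 1).
Proof. by rewrite /cdiff /= expr1 scaleN1r. Qed.
Lemma cshift_comp X Y (f : Mor X Y) i : (f⟪1⟫)⌈i⌉ = f⌈i + 1⌉.
Proof. by []. Qed.

Lemma exists_cmap X Y (f : forall i, Mor (X⌊i⌋) (Y⌊i⌋)) :
  (forall i, f (i + 1) ∘ cdiff X i (i + 1) = cdiff Y i (i + 1) ∘ f i) ->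
  exists g : Mor X Y, forall i, g⌈i⌉ = f i.
Proof.
move=> fd; have fP i j : f j ∘ cdiff X i j = cdiff Y i j ∘ f i.
  have [->|ij] := eqVneq j (i + 1); first exact: fd.
  by rewrite !cdiff_shape // compm0 comp0m.
by exists (CMap fP).
Qed.

Section MkCplx.
Variables (X : int -> A) (d : forall i, Mor (X i) (X (i + 1))).
Hypothesis dd : forall i, d (i + 1) ∘ d i = 0.
Hypothesis bd : exists N : nat, forall i : int, (N < `|i|)%N -> is_zero (X i).

Definition mk_diff i j : Mor (X i) (X j) :=
  if j =P i + 1 is ReflectT e then ecast z (Mor (X i) (X z)) (esym e) (d i) else 0.

Lemma mk_diffS i : mk_diff i (i + 1) = d i.
Proof. by rewrite /mk_diff; case: eqP => // e; rewrite (eq_irrelevance e erefl). Qed.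

Lemma mk_diff0 i j : j != i + 1 -> mk_diff i j = 0.
Proof. by rewrite /mk_diff; case: eqP. Qed.

Lemma mk_diff_sq i j k : mk_diff j k ∘ mk_diff i j = 0.
Proof.
have [->|ij] := eqVneq j (i + 1); last by rewrite (mk_diff0 ij) compm0.
have [->|jk] := eqVneq k (i + 1 + 1); last by rewrite (mk_diff0 jk) comp0m.
by rewrite !mk_diffS.
Qed.

Definition mk_cplx : Cb A := @Cplx K A X mk_diff mk_diff0 mk_diff_sq bd.

Lemma mk_cplx_diff i : cdiff mk_cplx i (i + 1) = d i.
Proof. exact: mk_diffS. Qed.

End MkCplx.

(** Homotopies are indexed by their target degree, so that no transport along
    [k + 1 - 1 = k] is needed. *)
Definition nullhomotopic X Y (f : Mor X Y) : Prop :=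
  exists h : forall k, Mor (X⌊k + 1⌋) (Y⌊k⌋), forall k,
    f⌈k + 1⌉ = cdiff Y k (k + 1) ∘ h k + h (k + 1) ∘ cdiff X (k + 1) (k + 1 + 1).

Lemma null0 X Y : nullhomotopic (0 : Mor X Y).
Proof. by exists (fun k => 0) => k; rewrite compm0 comp0m addr0. Qed.

Lemma nullB X Y (f g : Mor X Y) : nullhomotopic f -> nullhomotopic g -> nullhomotopic (f - g).
Proof.
move=> [h hP] [h' hP']; exists (fun k => h k - h' k) => k.
by rewrite ccompB hP hP' compBr compBl opprD addrACA.
Qed.

Lemma nullN X Y (f : Mor X Y) : nullhomotopic f -> nullhomotopic (- f).
Proof. by move=> f0; rewrite -(add0r (- f)); apply: nullB => //; exact: null0. Qed.

Lemma nullD X Y (f g : Mor X Y) : nullhomotopic f -> nullhomotopic g -> nullhomotopic (f + g).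
Proof. by move=> f0 g0; rewrite -[g]opprK; apply: nullB => //; exact: nullN. Qed.

Lemma null_compl X Y Z (g : Mor Y Z) (f : Mor X Y) : nullhomotopic f -> nullhomotopic (g ∘ f).
Proof.
move=> [h hP]; exists (fun k => g⌈k⌉ ∘ h k) => k.
by rewrite ccompM hP compDr !compA ccomp_diff.
Qed.

Lemma null_compr X Y Z (g : Mor Y Z) (f : Mor X Y) : nullhomotopic g -> nullhomotopic (g ∘ f).
Proof.
move=> [h hP]; exists (fun k => h k ∘ f⌈k + 1⌉) => k.
by rewrite ccompM hP compDl -!compA ccomp_diff.
Qed.

(** Changing [f] by the homotopy [h] turns relations that hold up to homotopy into strict ones, as
    [cone_factor] and [cone_colift] require. *)
Lemma null_modify X Y (f : Mor X Y) (h : forall k, Mor (X⌊k + 1⌋) (Y⌊k⌋)) :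
  exists g : Mor X Y, nullhomotopic (f - g) /\ forall k,
    g⌈k + 1⌉ = f⌈k + 1⌉ - (cdiff Y k (k + 1) ∘ h k + h (k + 1) ∘ cdiff X (k + 1) (k + 1 + 1)).
Proof.
have [F FE] := @reindex_succ (fun i => Mor (X⌊i⌋) (Y⌊i⌋)) (fun k =>
  f⌈k + 1⌉ - (cdiff Y k (k + 1) ∘ h k + h (k + 1) ∘ cdiff X (k + 1) (k + 1 + 1))).
have [|g gE] := @exists_cmap X Y F.
  apply: int_succP => k; rewrite !FE !compBl !compBr compDl compDr ccomp_diff.
  by rewrite !compA cdiff_sq comp0m add0r -!compA cdiff_sq compm0 addr0 compA.
exists g; split=> [|k]; last by rewrite gE FE.
by exists h => k; rewrite ccompB gE FE subKr.
Qed.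

Section Cone.
Variables (X Y C : Cb A) (f : Mor X Y) (u : Mor Y C) (v : Mor C X⟨1⟩).
Hypothesis cone : is_cone f u v.

(** The last identity is not part of [is_cone]: its [p] component is, and its [v] component follows
    from [v] being a chain map into a shift, whose differential carries the minus sign. *)
Lemma coneE : exists (s : forall i, Mor (X⌊i + 1⌋) (C⌊i⌋)) (p : forall i, Mor (C⌊i⌋) (Y⌊i⌋)),
  [/\ forall i, [/\ p i ∘ u⌈i⌉ = idm _, v⌈i⌉ ∘ s i = idm _, p i ∘ s i = 0 & v⌈i⌉ ∘ u⌈i⌉ = 0],
      forall i, u⌈i⌉ ∘ p i + s i ∘ v⌈i⌉ = idm _,
      forall i, p (i + 1) ∘ cdiff C i (i + 1) = cdiff Y i (i + 1) ∘ p i + f⌈i + 1⌉ ∘ v⌈i⌉ &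
      forall i, cdiff C i (i + 1) ∘ s i =
        u⌈i + 1⌉ ∘ f⌈i + 1⌉ - s (i + 1) ∘ cdiff X (i + 1) (i + 1 + 1)].
Proof.
have [s [p sp]] := cone; exists s, p.
have E i : [/\ p i ∘ u⌈i⌉ = idm _, v⌈i⌉ ∘ s i = idm _, p i ∘ s i = 0 & v⌈i⌉ ∘ u⌈i⌉ = 0].
  by have [[] ] := sp i.
have up i : u⌈i⌉ ∘ p i + s i ∘ v⌈i⌉ = idm _ by have [[] ] := sp i.
have pd i : p (i + 1) ∘ cdiff C i (i + 1) = cdiff Y i (i + 1) ∘ p i + f⌈i + 1⌉ ∘ v⌈i⌉.
  by have [] := sp i.
split=> // i; rewrite -[LHS]comp1m -up compDl; congr (_ + _).
- have [_ vs ps _] := E i.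
  by rewrite -compA (compA (p _)) pd compDl -!compA ps vs compm0 compm1 add0r.
- have [_ vs _ _] := E i.
  by rewrite -compA (compA v⌈_⌉) ccomp_diff cshift_diff -compA vs compm1 compmN.
Qed.

Lemma cone_uf : nullhomotopic (u ∘ f).
Proof.
have [s [p [E up pd ds]]] := coneE; exists s => k.
by rewrite ds ccompM subrK.
Qed.

Lemma cone_fv : nullhomotopic (f⟪1⟫ ∘ v).
Proof.
have [s [p [E up pd ds]]] := coneE; exists (fun k => p (k + 1)) => k.
by rewrite ccompM cshift_comp pd cshift_diff compNm addKr.
Qed.

(** A null homotopy of [y ∘ f] is exactly the missing component of [w] on the summand coming from
    [X], so the extension is strict and not merely up to homotopy. *)
Lemma cone_extend Z (y : Mor Y Z) : nullhomotopic (y ∘ f) -> exists w, w ∘ u = y.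
Proof.
move=> [h hP]; have [s [p [E up pd ds]]] := coneE.
have [|w wE] := @exists_cmap C Z (fun i => y⌈i⌉ ∘ p i + h i ∘ v⌈i⌉).
  move=> i; rewrite compDl -!compA pd (ccomp_diff v) cshift_diff compNm compmN compDr.
  rewrite (compA y⌈_⌉ f⌈_⌉) -ccompM hP compDl [RHS]compDr !compA (ccomp_diff y).
  by rewrite addrA addrK.
exists w; apply: ccomp_ext => i; rewrite ccompM wE compDl -!compA.
by have [-> _ _ ->] := E i; rewrite compm1 compm0 addr0.
Qed.

(** The null homotopy of [w ∘ u], extended to [C] by means of [p], modifies [w] into a homotopic map
    that vanishes strictly on [Y]; this one factors through the projection [v]. *)
Lemma cone_factor Z (w : Mor C Z) :
  nullhomotopic (w ∘ u) -> exists x, nullhomotopic (w - x ∘ v).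
Proof.
move=> [h hP]; have [s [p [E up pd ds]]] := coneE.
have [w' [w'0 w'E]] := null_modify w (fun k => h k ∘ p (k + 1)).
have w'u i : w'⌈i⌉ ∘ u⌈i⌉ = 0.
  elim/int_succP: i => k; rewrite w'E compBl -ccompM hP.
  have [pu _ _ vu] := E (k + 1).
  rewrite compDl -!compA pu compm1 -ccomp_diff (compA (p _)).
  by have [-> _ _ _] := E (k + 1 + 1); rewrite comp1m subrr.
have [|x xE] := @exists_cmap X⟨1⟩ Z (fun i => w'⌈i⌉ ∘ s i).
  move=> i; rewrite cshift_diff compmN compA -ccomp_diff -compA ds compBr compA w'u comp0m.
  by rewrite add0r compA.
exists x; have -> : x ∘ v = w' => //; apply: ccomp_ext => i.
by rewrite ccompM xE -compA -[RHS]compm1 -up compDr !compA w'u comp0m add0r.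
Qed.

Lemma cone_lift P (x : Mor P X⟨1⟩) :
  nullhomotopic (f⟪1⟫ ∘ x) -> exists w, v ∘ w = x.
Proof.
move=> [h hP]; have [s [p [E up pd ds]]] := coneE.
(* A homotopy into [Y⟨1⟩] maps degree [k + 1] of [P] to degree [k + 1] of [Y]; reindexed, it is the
   component in [Y] of the lift. *)
have [H HE] := @reindex_succ (fun i => Mor (P⌊i⌋) (Y⌊i⌋)) h.
have fx i : f⌈i + 1⌉ ∘ x⌈i⌉ = - (cdiff Y i (i + 1) ∘ H i) + H (i + 1) ∘ cdiff P i (i + 1).
  elim/int_succP: i => k; have := hP k.
  by rewrite ccompM cshift_comp cshift_diff compNm !HE.
have aux (V : zmodType) (a b c : V) : - c + b = - a + b - c + a.
  by rewrite addrAC (addrC (- a)) subrK addrC.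
have [|w wE] := @exists_cmap P C (fun i => s i ∘ x⌈i⌉ + u⌈i⌉ ∘ H i).
  move=> i; rewrite compDl -!compA (ccomp_diff x) cshift_diff compNm compmN.
  rewrite [RHS]compDr !(compA (cdiff C _ _)) ds -ccomp_diff compBl -!compA fx.
  by rewrite compDr compmN; exact: aux.
exists w; apply: ccomp_ext => i; rewrite ccompM wE compDr !compA.
by have [_ -> _ ->] := E i; rewrite comp1m comp0m addr0.
Qed.

Lemma cone_colift P (w : Mor P C) :
  nullhomotopic (v ∘ w) -> exists y, nullhomotopic (w - u ∘ y).
Proof.
move=> [h hP]; have [s [p [E up pd ds]]] := coneE.
have [w' [w'0 w'E]] := null_modify w (fun k => s k ∘ h k).
have vw' i : v⌈i⌉ ∘ w'⌈i⌉ = 0.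
  elim/int_succP: i => k; rewrite w'E compBr -ccompM hP compDr !compA.
  have [_ vs _ _] := E (k + 1); rewrite vs comp1m ccomp_diff -(compA (cdiff _ _ _)).
  by have [_ -> _ _] := E k; rewrite compm1 subrr.
have [|y yE] := @exists_cmap P Y (fun i => p i ∘ w'⌈i⌉).
  move=> i; rewrite -compA ccomp_diff !compA pd compDl -(compA f⌈_⌉) vw' compm0.
  by rewrite addr0.
exists y; have -> : u ∘ y = w' => //; apply: ccomp_ext => i.
by rewrite ccompM yE compA -[RHS]comp1m -up compDl -(compA (s i)) vw' compm0 addr0.
Qed.

Lemma cone_in_add U i : in_add U (X⌊i + 1⌋) -> in_add U (Y⌊i⌋) -> in_add U (C⌊i⌋).
Proof.
have [s [p [E up _ _]]] := coneE => aX aY.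
by apply: (in_add_sum _ aY aX); exact: up.
Qed.

End Cone.

Definition is_sum (M N R : A) (i : Mor M R) (j : Mor N R) (p : Mor R M) (q : Mor R N) :=
  [/\ p ∘ i = idm M, q ∘ j = idm N, q ∘ i = 0, p ∘ j = 0 & i ∘ p + j ∘ q = idm R].

Definition has_sums : Prop := (exists Z : A, is_zero Z) /\
  forall M N : A, exists R i j p q, @is_sum M N R i j p q.

(** [has_sums] merely asserts existence; a record in [Type] allows a sum and its maps to be chosen
    simultaneously in all degrees. *)
Record sum_of (M N : A) := SumOf {
  sd_ob : A;
  sd_inl : Mor M sd_ob;
  sd_inr : Mor N sd_ob;
  sd_fst : Mor sd_ob M;
  sd_snd : Mor sd_ob N;
  sdP : is_sum sd_inl sd_inr sd_fst sd_snd
}.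

Lemma sum_data (M N : A) : (exists R i j p q, @is_sum M N R i j p q) -> sum_of M N.
Proof. by case/cid=> R /cid[i /cid[j /cid[p /cid[q ijpq]]]]; exact: SumOf ijpq. Qed.

Hypothesis sums : has_sums.

Lemma exists_cone X Y (f : Mor X Y) : exists C (u : Mor Y C) (v : Mor C X⟨1⟩), is_cone f u v.
Proof.
pose B i := sum_data (proj2 sums (X⌊i + 1⌋) (Y⌊i⌋)).
pose R i := sd_ob (B i).
pose s i : Mor _ (R i) := sd_inl (B i).
pose u i : Mor _ (R i) := sd_inr (B i).
pose v i : Mor (R i) _ := sd_fst (B i).
pose p i : Mor (R i) _ := sd_snd (B i).
have vs i : v i ∘ s i = idm _ by have [] := sdP (B i).
have pu i : p i ∘ u i = idm _ by have [] := sdP (B i).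
have ps i : p i ∘ s i = 0 by have [] := sdP (B i).
have vu i : v i ∘ u i = 0 by have [] := sdP (B i).
have su i : s i ∘ v i + u i ∘ p i = idm _ by have [] := sdP (B i).
pose d i : Mor (R i) (R (i + 1)) :=
  u (i + 1) ∘ (f⌈i + 1⌉ ∘ v i + cdiff Y i (i + 1) ∘ p i) -
  s (i + 1) ∘ (cdiff X (i + 1) (i + 1 + 1) ∘ v i).
have pd i : p (i + 1) ∘ d i = f⌈i + 1⌉ ∘ v i + cdiff Y i (i + 1) ∘ p i.
  by rewrite compBr !(compA (p _)) pu ps comp0m subr0 comp1m.
have vd i : v (i + 1) ∘ d i = - (cdiff X (i + 1) (i + 1 + 1) ∘ v i).
  by rewrite compBr !(compA (v _)) vu vs comp0m sub0r comp1m.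
have dd i : d (i + 1) ∘ d i = 0.
  have e1 : (f⌈i + 1 + 1⌉ ∘ v (i + 1) + cdiff Y (i + 1) (i + 1 + 1) ∘ p (i + 1)) ∘ d i = 0.
    rewrite compDl -!compA vd pd compmN compDr !compA cdiff_sq comp0m addr0.
    by rewrite ccomp_diff addNr.
  have e2 : (cdiff X (i + 1 + 1) (i + 1 + 1 + 1) ∘ v (i + 1)) ∘ d i = 0.
    by rewrite -compA vd compmN compA cdiff_sq comp0m oppr0.
  by rewrite {1}/d compBl -(compA (u _)) e1 -(compA (s _)) e2 !compm0 subr0.
have bd : exists N : nat, forall i : int, (N < `|i|)%N -> is_zero (R i).
  have [N XN] := cterm_bounded X; have [M YM] := cterm_bounded Y.
  exists (N + M).+1 => i iN; apply: is_zero_idm; rewrite -su.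
  rewrite (hom_zeror (XN (i + 1) _) (v i)); last by lia.
  by rewrite (hom_zeror (YM i _) (p i)) ?compm0 ?addr0 //; lia.
pose C := mk_cplx dd bd.
have [|u' u'E] := @exists_cmap Y C u.
  move=> i; rewrite mk_cplx_diff /d compBl -!compA compDl -!compA vu pu !compm0 compm1.
  by rewrite subr0 add0r.
have [|v' v'E] := @exists_cmap C X⟨1⟩ v.
  by move=> i; rewrite mk_cplx_diff vd cshift_diff compNm.
exists C, u', v', s, p => i; split.
- split; first by rewrite -[RHS](pu i) -u'E.
  + by rewrite -[RHS](vs i) -v'E.
  + exact: ps.
  + by rewrite -[RHS](vu i) -u'E -v'E.
  + by rewrite -[RHS](su i) -u'E -v'E (addrC (s i ∘ _)).
- rewrite (addrC (_ ∘ p i)); have := pd i; rewrite -v'E => <-.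
  by rewrite -mk_cplx_diff.
Qed.

End Chains.

(** * Concentrated complexes, brutal truncation and contractibility *)

Section Stalks.
Variables (K : fieldType) (A : kcat K).
Implicit Types X Y Z C P : Cb A.

Lemma cmap_iso X Y (f : Mor X Y) : (forall i, is_iso f⌈i⌉) -> is_iso f.
Proof.
move=> fi; pose g i := sval (cid (fi i)).
have gf i : g i ∘ f⌈i⌉ = idm _ by rewrite /g; case: cid => ? [].
have fg i : f⌈i⌉ ∘ g i = idm _ by rewrite /g; case: cid => ? [].
have [|g' g'E] := @exists_cmap K A Y X g.
  move=> i; apply: (iso_cancell (fi (i + 1))).
  by rewrite !compA fg comp1m (ccomp_diff f) -compA fg compm1.
by exists g'; split; apply: ccomp_ext => i; rewrite ccompM g'E.
Qed.

(** Transport between terms of equal degree, as a morphism that exists for all [i] and [j] and is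
    zero when they differ. Formulas can thus be written uniformly in the degree. *)
Definition ctr X i j : Mor X⌊i⌋ X⌊j⌋ :=
  if i =P j is ReflectT e then ecast z (Mor X⌊i⌋ X⌊z⌋) e (idm _) else 0.

Lemma ctr_id X i : ctr X i i = idm _.
Proof. by rewrite /ctr; case: eqP => // e; rewrite (eq_irrelevance e erefl). Qed.

Lemma ctr_diff X i i' j j' : i = i' -> j = j' ->
  ctr X j j' ∘ cdiff X i j = cdiff X i' j' ∘ ctr X i i'.
Proof. by move=> <- <-; rewrite !ctr_id comp1m compm1. Qed.

Lemma ctr_iso X i j : i = j -> is_iso (ctr X i j).
Proof. by move=> <-; rewrite ctr_id; exact: is_iso_id. Qed.

Definition cunshift : functor (Cb A) (Cb A) := Cb_shift A (-1).

Lemma cunshiftK X : iso_ob (cunshift X)⟨1⟩ X.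
Proof.
have e i : i + 1 - 1 = i :> int by rewrite addrK.
have [|f fE] := @exists_cmap K A (cunshift X)⟨1⟩ X (fun i => ctr X (i + 1 - 1) i).
  move=> i; rewrite cshift_diff {1}/cdiff /= expr1 scaleN1r opprK.
  exact: ctr_diff.
by exists f; apply: cmap_iso => i; rewrite fE; exact: ctr_iso.
Qed.

(** Unlike being a literal stalk complex, this property passes to shifts and unshifts, with terms
    that agree by definition. *)
Definition conc a X : Prop := forall i, i != a -> is_zero X⌊i⌋.

Lemma conc_shift a X : conc (a + 1) X -> conc a X⟨1⟩.
Proof. by move=> cX i ia; apply: (cX (i + 1)); apply: contra_neq ia; exact: addIr. Qed.

Lemma conc_unshift a X : conc a X -> conc (a + 1) (cunshift X).
Proof.
move=> cX i ia; apply: (cX (i - 1)); apply: contra_neq ia => <-.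
by rewrite subrK.
Qed.

Lemma conc_diff a X i j : conc a X -> cdiff X i j = 0.
Proof.
move=> cX; have [->|/cdiff_shape //] := eqVneq j (i + 1).
have [ia|ia] := eqVneq i a; last exact: (hom_zerol (cX i ia)).
by apply: (hom_zeror (cX (i + 1) _)); lia.
Qed.

Lemma conc_ext a X Y (f g : Mor X Y) : conc a X -> f⌈a⌉ = g⌈a⌉ -> f = g.
Proof.
move=> cX fg; apply: ccomp_ext => i; have [->//|ia] := eqVneq i a.
have X0 := hom_zerol (cX i ia).
by rewrite (X0 _ f⌈i⌉) (X0 _ g⌈i⌉).
Qed.

Lemma conc_map a X Y (g : Mor X⌊a⌋ Y⌊a⌋) : conc a X -> cdiff Y a (a + 1) ∘ g = 0 ->
  exists f : Mor X Y, f⌈a⌉ = g.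
Proof.
move=> cX dg; have [|f fE] := @exists_cmap K A X Y (fun i => ctr Y a i ∘ g ∘ ctr X i a).
  move=> i; rewrite (conc_diff _ _ cX) compm0.
  have [->|ia] := eqVneq i a; last by rewrite (hom_zerol (cX i ia) (ctr X i a)) !compm0.
  by rewrite ctr_id comp1m compA dg comp0m.
by exists f; rewrite fE !ctr_id comp1m compm1.
Qed.

(** Of a homotopy only the component from degree [a + 1] of [X] to degree [a] of [Y] survives.
    Homotopy classes of maps are therefore cocycles modulo boundaries, tested on the single term of
    [X]. *)
Lemma conc_null a X Y (f : Mor X Y) : conc (a + 1) X ->
  nullhomotopic f <-> exists h, f⌈a + 1⌉ = cdiff Y a (a + 1) ∘ h.
Proof.
move=> cX; split=> [[h hP]|[h hE]].
  by exists (h a); rewrite hP (conc_diff _ _ cX) compm0 addr0.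
exists (fun k => ctr Y a k ∘ h ∘ ctr X (k + 1) (a + 1)) => k.
rewrite (conc_diff _ _ cX) compm0 addr0.
have [->|ka] := eqVneq k a; first by rewrite !ctr_id comp1m compm1.
have Xk : is_zero X⌊k + 1⌋ by apply: cX; lia.
by rewrite (hom_zerol Xk f⌈k + 1⌉) (hom_zerol Xk (ctr X (k + 1) _)) !compm0.
Qed.

Lemma conc_zero a X : conc a X -> is_zero X⌊a⌋ -> is_zero X.
Proof.
move=> cX X0; apply: is_zero_idm; apply: (conc_ext cX).
exact: (hom_zerol X0).
Qed.

Section Restriction.
Variables (O : A) (O0 : is_zero O).

Definition res (b : bool) (M : A) : A := if b then M else O.
Definition rin b M : Mor (res b M) M := if b return Mor (res b M) M then idm M else 0.
Definition rout b M : Mor M (res b M) := if b return Mor M (res b M) then idm M else 0.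

Lemma res_zero (b : bool) M : ~~ b -> is_zero (res b M).
Proof. by case: b. Qed.
Lemma res_id (b : bool) M : is_zero M -> is_zero (res b M).
Proof. by case: b. Qed.
Lemma routK b M : rout b M ∘ rin b M = idm _.
Proof. by case: b; rewrite /= ?comp1m //; exact: (etrans (hom_zerol O0 _) (esym (hom_zerol O0 _))). Qed.
Lemma rinK (b : bool) M : b -> rin b M ∘ rout b M = idm M.
Proof. by case: b => //= _; rewrite comp1m. Qed.
Lemma res_in_add U b M : in_add U M -> in_add U (res b M).
Proof. by case: b => //= _; exact: in_add_zero. Qed.

Lemma exists_conc a M : exists X, conc a X /\ iso_ob X⌊a⌋ M.
Proof.
pose X i := res (i == a) M; pose d i : Mor (X i) (X (i + 1)) := 0.
have dd i : d (i + 1) ∘ d i = 0 by rewrite comp0m.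
have bd : exists N : nat, forall i : int, (N < `|i|)%N -> is_zero (X i).
  by exists `|a|%N => i ai; apply: res_zero; lia.
exists (mk_cplx dd bd); split; first by move=> i ia; exact: res_zero.
by rewrite /cterm /= /X eqxx; exact: iso_ob_refl.
Qed.

(** Splitting off the lowest term [X⌊a⌋] presents [X] as the cone of a map
    from that term, placed in degree [a + 1], to the rest. *)
Lemma brutal_cone a X : (forall i, i < a -> is_zero X⌊i⌋) ->
  exists X' Y' (f : Mor X' Y') (u : Mor Y' X) (v : Mor X X'⟨1⟩),
  [/\ is_cone f u v, conc (a + 1) X', forall i, i <= a -> is_zero Y'⌊i⌋,
      forall i, is_zero X⌊i⌋ -> is_zero Y'⌊i⌋ &
      forall U, (forall i, in_add U X⌊i⌋) ->
        (forall i, in_add U X'⌊i⌋) /\ (forall i, in_add U Y'⌊i⌋)].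
Proof.
move=> Xa; pose y i := res (a < i) X⌊i⌋; pose x i := res (i == a + 1) X⌊a⌋.
pose rO i : Mor X⌊i⌋ (y i) := rout (a < i) X⌊i⌋.
pose rI i : Mor (y i) X⌊i⌋ := rin (a < i) X⌊i⌋.
pose sO i : Mor X⌊a⌋ (x i) := rout (i == a + 1) X⌊a⌋.
pose sI i : Mor (x i) X⌊a⌋ := rin (i == a + 1) X⌊a⌋.
have rIO i : a < i -> rI i ∘ rO i = idm _ by exact: rinK.
have rOI i : rO i ∘ rI i = idm _ by exact: routK.
have sOI i : sO i ∘ sI i = idm _ by exact: routK.
have sIO i : i = a + 1 -> sI i ∘ sO i = idm _ by move=> ->; apply: rinK.
have y0 i : i <= a -> is_zero (y i) by move=> ia; apply: res_zero; lia.
have x0 i : i != a + 1 -> is_zero (x i) by exact: res_zero.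
pose dy i : Mor (y i) (y (i + 1)) := rO (i + 1) ∘ cdiff X i (i + 1) ∘ rI i.
pose dx i : Mor (x i) (x (i + 1)) := 0.
have dyy i : dy (i + 1) ∘ dy i = 0.
  have [ai|ia] := ltP a (i + 1); last by rewrite (hom_zeror (y0 _ ia) (dy i)) compm0.
  rewrite /dy !compA -(compA _ (rI _)) rIO // compm1.
  by rewrite -(compA _ (cdiff _ _ _) (cdiff _ _ _)) cdiff_sq compm0 comp0m.
have dxx i : dx (i + 1) ∘ dx i = 0 by rewrite comp0m.
have ybd : exists N : nat, forall i : int, (N < `|i|)%N -> is_zero (y i).
  by have [N XN] := cterm_bounded X; exists N => i iN; apply: res_id; exact: XN.
have xbd : exists N : nat, forall i : int, (N < `|i|)%N -> is_zero (x i).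
  by exists (`|a| + 1)%N => i ai; apply: x0; lia.
pose X' := mk_cplx dxx xbd; pose Y' := mk_cplx dyy ybd.
have rId i : rI (i + 1) ∘ dy i = cdiff X i (i + 1) ∘ rI i.
  have [ai|ia] := ltP a i; last by rewrite (hom_zerol (y0 _ ia) (dy i)) (hom_zerol (y0 _ ia) (rI i)) !compm0.
  by rewrite /dy !compA rIO ?comp1m //; lia.
have rOd i : a < i -> rO (i + 1) ∘ cdiff X i (i + 1) = dy i ∘ rO i.
  by move=> ai; rewrite /dy -[in RHS]compA rIO // compm1.
(* The only component that can be nonzero is the differential of [X] from degree [a] to [a + 1];
   [cdiff_sq] makes it a chain map. *)
have [|f fE] := @exists_cmap K A X' Y' (fun i => rO i ∘ cdiff X a i ∘ sI i).
  move=> i; rewrite !mk_cplx_diff compm0 !compA.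
  have [ia|ia] := eqVneq i (a + 1); last by rewrite (hom_zerol (x0 _ ia) (sI i)) compm0.
  rewrite -rOd; last by lia.
  by rewrite -(compA (rO _)) cdiff_sq compm0 comp0m.
have [|u uE] := @exists_cmap K A Y' X rI.
  by move=> i; rewrite mk_cplx_diff rId.
have [|v vE] := @exists_cmap K A X X'⟨1⟩ (fun i => sO (i + 1) ∘ ctr X i a).
  move=> i; rewrite cshift_diff mk_cplx_diff oppr0 comp0m.
  have [ia|ia] := eqVneq (i + 1) a; last by rewrite (_ : ctr X (i + 1) a = 0) ?compm0 ?comp0m // /ctr; case: eqP ia.
  have Xi : is_zero X⌊i⌋ by apply: Xa; lia.
  by rewrite (hom_zerol Xi (cdiff X i _)) compm0.
exists X', Y', f, u, v; split.
- exists (fun i => ctr X a i ∘ sI (i + 1)), rO => i.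
  have vE' : cm (v : cmap X X'⟨1⟩) i = sO (i + 1) ∘ ctr X i a := vE i.
  have uE' : cm (u : cmap Y' X) i = rI i := uE i.
  have fE' : cm (f : cmap X' Y') (i + 1) = rO (i + 1) ∘ cdiff X a (i + 1) ∘ sI (i + 1) := fE (i + 1).
  rewrite vE' uE' fE'.
  (* In degree [a] the rest [Y'] vanishes and the cone consists of the split-off term; in all other
     degrees the contribution of [X'] vanishes. *)
  have [ia|ia] := eqVneq i a.
    have si : sI (i + 1) ∘ sO (i + 1) = idm _ by apply: sIO; rewrite ia.
    have yi : is_zero (y i) by apply: y0; rewrite ia.
    move: si yi; subst i => si yi; rewrite !ctr_id; split; [split|].
    + exact: rOI.
    + by rewrite compm1 comp1m sOI.
    + by rewrite (hom_zeror yi (rO a)) comp0m.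
    + by rewrite (hom_zerol yi (rI a)) compm0.
    + by rewrite (hom_zerol yi (rI a)) comp0m add0r comp1m compm1 si.
    + rewrite (hom_zeror yi (rO a)) !compm0 add0r compm1 -!compA si compm1.
      by [].
  have xi : is_zero (x (i + 1)) by apply: x0; lia.
  have s0 : sI (i + 1) = 0 by exact: (hom_zerol xi).
  have c0 : sO (i + 1) = 0 by exact: (hom_zeror xi).
  rewrite s0 c0 !(comp0m, compm0) addr0; split; [split|].
  + exact: rOI.
  + exact: (esym (hom_zerol xi _)).
  + by [].
  + by [].
  + have [ai|ai] := ltP a i; first exact: rIO.
    have Xi : is_zero X⌊i⌋ by apply: Xa; lia.
    exact: (etrans (hom_zerol Xi _) (esym (hom_zerol Xi _))).
  + have [ai|ai] := ltP a i.
      have := rOd i ai; rewrite -(mk_cplx_diff dyy ybd i) addr0; exact.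
    have Xi : is_zero X⌊i⌋ by apply: Xa; lia.
    exact: (etrans (hom_zerol Xi _) (esym (hom_zerol Xi _))).
- by move=> i; exact: x0.
- by move=> i; exact: y0.
- by move=> i; exact: res_id.
- by move=> U aU; split=> i; exact: res_in_add.
Qed.

End Restriction.

Definition has_kernels : Prop :=
  forall (M N : A) (f : Mor M N), exists (Z : A) (i : Mor Z M), is_kernel f i.
Definition has_cokernels : Prop :=
  forall (M N : A) (f : Mor M N), exists (Q : A) (p : Mor N Q), is_cokernel f p.

Lemma kernel_mono (M N Z W : A) (f : Mor M N) (i : Mor Z M) (g h : Mor W Z) :
  is_kernel f i -> i ∘ g = i ∘ h -> g = h.
Proof.
move=> [fi univ] gh; have [|k [_ uniq]] := univ _ (i ∘ h).
  by rewrite compA fi comp0m.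
by rewrite -(uniq g gh) -(uniq h).
Qed.

Lemma cokernel_epi (M N Q W : A) (f : Mor M N) (p : Mor N Q) (g h : Mor Q W) :
  is_cokernel f p -> g ∘ p = h ∘ p -> g = h.
Proof.
move=> [pf univ] gh; have [|k [_ uniq]] := univ _ (h ∘ p).
  by rewrite -compA pf compm0.
by rewrite -(uniq g gh) -(uniq h).
Qed.

Lemma exists_cohomology X i j k : has_kernels -> has_cokernels ->
  exists (Z H : A) (iota : Mor Z X⌊j⌋) (a : Mor X⌊i⌋ Z) (p : Mor Z H),
    is_cohomology (cdiff X i j) (cdiff X j k) iota a p.
Proof.
move=> ker coker; have [Z [iota iotaP]] := ker _ _ (cdiff X j k).
have [a [aE _]] := proj2 iotaP _ (cdiff X i j) (cdiff_sq X i j k).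
by have [H [p pP]] := coker _ _ a; exists Z, H, iota, a, p.
Qed.

Hypotheses (sums : has_sums A) (ker : has_kernels) (coker : has_cokernels).

(** [0 : C -> C] is a quasi-isomorphism. *)
Lemma contractible_Db0 C : nullhomotopic (idm C) -> fmap (Db_functor A) (idm C) = 0.
Proof.
move=> [h hP]; have q : quasi_iso (0 : Mor C C).
  move=> i j k ij jk; have [Z [H [iota [a [p coh]]]]] := exists_cohomology C i j k ker coker.
  exists Z, H, Z, H, iota, a, p, iota, a, p, 0, 0; split=> //.
  - by rewrite compm0 comp0m.
  - by rewrite compm0 comp0m.
  have [iotaP ia pP] := coh; subst j k.
  (* The contraction presents every cocycle as a boundary, so the cohomology [H] is zero and [0] is
     an isomorphism on it. *)
  have aE : idm Z = a ∘ (h i ∘ iota).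
    apply: (kernel_mono iotaP); rewrite compm1 !compA ia.
    have := hP i; rewrite ccomp_id => /(f_equal (comp^~ iota)).
    by rewrite comp1m compDl -!compA (proj1 iotaP) compm0 addr0.
  have p0 : p = 0 by rewrite -(compm1 p) aE compA (proj1 pP) comp0m.
  have H0 : idm H = 0 by apply: (cokernel_epi pP); rewrite p0 !compm0.
  by exists 0; rewrite comp0m H0.
have [g [g0 _]] := loc_functor_iso q.
by rewrite fmap1 -[LHS]g0 (_ : fmap (loc_functor _) (0 : Mor C C) = 0) ?compm0 ?functor0.
Qed.

(** A null-homotopic map extends over the cone of the identity of [X], so it factors through a
    contractible complex. *)
Lemma null_Db0 X Y (f : Mor X Y) : nullhomotopic f -> fmap (Db_functor A) f = 0.
Proof.
move=> f0; have [C [u [v cone]]] := exists_cone sums (idm X).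
have [|w wu] := cone_extend cone (y := f); first by rewrite compm1.
have C0 : nullhomotopic (idm C).
  have [s [p [E up pd ds]]] := coneE cone.
  exists (fun k => s k ∘ p (k + 1)) => k.
  rewrite compA ds -compA pd ccomp_id -up compBl compDr !ccomp_id compm1 comp1m !compA.
  by rewrite addrA subrK.
rewrite -wu -[w]compm1 !fmapM contractible_Db0 //.
by rewrite compm0 comp0m.
Qed.

End Stalks.
(** * Devissage *)

Section Devissage.
Variables (K : fieldType) (T : tridata K) (T_tri : triangulated T).
Variables (A : kcat K) (sums : has_sums A).
Implicit Types X Y Z C P : Cb A.

Variable G : functor (Cb A) T.
Hypothesis G_null : forall X Y (f : Mor X Y), nullhomotopic f -> fmap G f = 0.
Variable theta : forall X, Mor (G X⟨1⟩) (G X)[1].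
Hypothesis theta_iso : forall X, is_iso (theta X).
Hypothesis theta_nat : forall X Y (f : Mor X Y),
  theta Y ∘ fmap G f⟪1⟫ = (fmap G f)⟦1⟧ ∘ theta X.
Hypothesis G_cone : forall X Y C (f : Mor X Y) (u : Mor Y C) (v : Mor C X⟨1⟩),
  is_cone f u v -> dist (fmap G f) (fmap G u) (theta X ∘ fmap G v).

(** Bijectivity of the map induced by [G] from homotopy classes of chain maps [P -> Z] to
    [Hom(G P, G Z)]; it is well defined by [G_null], and the homotopy category need not be
    formed. *)
Definition hom_bij P Z : Prop :=
  (forall f : Mor P Z, fmap G f = 0 -> nullhomotopic f) /\
  (forall t : Mor (G P) (G Z), exists f, fmap G f = t).

(** A four-lemma argument carried out with chain maps up to homotopy: nothing needs
    to be known about morphisms of the derived category. *)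
Lemma cone_hom_bij P X Y C (f : Mor X Y) (u : Mor Y C) (v : Mor C X⟨1⟩) :
  is_cone f u v -> hom_bij P X -> hom_bij P X⟨1⟩ -> hom_bij P Y -> hom_bij P Y⟨1⟩ ->
  hom_bij P C.
Proof.
move=> cone [_ surjX] [injX1 surjX1] [injY surjY] [injY1 _]; have D := G_cone cone.
split=> [w w0|t].
  have [|y wuy] := cone_colift cone (w := w).
    by apply: injX1; rewrite fmapM w0 compm0.
    have uy0 : fmap G u ∘ fmap G y = 0.
      by have := G_null wuy; rewrite functorB w0 sub0r => /(f_equal -%R);
        rewrite opprK oppr0 fmapM.
    have [t ty] := dist_lift T_tri D uy0; have [x xt] := surjX t.
    have yfx : nullhomotopic (y - f ∘ x).
      by apply: injY; rewrite functorB fmapM xt ty subrr.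
    have -> : w = (w - u ∘ y) + (u ∘ (y - f ∘ x) + u ∘ f ∘ x).
      by rewrite compBr compA subrK subrK.
    apply: nullD => //; apply: nullD; first exact: null_compl.
    by apply: null_compr; exact: cone_uf cone.
have [x xE] := surjX1 (fmap G v ∘ t).
have [|w vw] := cone_lift cone (x := x).
  by apply: injY1; rewrite fmapM xE compA -fmapM (G_null (cone_fv cone)) comp0m.
  have [|s sE] := dist_lift2 T_tri D (z := t - fmap G w).
    by rewrite -compA compBr -fmapM vw xE subrr compm0.
  have [y yE] := surjY s; exists (w + u ∘ y).
  by rewrite fmapD fmapM yE sE addrC subrK.
Qed.

(** The same chase in the first variable. Shifts now occur in the source, so [theta] translates
    between [G X⟨1⟩] and the shift of [G X]. *)
Lemma cone_hom_bij_contra Z X Y C (f : Mor X Y) (u : Mor Y C) (v : Mor C X⟨1⟩) :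
  is_cone f u v -> hom_bij X Z -> hom_bij X⟨1⟩ Z -> hom_bij Y Z -> hom_bij Y⟨1⟩ Z ->
  hom_bij C Z.
Proof.
move=> cone [injX _] [injX1 surjX1] [injY surjY] [_ surjY1]; have D := G_cone cone.
have [th [thX Xth]] := theta_iso X.
split=> [g g0|t].
  have [|x gxv] := cone_factor cone (w := g).
    by apply: injY; rewrite fmapM g0 comp0m.
    have xv0 : fmap G x ∘ fmap G v = 0.
      by have := G_null gxv; rewrite functorB g0 sub0r => /(f_equal -%R);
        rewrite opprK oppr0 fmapM.
    have [|w wE] := dist_ext_along2 T_tri (dist_rotl T_tri D) (z := fmap G x ∘ th).
      by rewrite compA -(compA _ th) thX compm1.
    have [w' w'E] := surjY1 (- (w ∘ theta Y)).
    have xw : nullhomotopic (x - w' ∘ f⟪1⟫).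
      apply: injX1; rewrite functorB fmapM w'E compNm -compA theta_nat compA opprK.
      rewrite -[w ∘ _]opprK -compmN wE compNm -compA thX compm1.
      by rewrite subrr.
    have -> : g = (g - x ∘ v) + ((x - w' ∘ f⟪1⟫) ∘ v + w' ∘ (f⟪1⟫ ∘ v)).
      by rewrite compBl compA subrK subrK.
    apply: nullD => //; apply: nullD; first exact: null_compr.
    by apply: null_compl; exact: cone_fv cone.
have [y yE] := surjY (t ∘ fmap G u).
have [|w wu] := cone_extend cone (y := y).
  by apply: injX; rewrite fmapM yE -compA -fmapM (G_null (cone_uf cone)) compm0.
  have [|s sE] := dist_ext_along2 T_tri D (z := t - fmap G w).
    by rewrite compBl -fmapM wu yE subrr.
  have [x xE] := surjX1 (s ∘ theta X); exists (w + x ∘ v).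
  by rewrite fmapD fmapM xE -compA sE addrC subrK.
Qed.

Variables (U : A) (J : functor A T).
Hypotheses (J_faithful : faithful J) (J_full : full J)
  (J_orth : forall a M, a != 0 -> hom_zero (shiftn a (J U)) (J M)).
Variable gamma : forall X, conc 0 X -> Mor (G X) (J X⌊0⌋).
Hypothesis gamma_iso : forall X (cX : conc 0 X), is_iso (gamma cX).
Hypothesis gamma_nat : forall X Y (cX : conc 0 X) (cY : conc 0 Y) (f : Mor X Y),
  gamma cY ∘ fmap G f = fmap J f⌈0⌉ ∘ gamma cX.

Lemma G_conc a X : conc a X -> iso_ob (G X) (shiftn (- a) (J X⌊a⌋)).
Proof.
elim/int_ind2: a X => [X cX|a IHa X cX|a IHa X cX].
- by rewrite oppr0; exists (gamma cX).
- apply: (shift_reflect T_tri).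
  apply: (iso_ob_trans (iso_ob_sym (ex_intro _ _ (theta_iso X)))).
  apply: (iso_ob_trans (IHa _ (conc_shift cX))).
  have := shiftnS T_tri (- (a + 1)) (J X⌊a + 1⌋).
  by rewrite opprD addrNK => /iso_ob_sym.
- apply: (iso_ob_trans (functor_iso_ob G (iso_ob_sym (cunshiftK X)))).
  apply: (iso_ob_trans (ex_intro _ _ (theta_iso _))).
  apply: (iso_ob_trans (functor_iso_ob _ (IHa _ (conc_unshift cX)))).
  apply: (iso_ob_trans (shiftnS T_tri _ _)); rewrite opprD addrNK.
  apply: shiftn_iso; apply: functor_iso_ob.
  by exists (ctr X (a + 1 - 1) a); apply: ctr_iso; rewrite addrK.
Qed.

Lemma G_conc_orth a b P Z : conc a P -> conc b Z -> in_add U P⌊a⌋ -> a != b ->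
  hom_zero (G P) (G Z).
Proof.
move=> cP cZ aP ab.
apply: (hom_zero_isol (iso_ob_sym (G_conc cP))).
apply: (hom_zero_isor (iso_ob_sym (G_conc cZ))).
have := hom_zero_shiftn T_tri (- b) (b - a) 0 (J P⌊a⌋) (J Z⌊b⌋).
rewrite add0r addrC addKr => ->.
have aJ := functor_add (shiftn_functor T (b - a)) (functor_add J aP).
by apply: (hom_zero_addl aJ); apply: J_orth; lia.
Qed.

(** In degree [0] this is full faithfulness of [J], carried over by [gamma]. Other degrees are
    reached by [theta]: upwards by shifting [X] and [Y], downwards by writing them as shifts of
    their unshifts. Strict injectivity is possible because no homotopies exist between complexes in
    the same single degree. *)
Lemma G_conc_bij a X Y : conc a X -> conc a Y ->
  (forall f : Mor X Y, fmap G f = 0 -> f = 0) /\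
  (forall t : Mor (G X) (G Y), exists f, fmap G f = t).
Proof.
elim/int_ind2: a X Y => [X Y cX cY|a IHa X Y cX cY|a IHa X Y cX cY].
- split=> [f f0|t].
    apply: (conc_ext cX); apply: J_faithful.
    by apply: (iso_cancelr (gamma_iso cX)); rewrite -(gamma_nat _ cY) f0 compm0 comp0m.
  have [g [gX Xg]] := gamma_iso cX.
  have [j jE] := J_full (gamma cY ∘ t ∘ g).
  have [|f fE] := conc_map (g := j) cX; first by rewrite (conc_diff _ _ cY) comp0m.
  exists f; apply: (iso_cancell (gamma_iso cY)).
  by rewrite (gamma_nat cX) fE jE -compA gX compm1.
- have [inj surj] := IHa _ _ (conc_shift cX) (conc_shift cY).
  split=> [f f0|t].
    have f1 : f⟪1⟫ = 0.
      by apply: inj; apply: (iso_cancell (theta_iso Y));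
        rewrite theta_nat f0 functor0 compm0 comp0m.
    apply: (conc_ext cX).
    by have := f_equal (fun g => ccomp g a) f1.
  have [th [thY Yth]] := theta_iso Y.
  have [g gE] := surj (th ∘ t⟦1⟧ ∘ theta X).
  have [|f fE] := conc_map (a := a + 1) (X := X) (Y := Y) (g := g⌈a⌉) cX.
    by rewrite (conc_diff _ _ cY) comp0m.
  have fg : f⟪1⟫ = g by apply: (conc_ext (conc_shift cX)).
  exists f; apply: (faithful_inj (shift_faithful T_tri)).
  apply: (iso_cancelr (theta_iso X)).
  by rewrite -theta_nat fg gE !compA Yth comp1m.
- have [inj surj] := IHa _ _ (conc_unshift cX) (conc_unshift cY).
  have [i [i' [i'i ii']]] := cunshiftK X; have [j [j' [j'j jj']]] := cunshiftK Y.
  have cX0 := conc_unshift cX; have cY0 := conc_unshift cY.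
  have lift (g : Mor (cunshift A X)⟨1⟩ (cunshift A Y)⟨1⟩) : exists f, f⟪1⟫ = g.
    have [|f fE] := conc_map (a := a + 1) (X := cunshift A X) (Y := cunshift A Y) (g := g⌈a⌉) cX0.
      by rewrite (conc_diff _ _ cY0) comp0m.
    by exists f; apply: (conc_ext (conc_shift cX0)).
  split=> [f f0|t].
    have [f' f'E] := lift (j' ∘ f ∘ i).
    suff f'0 : f' = 0.
      rewrite -(comp1m f) -jj' -(compm1 f) -ii' !compA -(compA j) -(compA j) -f'E f'0.
      by rewrite functor0 compm0 comp0m.
    apply: inj; apply: (shift_faithful T_tri).
    apply: (iso_cancelr (theta_iso _)); rewrite -theta_nat f'E !fmapM f0.
    by rewrite !(compm0, comp0m).
  have [th [thY Yth]] := theta_iso (cunshift A Y).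
  have [th' [thX Xth]] := theta_iso (cunshift A X).
  have [t0 t0E] := shift_full T_tri
    (theta (cunshift A Y) ∘ fmap G j' ∘ t ∘ fmap G i ∘ th').
  have [f fE] := surj t0; exists (j ∘ f⟪1⟫ ∘ i').
  rewrite !fmapM; apply: (iso_cancell (f := fmap G j')); first by apply: functor_iso; exists j.
  apply: (iso_cancelr (f := fmap G i)); first by apply: functor_iso; exists i'.
  apply: (iso_cancell (theta_iso _)).
  rewrite -!compA -fmapM i'i fmap1 compm1 (compA (fmap G j')) -fmapM j'j fmap1 comp1m.
  by rewrite theta_nat fE t0E -!compA thX compm1.
Qed.

Lemma hom_bij_conc a b P Z : conc a P -> conc b Z -> in_add U P⌊a⌋ -> hom_bij P Z.
Proof.
move=> cP cZ aP; have [ab|ab] := eqVneq a b.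
  subst b; have [inj surj] := G_conc_bij cP cZ; split=> // f /inj ->.
  exact: null0.
split=> [f _|t]; last by exists 0; rewrite functor0 (G_conc_orth cP cZ aP ab t).
rewrite (_ : f = 0); first exact: null0.
by apply: (conc_ext cP); apply: (hom_zeror (cZ a ab)).
Qed.

Definition perfect P : Prop := forall i, in_add U P⌊i⌋.

Definition supported (a : int) (n : nat) X : Prop :=
  forall i, ~~ (a <= i < a + Posz n) -> is_zero X⌊i⌋.

Lemma supported_shift a n X : supported (a + 1) n X -> supported a n X⟨1⟩.
Proof. by move=> sX i ai; apply: (sX (i + 1)); lia. Qed.

Lemma exists_supported X : exists a n, supported a n X.
Proof.
(* The interval from [-N] to [N] contains [2N + 1] degrees. *)
have [N XN] := cterm_bounded X; exists (- Posz N), (N + N.+1)%N => i ai.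
by apply: XN; lia.
Qed.

Lemma supported0 a X : supported a 0 X -> is_zero X.
Proof.
move=> sX; apply: is_zero_idm; apply: ccomp_ext => i.
have X0 : is_zero X⌊i⌋ by apply: sX; lia.
exact: (hom_zerol X0).
Qed.

Lemma brutal_supported a n X : supported a n.+1 X ->
  exists X' Y' (f : Mor X' Y') (u : Mor Y' X) (v : Mor X X'⟨1⟩),
  [/\ is_cone f u v, conc (a + 1) X', supported (a + 1) n Y' &
      forall V, (forall i, in_add V X⌊i⌋) ->
        (forall i, in_add V X'⌊i⌋) /\ (forall i, in_add V Y'⌊i⌋)].
Proof.
move=> sX; have [O O0] := proj1 sums.
have [|X' [Y' [f [u [v [cone cX' Y'a Y'0 add]]]]]] := brutal_cone O0 (a := a) (X := X).
  by move=> i ia; apply: sX; lia.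
exists X', Y', f, u, v; split=> // i ai; have [ia|ia] := leP i a; first exact: Y'a.
by apply: Y'0; apply: sX; lia.
Qed.

Lemma hom_bij_zero P Z : is_zero P \/ is_zero Z -> hom_bij P Z.
Proof.
move=> PZ; have PZ0 : hom_zero P Z by case: PZ => [/hom_zerol|/hom_zeror].
split=> [f _|t]; first by rewrite (PZ0 f); exact: null0.
exists 0; rewrite functor0; case: PZ => /(functor_zero G) Z0; apply: esym.
- exact: (hom_zerol Z0).
- exact: (hom_zeror Z0).
Qed.

Lemma hom_bij_conc_perfect a P Z : conc a P -> in_add U P⌊a⌋ -> hom_bij P Z.
Proof.
move=> cP aP; have [b [n]] := exists_supported Z.
(* The induction is on the length of the support with its start left free: [Y] starts at [b + 1] and
   [Y⟨1⟩] at [b], both with length [n]. *)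
elim: n b Z => [|n IHn] b Z sZ; first by apply: hom_bij_zero; right; exact: supported0 sZ.
have [X [Y [f [u [v [cone cX sY _]]]]]] := brutal_supported sZ.
apply: (cone_hom_bij cone).
- exact: (hom_bij_conc cP cX aP).
- exact: (hom_bij_conc cP (conc_shift cX) aP).
- exact: IHn sY.
- exact: IHn (supported_shift sY).
Qed.

Lemma hom_bij_perfect P Z : perfect P -> hom_bij P Z.
Proof.
move=> aP; have [b [n]] := exists_supported P.
elim: n b P aP => [|n IHn] b P aP sP.
  by apply: hom_bij_zero; left; exact: supported0 sP.
have [X [Y [f [u [v [cone cX sY /(_ U aP)[aX aY]]]]]]] := brutal_supported sP.
apply: (cone_hom_bij_contra cone).
- exact: (hom_bij_conc_perfect _ cX).
- by apply: (hom_bij_conc_perfect _ (conc_shift cX)); exact: (aX (b + 1)).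
- exact: IHn sY.
- by apply: (IHn b) (supported_shift sY) => i; exact: (aY (i + 1)).
Qed.

Hypotheses (ker : has_kernels A) (coker : has_cokernels A).
Hypothesis U_exact : forall M N Q (f : Mor M N) (p : Mor N Q), is_cokernel f p ->
  (forall x : Mor U Q, exists y, p ∘ y = x) /\
  (forall y : Mor U N, p ∘ y = 0 -> exists x, f ∘ x = y).
Hypothesis U_conservative : forall M N (f : Mor M N),
  (forall x : Mor U M, f ∘ x = 0 -> x = 0) ->
  (forall y : Mor U N, exists x, f ∘ x = y) -> is_iso f.

(** Surjectivity of [p] on cohomology, tested by [U]. The cocycle [x] is a chain map from [U] placed
    in degree [b + 1]; composed with the inverse of [G p] it lifts to a chain map into [P], whose
    composite with [p] agrees with [x] up to homotopy, that is up to a boundary. *)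
Lemma G_iso_lift P M (p : Mor P M) b (x : Mor U M⌊b + 1⌋) : is_iso (fmap G p) ->
  cdiff M (b + 1) (b + 1 + 1) ∘ x = 0 ->
  exists (y : Mor U P⌊b + 1⌋) (h : Mor U M⌊b⌋),
    cdiff P (b + 1) (b + 1 + 1) ∘ y = 0 /\ p⌈b + 1⌉ ∘ y - x = cdiff M b (b + 1) ∘ h.
Proof.
move=> [q [qp pq]] dx; have [O O0] := proj1 sums.
have [S [cS [e [e' [e'e ee']]]]] := exists_conc O0 (b + 1) U.
have aS : in_add U S⌊b + 1⌋ by apply: in_add_iso (in_add_self U); exists e, e'.
have [|xi xiE] := conc_map (Y := M) (g := x ∘ e) cS; first by rewrite compA dx comp0m.
have [_ /(_ (q ∘ fmap G xi))[eta etaE]] := hom_bij_conc_perfect P cS aS.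
have [inj _] := hom_bij_conc_perfect M cS aS.
have /inj/(conc_null _ cS)[h] : fmap G (p ∘ eta - xi) = 0.
  by rewrite functorB fmapM etaE compA pq comp1m subrr.
rewrite ccompB ccompM xiE => hE; exists (eta⌈b + 1⌉ ∘ e'), (h ∘ e'); split.
  by rewrite compA -ccomp_diff (conc_diff _ _ cS) compm0 comp0m.
by rewrite !compA -hE compBl -!compA ee' compm1.
Qed.

(** Injectivity on cohomology, by the same device: if [p] sends the cocycle [y] to a boundary, [G]
    kills the chain map given by [y], which is then null-homotopic. *)
Lemma G_iso_reflect P M (p : Mor P M) b (y : Mor U P⌊b + 1⌋) (h : Mor U M⌊b⌋) :
  is_iso (fmap G p) -> cdiff P (b + 1) (b + 1 + 1) ∘ y = 0 ->
  p⌈b + 1⌉ ∘ y = cdiff M b (b + 1) ∘ h -> exists k, y = cdiff P b (b + 1) ∘ k.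
Proof.
move=> pi dy pyh; have [O O0] := proj1 sums.
have [S [cS [e [e' [e'e ee']]]]] := exists_conc O0 (b + 1) U.
have aS : in_add U S⌊b + 1⌋ by apply: in_add_iso (in_add_self U); exists e, e'.
have [|eta etaE] := conc_map (Y := P) (g := y ∘ e) cS; first by rewrite compA dy comp0m.
have [inj _] := hom_bij_conc_perfect P cS aS.
have /inj/(conc_null _ cS)[k] : fmap G eta = 0.
  apply: (iso_cancell pi); rewrite -fmapM compm0; apply: G_null.
  apply/(conc_null _ cS); exists (h ∘ e).
  by rewrite ccompM etaE !compA pyh.
rewrite etaE => kE; exists (k ∘ e').
by rewrite compA -kE -compA ee' compm1.
Qed.

(** Exactness of [Hom(U, -)] turns maps from [U] to cohomology into cocycles modulo boundaries,
    where the two preceding lemmas apply; [U_conservative] returns to the objects themselves. *)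
Lemma G_iso_quasi_iso P M (p : Mor P M) : is_iso (fmap G p) -> quasi_iso p.
Proof.
move=> pi i j k ij jk; subst j k.
have [ZX [HX [iX [aX [pX cX]]]]] := exists_cohomology P i (i + 1) (i + 1 + 1) ker coker.
have [ZY [HY [iY [aY [pY cY]]]]] := exists_cohomology M i (i + 1) (i + 1 + 1) ker coker.
have [kX iaX kpX] := cX; have [kY iaY kpY] := cY.
have [|z [zE _]] := proj2 kY _ (p⌈i + 1⌉ ∘ iX).
  by rewrite compA -ccomp_diff -compA (proj1 kX) compm0.
have zaX : z ∘ aX = aY ∘ p⌈i⌉.
  by apply: (kernel_mono kY); rewrite !compA zE iaY -compA iaX ccomp_diff.
have [|phi [phiE _]] := proj2 kpX _ (pY ∘ z).
  by rewrite -compA zaX compA (proj1 kpY) comp0m.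
exists ZX, HX, ZY, HY, iX, aX, pX, iY, aY, pY, z, phi; split=> //.
apply: U_conservative => [x phix|x].
  have [x' x'E] := proj1 (U_exact kpX) x; subst x.
  have [|w wE] := proj2 (U_exact kpY) (z ∘ x').
    by rewrite compA -phiE -compA.
  have [||l lE] := G_iso_reflect (y := iX ∘ x') (h := w) pi.
  - by rewrite compA (proj1 kX) comp0m.
  - by rewrite compA -zE -compA -wE compA iaY.
  suff -> : x' = aX ∘ l by rewrite compA (proj1 kpX) comp0m.
  by apply: (kernel_mono kX); rewrite lE compA iaX.
have [x' x'E] := proj1 (U_exact kpY) x; subst x.
have [|y [h [dy yh]]] := G_iso_lift (x := iY ∘ x') pi.
  by rewrite compA (proj1 kY) comp0m.
have [y' [y'E _]] := proj2 kX _ y dy.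
exists (pX ∘ y'); rewrite compA phiE; apply/subr0_eq.
rewrite -compA -compBr (_ : _ - _ = aY ∘ h); first by rewrite compA (proj1 kpY) comp0m.
by apply: (kernel_mono kY); rewrite compBr compA zE -compA y'E yh compA iaY.
Qed.

End Devissage.
(** * The quasi-inverse *)

Section Equivalence.
Variables (K : fieldType) (T : tridata K) (T_tri : triangulated T).
Variables (A : kcat K) (sums : has_sums A) (ker : has_kernels A) (coker : has_cokernels A).
Variable U : A.
Hypothesis U_exact : forall M N Q (f : Mor M N) (p : Mor N Q), is_cokernel f p ->
  (forall x : Mor U Q, exists y, p ∘ y = x) /\
  (forall y : Mor U N, p ∘ y = 0 -> exists x, f ∘ x = y).
Hypothesis U_conservative : forall M N (f : Mor M N),
  (forall x : Mor U M, f ∘ x = 0 -> x = 0) ->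
  (forall y : Mor U N, exists x, f ∘ x = y) -> is_iso f.
Local Notation loc := (fmap (Db_functor A)).

Variable G : functor (Db A) T.
Variable theta : forall X : Db A, Mor (G (shift (Db A) X)) (G X)[1].
Hypothesis theta_iso : forall X, is_iso (theta X).
Hypothesis theta_nat : forall (X Y : Db A) (f : Mor X Y),
  theta Y ∘ fmap G (fmap (shift (Db A)) f) = (fmap G f)⟦1⟧ ∘ theta X.
Hypothesis G_dist : forall (X Y Z : Db A) (f : Mor X Y) (g : Mor Y Z)
    (h : Mor Z (shift (Db A) X)),
  dist f g h -> dist (fmap G f) (fmap G g) (theta X ∘ fmap G h).

Definition Gc : functor (Cb A) T := comp_functor (G : functor (Db_cat A) T) (Db_functor A).

Variable J : functor A T.
Hypotheses (J_faithful : faithful J) (J_full : full J)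
  (J_orth : forall a M, a != 0 -> hom_zero (shiftn a (J U)) (J M)).
Variable gamma : forall X : Cb A, conc 0 X -> Mor (Gc X) (J X⌊0⌋).
Hypothesis gamma_iso : forall X (cX : conc 0 X), is_iso (gamma cX).
Hypothesis gamma_nat : forall X Y (cX : conc 0 X) (cY : conc 0 Y) (f : Mor X Y),
  gamma cY ∘ fmap Gc f = fmap J f⌈0⌉ ∘ gamma cX.
Hypothesis J_generate : forall S : tri_subcat T,
  (forall P, in_add U P -> S (J P)) -> forall X, S X.

Lemma Db_shift_loc (X Y : Cb A) (f : Mor X Y) :
  fmap (shift (Db A)) (loc f : @Mor K (Db A) X Y) = loc f⟪1⟫.
Proof. exact: loc_liftK. Qed.

Lemma Gc_null (X Y : Cb A) (f : Mor X Y) : nullhomotopic f -> fmap Gc f = 0.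
Proof.
move=> /(null_Db0 sums ker coker) f0.
exact: (etrans (f_equal (fmap (G : functor (Db_cat A) T)) f0) (functor0 _ _ _)).
Qed.

Definition theta_c (X : Cb A) : Mor (Gc X⟨1⟩) (Gc X)[1] := theta (X : Db A).

Lemma theta_c_nat (X Y : Cb A) (f : Mor X Y) :
  theta_c Y ∘ fmap Gc f⟪1⟫ = (fmap Gc f)⟦1⟧ ∘ theta_c X.
Proof.
by have := theta_nat (loc f : @Mor K (Db A) X Y); rewrite Db_shift_loc.
Qed.

Lemma cone_dist (X Y C : Cb A) (f : Mor X Y) (u : Mor Y C) (v : Mor C X⟨1⟩) :
  is_cone f u v -> @dist K (Db A) X Y C (loc f) (loc u) (loc v).
Proof.
move=> cone; exists X, Y, C, f, u, v; split=> //.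
exists (idm _), (idm _), (idm _); split; first by split; exact: is_iso_id.
by split; rewrite ?comp1m ?compm1 // (fmap1 (Db_shift A 1)) comp1m.
Qed.

Lemma Gc_cone (X Y C : Cb A) (f : Mor X Y) (u : Mor Y C) (v : Mor C X⟨1⟩) :
  is_cone f u v -> dist (fmap Gc f) (fmap Gc u) (theta_c X ∘ fmap Gc v).
Proof. by move=> /cone_dist/G_dist. Qed.

Lemma Gc_bij (P Z : Cb A) : perfect U P -> hom_bij Gc P Z.
Proof.
exact: (hom_bij_perfect T_tri sums Gc_null (theta := theta_c)
  (fun X => theta_iso X) theta_c_nat Gc_cone J_faithful J_full J_orth
  gamma_iso gamma_nat).
Qed.

Lemma Gc_quasi_iso (P Z : Cb A) (p : Mor P Z) : is_iso (fmap Gc p) -> quasi_iso p.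
Proof.
exact: (G_iso_quasi_iso T_tri sums Gc_null (theta := theta_c)
  (fun X => theta_iso X) theta_c_nat Gc_cone J_faithful J_full J_orth
  gamma_iso gamma_nat ker coker U_exact U_conservative).
Qed.

Lemma loc_null_eq (X Y : Cb A) (f g : Mor X Y) : nullhomotopic (f - g) -> loc f = loc g.
Proof.
move=> /(null_Db0 sums ker coker); rewrite functorB => /eqP.
by rewrite subr_eq0 => /eqP.
Qed.

(** A formal inverse of a quasi-isomorphism [s] applied to a chain map from [P]
    is again a chain map, because [Gc s] is invertible and [Gc] is full. *)
Lemma perfect_loc_full (P Z : Cb A) (q : @Mor K (Db_cat A) P Z) :
  perfect U P -> exists g : Mor P Z, loc g = q.
Proof.
move=> aP.
suff main (X Y : Cb A) (e : expr (@quasi_iso K A) X Y) (g : Mor P X) :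
    exists g' : Mor P Y, loc g' = (cls e : @Mor K (Db_cat A) X Y) ∘ loc g.
  have [g gE] := main _ _ (rep q) (idm P); exists g.
  by rewrite gE repK (fmap1 (Db_functor A)) compm1.
elim: e g => {X Y q} [X Y f|Y X s Ws|X Y W e2 IH2 e1 IH1|X Y e1 IH1 e2 IH2|X Y c e IH] g.
- by exists (f ∘ g); rewrite (fmapM (Db_functor A)).
- have [t [ts st]] : is_iso (fmap Gc s).
    by apply: (functor_iso (G : functor (Db_cat A) T)); exact: loc_functor_iso.
  have [_ /(_ (t ∘ fmap Gc g))[g' g'E]] := Gc_bij Y aP.
  have [inj _] := Gc_bij X aP.
  have sg : loc (s ∘ g') = loc g.
    apply/loc_null_eq/inj; rewrite functorB fmapM g'E compA st comp1m.
    exact: subrr.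
  exists g'; rewrite -sg (fmapM (Db_functor A)) compA.
  rewrite (_ : _ ∘ loc s = idm _) ?comp1m //.
  by rewrite /= loc_compE; apply/clsP; exact: eqv_InvL.
- have [g1 g1E] := IH1 g; have [g2 g2E] := IH2 g1; exists g2.
  by rewrite g2E g1E compA /= loc_compE.
- have [g1 g1E] := IH1 g; have [g2 g2E] := IH2 g; exists (g1 + g2).
  rewrite (fmapD (Db_functor A)) g1E g2E -compDl; congr (_ ∘ _).
  exact: loc_addE.
- have [g1 g1E] := IH g; exists (c *: g1).
  rewrite (loc_functor_klinear (@quasi_iso K A) c g1).
  rewrite (_ : fmap (loc_functor _) g1 = loc g1) // g1E -compZl; congr (_ ∘ _).
  exact: loc_scaleE.
Qed.

Lemma G_perfect_inj (P : Cb A) (Z : Db A) (q q' : @Mor K (Db A) P Z) :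
  perfect U P -> fmap G q = fmap G q' -> q = q'.
Proof.
move=> aP; have [g <-] := perfect_loc_full q aP; have [g' <-] := perfect_loc_full q' aP.
move=> gg'; apply: loc_null_eq; have [inj _] := Gc_bij Z aP; apply: inj.
by apply/eqP; rewrite functorB subr_eq0; apply/eqP.
Qed.

Lemma G_perfect_full (P : Cb A) (Z : Db A) (t : Mor (G P) (G Z)) :
  perfect U P -> exists q : @Mor K (Db A) P Z, fmap G q = t.
Proof.
by move=> aP; have [_ /(_ t)[g gE]] := Gc_bij Z aP; exists (loc g).
Qed.

(** Conservativity of [G] on maps out of perfect complexes: [q] comes from a chain map, which is a
    quasi-isomorphism and therefore has a formal inverse. *)
Lemma G_perfect_iso (P : Cb A) (Z : Db A) (q : @Mor K (Db A) P Z) :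
  perfect U P -> is_iso (fmap G q) -> is_iso q.
Proof.
move=> aP; have [g <-] := perfect_loc_full q aP => gi.
by apply: loc_functor_iso; exact: Gc_quasi_iso.
Qed.

Lemma perfect_shift (P : Cb A) : perfect U P -> perfect U P⟨1⟩.
Proof. by move=> aP i; exact: (aP (i + 1)). Qed.

Lemma perfect_ess_surj (X : T) : exists P : Cb A, perfect U P /\ iso_ob (Gc P) X.
Proof.
pose S (X : T) := exists P : Cb A, perfect U P /\ iso_ob (Gc P) X.
have [O O0] := proj1 sums.
have Siso : iso_closed S.
  by move=> Y Z YZ [P [aP PY]]; exists P; split=> //; exact: iso_ob_trans YZ.
have Szero Z : is_zero Z -> S Z.
  move=> Z0; have [P [cP [e ei]]] := exists_conc O0 0 O.
  have P0 : is_zero P⌊0⌋ by apply: is_zero_iso O0; apply: iso_ob_sym; exists e.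
  exists P; split=> [i|].
    apply: in_add_zero; have [->//|i0] := eqVneq i 0; exact: cP.
  by apply: iso_zero => //; apply: functor_zero; exact: conc_zero cP P0.
have Sshift Y : S Y -> S Y[1].
  move=> [P [aP PY]]; exists P⟨1⟩; split; first exact: perfect_shift.
  apply: (iso_ob_trans (ex_intro _ (theta_c P) (theta_iso P))).
  exact: functor_iso_ob.
have Sunshift Y : S Y -> S (unshift T Y).
  move=> [P [aP PY]]; exists (cunshift A P); split; first by move=> i; exact: (aP (i - 1)).
  apply: (shift_reflect T_tri).
  apply: (iso_ob_trans (iso_ob_sym (ex_intro _ (theta_c _) (theta_iso _)))).
  apply: (iso_ob_trans (functor_iso_ob Gc (cunshiftK P))).
  apply: (iso_ob_trans PY); apply: iso_ob_sym.
  exact: shift_unshift.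
have Scone X1 Y Z (f : Mor X1 Y) (g : Mor Y Z) (h : Mor Z X1[1]) :
    dist f g h -> S X1 -> S Y -> S Z.
  move=> D [P [aP [i ii]]] [Q [aQ [j ji]]]; have [j' [j'j jj']] := ji.
  (* The first map of the triangle lifts to a chain map of perfect complexes. Its cone is perfect
     term by term, and the five lemma identifies the image of the cone with [Z]. *)
  have [_ /(_ (j' ∘ f ∘ i))[a aE]] := Gc_bij Q aP.
  have [C [u [v cone]]] := exists_cone sums a; exists C; split.
    by move=> k; apply: (cone_in_add cone); [exact: (aP (k + 1))|exact: aQ].
  have jaE : j ∘ fmap Gc a = f ∘ i by rewrite aE !compA jj' comp1m.
  have [c [cu hc]] := tri_mor T_tri (Gc_cone cone) D jaE.
  by exists c; exact: (dist_iso3 T_tri (Gc_cone cone) D ii ji jaE cu hc).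
apply: (J_generate (S := TriSubcat Siso Szero Sshift Sunshift Scone)) => P aP.
have [X1 [cX XP]] := exists_conc O0 0 P; exists X1; split=> [i|].
  have [->|i0] := eqVneq i 0; first exact: in_add_iso aP.
  by apply: in_add_zero; exact: cX.
by apply: iso_ob_trans (functor_iso_ob J XP); exists (gamma cX).
Qed.

Definition resolve (X : T) : Cb A := sval (cid (perfect_ess_surj X)).

Lemma resolve_perfect X : perfect U (resolve X).
Proof. by rewrite /resolve; case: cid => P []. Qed.

Lemma resolve_iso X : iso_ob (Gc (resolve X)) X.
Proof. by rewrite /resolve; case: cid => P []. Qed.

Definition res_phi X : Mor (Gc (resolve X)) X := sval (cid (resolve_iso X)).
Definition res_psi X : Mor X (Gc (resolve X)) := sval (cid (svalP (cid (resolve_iso X)))).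

Lemma res_psiK X : res_psi X ∘ res_phi X = idm _.
Proof. exact: (proj1 (svalP (cid (svalP (cid (resolve_iso X)))))). Qed.

Lemma res_phiK X : res_phi X ∘ res_psi X = idm _.
Proof. exact: (proj2 (svalP (cid (svalP (cid (resolve_iso X)))))). Qed.

Lemma res_phi_iso X : is_iso (res_phi X).
Proof. by exists (res_psi X); split; [exact: res_psiK|exact: res_phiK]. Qed.

Definition resolve_map (X Y : T) (f : Mor X Y) : @Mor K (Db A) (resolve X) (resolve Y) :=
  sval (cid (@G_perfect_full (resolve X) (resolve Y) (res_psi Y ∘ f ∘ res_phi X)
    (@resolve_perfect X))).

Lemma resolve_mapE X Y (f : Mor X Y) :
  fmap G (resolve_map f) = res_psi Y ∘ f ∘ res_phi X.
Proof. by rewrite /resolve_map; case: cid. Qed.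

(** After applying [G], the map [resolve_map f] is the conjugate of [f]. Since [G] is injective on
    morphisms out of perfect complexes, the functor laws may be checked there. *)
Definition resolution : functor T (Db A).
Proof.
refine (@Functor K T (Db A) (fun X => resolve X) resolve_map _ _ _).
- move=> X; apply: (G_perfect_inj (@resolve_perfect X)).
  by rewrite resolve_mapE compm1 fmap1 res_psiK.
- move=> X Y Z g f; apply: (G_perfect_inj (@resolve_perfect X)).
  by rewrite fmapM !resolve_mapE !compA -(compA _ (res_phi _)) res_phiK compm1.
- move=> X Y f g; apply: (G_perfect_inj (@resolve_perfect X)).
  by rewrite fmapD !resolve_mapE compDr compDl.
Defined.

Lemma resolution_equivalence : is_equivalence resolution.
Proof.
exists G; split.
- have ex (M : Db A) : exists q : @Mor K (Db A) (resolve (G M)) M, fmap G q = res_phi (G M).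
    exact: (G_perfect_full _ (@resolve_perfect (G M))).
  exists (fun M => sval (cid (ex M))); split=> [M|M N f].
    case: cid => q /= qE; apply: (G_perfect_iso (@resolve_perfect _)).
    by rewrite qE; exact: res_phi_iso.
  case: (cid (ex M)) => q /= qE; case: (cid (ex N)) => r /= rE.
  apply: (G_perfect_inj (@resolve_perfect _)).
  by rewrite !fmapM qE rE resolve_mapE !compA res_phiK comp1m.
- exists res_phi; split=> [X|X Y f]; first exact: res_phi_iso.
  by rewrite /= resolve_mapE !compA res_phiK comp1m.
Qed.

Lemma resolution_exact : exact_functor resolution.
Proof.
have rP := @resolve_perfect.
have ex (X : T) : exists q : @Mor K (Db A) (resolve X[1]) (shift (Db A) (resolve X)),
    theta (resolve X : Db A) ∘ fmap G q = (res_psi X)⟦1⟧ ∘ res_phi X[1].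
  have [th [thX Xth]] := theta_iso (resolve X : Db A).
  have [q qE] := @G_perfect_full (resolve X[1]) (shift (Db A) (resolve X))
    (th ∘ (res_psi X)⟦1⟧ ∘ res_phi X[1]) (rP _).
  by exists q; rewrite qE !compA Xth comp1m.
pose th X := sval (cid (ex X)).
have thE X : theta (resolve X : Db A) ∘ fmap G (th X) = (res_psi X)⟦1⟧ ∘ res_phi X[1].
  by rewrite /th; case: cid.
exists th; split=> [X|X Y f|X Y Z f g h D].
- apply: (G_perfect_iso (rP _)); have [t [tX Xt]] := theta_iso (resolve X : Db A).
  rewrite -(comp1m (fmap G _)) -tX -compA thE; apply: is_iso_comp; first by exists (theta (resolve X : Db A)).
  apply: is_iso_comp (res_phi_iso _); apply: functor_iso.
  by exists (res_phi X); split; [exact: res_phiK|exact: res_psiK].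
- apply: (G_perfect_inj (rP _)); apply: (iso_cancell (theta_iso _)).
  rewrite !fmapM !compA thE theta_nat -!compA thE !resolve_mapE !compA -!fmapM.
  rewrite -(compA _ (res_phi _)) -(compA _ (res_phi X)) !res_phiK !compm1.
  by rewrite -fmapM.
(* The lifted first map has a cone [C] with [G C] isomorphic to [Z], compatibly with the triangles.
   Lifting this isomorphism to [r] exhibits the image triangle as isomorphic to a cone triangle; the
   required squares commute because they do after [G]. *)
- have [a aE] := perfect_loc_full (resolve_map f) (rP X).
  have [C [u [v cone]]] := exists_cone sums a.
  have GaE : res_phi Y ∘ fmap Gc a = f ∘ res_phi X.
    by rewrite [fmap Gc a](f_equal (fmap G) aE) resolve_mapE !compA res_phiK comp1m.
  have [c [cu hc]] := tri_mor T_tri (Gc_cone cone) D GaE.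
  have [d [dc cd]] := dist_iso3 T_tri (Gc_cone cone) D (res_phi_iso X) (res_phi_iso Y) GaE cu hc.
  have [r rE] := @G_perfect_full (resolve Z) C (d ∘ res_phi Z) (rP Z).
  exists (resolve X), (resolve Y), C, a, u, v; split=> //.
  exists (idm _), (idm _), r; split.
    split; [exact: is_iso_id|exact: is_iso_id|].
    apply: (G_perfect_iso (rP _)); rewrite rE; apply: is_iso_comp (res_phi_iso _).
    by exists c.
  split.
  + by rewrite comp1m compm1 aE.
  + rewrite compm1; apply: (G_perfect_inj (rP _)).
    rewrite fmapM rE resolve_mapE !compA -(compA d) res_phiK compm1.
    rewrite -[RHS]comp1m -dc -!compA; congr (d ∘ _).
    exact: (esym cu).
  + rewrite (fmap1 (Db_shift A 1)) comp1m; apply: (G_perfect_inj (rP _)).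
    apply: (iso_cancell (theta_iso _)).
    rewrite !fmapM rE resolve_mapE !compA thE -!compA (compA (res_phi X[1])) res_phiK comp1m.
    have hc' : h ∘ c = (res_phi X)⟦1⟧ ∘ theta_c (resolve X) ∘ fmap Gc v.
      by rewrite -hc compA.
    rewrite -[LHS]comp1m.
    have -> : theta (resolve X : Db A) ∘ (fmap G (loc v) ∘ (d ∘ res_phi Z)) =
        (res_psi X)⟦1⟧ ∘ (h ∘ c) ∘ (d ∘ res_phi Z).
      by rewrite hc' !compA -fmapM res_psiK fmap1 comp1m.
    by rewrite comp1m -!compA (compA c) cd comp1m.
Qed.

Theorem equivalence_of_realization : tri_equivalent T (Db A).
Proof. exists resolution; split; [exact: resolution_exact|exact: resolution_equivalence]. Qed.

End Equivalence.
(** * Derived functors of equivalences *)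

Section InducedFunctor.
Variables (K : fieldType) (A B : kcat K) (F : functor A B).
Hypotheses (F_lin : klinear F) (F_faithful : faithful F) (F_full : full F)
  (F_ess : forall Y : B, exists X : A, iso_ob (F X) Y).

(** Every test object [W] is isomorphic to some [F V], where full faithfulness transfers the
    universal property. *)
Lemma equivalence_kernel (X Y Z : A) (f : Mor X Y) (i : Mor Z X) :
  is_kernel f i -> is_kernel (fmap F f) (fmap F i).
Proof.
move=> [fi univ]; split=> [|W g fg]; first by rewrite -fmapM fi functor0.
have [V [e [e' [e'e ee']]]] := F_ess W.
have [g' g'E] := F_full (g ∘ e).
have [|h [hE uniq]] := univ V g'.
  by apply: F_faithful; rewrite fmapM g'E compA fg comp0m.
exists (fmap F h ∘ e'); split=> [|k kE].
  by rewrite compA -fmapM hE g'E -compA ee' compm1.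
have [l lE] := F_full (k ∘ e).
rewrite (uniq l) ?lE -?compA ?ee' ?compm1 //.
by apply: (faithful_inj F_faithful); rewrite fmapM lE g'E compA kE.
Qed.

Lemma equivalence_cokernel (X Y Q : A) (f : Mor X Y) (p : Mor Y Q) :
  is_cokernel f p -> is_cokernel (fmap F f) (fmap F p).
Proof.
move=> [pf univ]; split=> [|W g gf]; first by rewrite -fmapM pf functor0.
have [V [e [e' [e'e ee']]]] := F_ess W.
have [g' g'E] := F_full (e' ∘ g).
have [|h [hE uniq]] := univ V g'.
  by apply: F_faithful; rewrite fmapM g'E -compA gf compm0.
exists (e ∘ fmap F h); split=> [|k kE].
  by rewrite -compA -fmapM hE g'E compA ee' comp1m.
have [l lE] := F_full (e' ∘ k).
rewrite (uniq l) ?lE ?compA ?ee' ?comp1m //.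
by apply: (faithful_inj F_faithful); rewrite fmapM lE g'E -compA kE.
Qed.

Definition cplx_map (X : cplx A) : cplx B.
Proof.
exists (fun i => F (X i)) (fun i j => fmap F (cd X i j)).
- by move=> i j ij; rewrite cd_shape ?functor0.
- by move=> i j k; rewrite -fmapM cd_sq functor0.
- have [N XN] := cd_bounded X; exists N => i iN.
  exact: functor_zero (XN i iN).
Defined.

Definition cmap_map (X Y : cplx A) (f : cmap X Y) : cmap (cplx_map X) (cplx_map Y).
Proof. by exists (fun i => fmap F (f i)) => i j /=; rewrite -!fmapM cmP. Defined.

Definition Cb_map : functor (Cb A) (Cb B).
Proof.
exists (fun X : Cb A => cplx_map X : Cb B) (fun (X Y : Cb A) (f : cmap X Y) => cmap_map f).
- by move=> X; apply: cmap_eq => i; exact: fmap1.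
- by move=> X Y Z g f; apply: cmap_eq => i; exact: fmapM.
- by move=> X Y f g; apply: cmap_eq => i; exact: fmapD.
Defined.

Lemma Cb_map_klinear : klinear Cb_map.
Proof. by move=> c X Y f; apply: cmap_eq => i; exact: F_lin. Qed.

Lemma Cb_map_quasi_iso (X Y : Cb A) (f : Mor X Y) : quasi_iso f -> quasi_iso (fmap Cb_map f).
Proof.
move=> qf i j k ij jk.
have [ZX [HX [ZY [HY [iX [aX [pX [iY [aY [pY [z [phi [cX cY iz pz iphi]]]]]]]]]]]]] := qf i j k ij jk.
have coh (M' M M'' Z H : A) (a : Mor M' M) (b : Mor M M'') (i' : Mor Z M) a' (p : Mor Z H) :
    is_cohomology a b i' a' p ->
    is_cohomology (fmap F a) (fmap F b) (fmap F i') (fmap F a') (fmap F p).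
  move=> [/equivalence_kernel ker ia /equivalence_cokernel coker].
  by split=> //; rewrite -fmapM ia.
exists (F ZX), (F HX), (F ZY), (F HY), (fmap F iX), (fmap F aX), (fmap F pX).
exists (fmap F iY), (fmap F aY), (fmap F pY), (fmap F z), (fmap F phi).
split; [exact: coh cX|exact: coh cY| | |exact: functor_iso].
- by rewrite -fmapM iz fmapM.
- by rewrite -!fmapM pz.
Qed.

Lemma Db_map_klinear : klinear (comp_functor (Db_functor B) Cb_map).
Proof.
move=> c X Y f; rewrite [LHS](f_equal _ (Cb_map_klinear c f)).
exact: loc_functor_klinear.
Qed.

Lemma Db_map_iso (X Y : Cb A) (s : Mor X Y) :
  quasi_iso s -> is_iso (fmap (comp_functor (Db_functor B) Cb_map) s).
Proof. by move=> qs; apply: loc_functor_iso; exact: Cb_map_quasi_iso. Qed.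

Definition Db_map : functor (Db A) (Db B) := loc_lift Db_map_klinear Db_map_iso.

Lemma Db_map_loc (X Y : Cb A) (f : Mor X Y) :
  fmap Db_map (fmap (Db_functor A) f : @Mor K (Db A) X Y) = fmap (Db_functor B) (fmap Cb_map f).
Proof. exact: loc_liftK. Qed.

(** Both complexes have the same terms, but their differentials agree only through
    [F (- d) = - F d], so an isomorphism with identity components replaces equality. *)
Lemma Cb_map_shift (X : Cb A) : exists k : Mor (Cb_map (cshift A X)) (cshift B (Cb_map X)),
  is_iso k /\ forall i, k⌈i⌉ = idm _.
Proof.
have [|k kE] := @exists_cmap K B (Cb_map (cshift A X)) (cshift B (Cb_map X))
    (fun i => idm (F X⌊i + 1⌋)).
  move=> i; rewrite comp1m compm1 cshift_diff /cdiff /=.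
  by rewrite expr1 scaleN1r functorN.
by exists k; split=> //; apply: cmap_iso => i; rewrite kE; exact: is_iso_id.
Qed.

Definition kappa (X : Cb A) := sval (cid (Cb_map_shift X)).

Lemma kappa_iso X : is_iso (kappa X).
Proof. by have [] := svalP (cid (Cb_map_shift X)). Qed.

Lemma kappaE X i : (kappa X)⌈i⌉ = idm _.
Proof. by have [] := svalP (cid (Cb_map_shift X)). Qed.

Lemma kappa_nat (X Y : Cb A) (f : Mor X Y) :
  kappa Y ∘ fmap Cb_map (fmap (cshift A) f) = fmap (cshift B) (fmap Cb_map f) ∘ kappa X.
Proof. by apply: ccomp_ext => i; rewrite !ccompM !kappaE; exact: etrans (comp1m _) (esym (compm1 _)). Qed.

Lemma Cb_map_cone (X Y C : Cb A) (f : Mor X Y) (u : Mor Y C) (v : Mor C (cshift A X)) :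
  is_cone f u v -> is_cone (fmap Cb_map f) (fmap Cb_map u) (kappa X ∘ fmap Cb_map v).
Proof.
move=> [s [p sp]]; exists (fun i => fmap F (s i)), (fun i => fmap F (p i)) => i.
have [[pu vs ps vu up] pd] := sp i.
have kv : cm (kappa X ∘ fmap Cb_map v : cmap _ _) i = fmap F ((v : cmap _ _) i).
  by apply: etrans (comp1m _); congr (_ ∘ _); exact: kappaE.
rewrite kv /= -!fmapM -!fmapD pu vs ps vu up pd !fmap1 !functor0.
by [].
Qed.

Lemma Db_map_exact : exact_functor Db_map.
Proof.
pose th (X : Db A) : Mor (Db_map (shift (Db A) X)) (shift (Db B) (Db_map X)) :=
  fmap (Db_functor B) (kappa X).
have th_nat (X Y : Db A) (f : Mor X Y) :
    th Y ∘ fmap Db_map (fmap (shift (Db A)) f) = fmap (shift (Db B)) (fmap Db_map f) ∘ th X.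
  (* Morphisms of [Db A] involve formal inverses; [loc_nat] reduces naturality to the images of
     chain maps. *)
  apply: (loc_nat (G := comp_functor (Db_map : functor (Db_cat A) (Db_cat B)) (Db_shift A 1))
    (G' := comp_functor (Db_shift B 1) (Db_map : functor (Db_cat A) (Db_cat B)))).
  move=> {f}X {}Y f.
  have e1 : fmap (Db_shift A 1) (fmap (Db_functor A) f) = fmap (Db_functor A) (fmap (cshift A) f).
    exact: loc_liftK.
  have e2 (X' Y' : Cb B) (g : Mor X' Y') :
      fmap (Db_shift B 1) (fmap (Db_functor B) g) = fmap (Db_functor B) (fmap (cshift B) g).
    exact: loc_liftK.
  have e3 := Db_map_loc f; have e4 := Db_map_loc (fmap (cshift A) f).
  transitivity (fmap (Db_functor B) (kappa Y ∘ fmap Cb_map (fmap (cshift A) f))).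
    rewrite (fmapM (Db_functor B)) -e4; congr (_ ∘ _).
    by rewrite -e1.
  rewrite kappa_nat (fmapM (Db_functor B)) -e2; congr (_ ∘ _).
  by rewrite -e3.
exists th; split=> [X||X Y Z f g h]; [exact: functor_iso (kappa_iso X)|exact: th_nat|].
move=> [X' [Y' [C [f' [u [v [cone [a [b [c [[ai bi ci] [bf cg ah]]]]]]]]]]]].
exists (Cb_map X'), (Cb_map Y'), (Cb_map C), (fmap Cb_map f'), (fmap Cb_map u).
exists (kappa X' ∘ fmap Cb_map v); split; first exact: Cb_map_cone.
exists (fmap Db_map (a : @Mor K (Db A) _ _)), (fmap Db_map (b : @Mor K (Db A) _ _)).
exists (fmap Db_map (c : @Mor K (Db A) _ _)); split.
  by split; apply: (functor_iso Db_map).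
split.
- by have := f_equal (fmap Db_map) bf; rewrite !fmapM Db_map_loc.
- by have := f_equal (fmap Db_map) cg; rewrite !fmapM Db_map_loc.
- rewrite (fmapM (Db_functor B)) compA.
  have -> : fmap (Db_shift B 1) (fmap Db_map (a : @Mor K (Db A) X X')) ∘ th X =
     th X' ∘ fmap Db_map (fmap (shift (Db A)) (a : @Mor K (Db A) X X')).
    exact: (esym (th_nat _ _ _)).
  have := f_equal (fmap Db_map) ah; rewrite !fmapM Db_map_loc => e.
  by rewrite -compA [X in th X' ∘ X]e compA.
Qed.

End InducedFunctor.

Lemma exact_comp (K : fieldType) (D D' D'' : tridata K) (G : functor D' D'') (F : functor D D') :
  exact_functor G -> exact_functor F -> exact_functor (comp_functor G F).
Proof.
move=> [g [gi gn gd]] [f [fi fn fd]]; exists (fun X => g (F X) ∘ fmap G (f X)); split.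
- by move=> X; apply: is_iso_comp (functor_iso G (fi X)).
- move=> X Y h /=; rewrite -compA -fmapM fn fmapM compA gn.
  by rewrite -compA.
- move=> X Y Z a b c D0 /=; rewrite -compA -fmapM; exact: gd (fd _ _ _ _ _ _ D0).
Qed.

Lemma incl_exact (K : fieldType) (T : tridata K) (S : tri_subcat T) :
  exact_functor (incl_functor S : functor (sub_tridata S) T).
Proof.
exists (fun X => idm (shift T (sval X))); split=> [X|X Y f|X Y Z f g h D].
- exact: is_iso_id.
- by rewrite comp1m compm1.
- by rewrite comp1m.
Qed.
(** * Modules as objects of the heart *)

Section HeartModules.
Variables (K : fieldType) (T : tridata K) (T_tri : triangulated T).
Variables (n : nat) (E : 'I_n -> T).
Hypotheses (E_exc : exceptional_sequence E) (E_full : full_sequence E)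
           (E_strong : strong_sequence E)
           (T_fin : forall X Y : T, dsum_fin_dim (fun i : int => Mor X (shiftn i Y))).
Variables (S : T) (inj : forall i : 'I_n, Mor (E i) S)
          (proj : forall i : 'I_n, Mor S (E i)).
Hypothesis S_sum : is_biproduct inj proj.
Let A := End_alg S.
Let H := full_subcat (in_heart (le0_all E)).
Let under (X : H) : T := sval (sval X).
Implicit Types M N : mod_cat A.

(** The functor is built from modules to the heart, the direction needed to precompose the
    realization functor; on objects it is an inverse of [Hom(S, -)], with [beta] as the
    identification. *)
Definition module_object M : T :=
  sval (cid (heart_ess_surj T_tri E_exc E_strong T_fin S_sum M)).

Lemma module_object_bij M : exists beta : carrier M -> Mor S (module_object M),
  [/\ heart S (module_object M), bijective beta,
      forall c v w, beta (c *: v + w) = c *: beta v + beta w &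
      forall v (a : Mor S S), beta (mac v (a : A)) = beta v ∘ a].
Proof. by rewrite /module_object; case: cid => X [b bP]; exists b. Qed.

Definition beta M : carrier M -> Mor S (module_object M) := sval (cid (module_object_bij M)).

Lemma betaP M : [/\ heart S (module_object M), bijective (@beta M),
      forall c (v w : carrier M), beta (c *: v + w) = c *: beta v + beta w &
      forall (v : carrier M) (a : Mor S S), beta (mac v (a : A)) = beta v ∘ a].
Proof. exact: (svalP (cid (module_object_bij M))). Qed.

Lemma module_object_heart M : heart S (module_object M).
Proof. by have [] := betaP M. Qed.

Lemma beta_surj M (e : Mor S (module_object M)) : exists v : carrier M, beta v = e.
Proof. by have [_ [g _ gK] _ _] := betaP M; exists (g e). Qed.

Lemma beta_inj M : injective (@beta M).
Proof. by have [_ /bij_inj] := betaP M. Qed.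

Lemma beta_linear M c (v w : carrier M) : beta (c *: v + w) = c *: beta v + beta w.
Proof. by have [] := betaP M. Qed.

Lemma beta_mac M v (a : Mor S S) : @beta M (mac v (a : A)) = beta v ∘ a.
Proof. by have [] := betaP M. Qed.

Lemma beta_ext M (X : T) (f g : Mor (module_object M) X) : heart S X ->
  (forall v : carrier M, f ∘ beta v = g ∘ beta v) -> f = g.
Proof.
move=> hX fg; apply/subr0_eq.
apply: (heart_faithful T_tri E_exc E_full E_strong T_fin S_sum (@module_object_heart M) hX).
by move=> e; have [v <-] := beta_surj e; rewrite compBl fg subrr.
Qed.

Lemma module_map_ex M N (f : Mor M N) : exists g : Mor (module_object M) (module_object N),
  forall v : carrier M, g ∘ beta v = beta (ev f v).
Proof.
have [_ [b' bK b'K] _ _] := betaP M.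
have [e e'|e a|g gE] := heart_full T_tri E_exc E_full E_strong T_fin S_sum
    (phi := fun e => beta (ev f (b' e))) (@module_object_heart M) (@module_object_heart N).
- have [v <-] := beta_surj e; have [w <-] := beta_surj e'.
  by rewrite -[beta v]scale1r -beta_linear !bK linearP beta_linear !scale1r bK.
- have [v <-] := beta_surj e; rewrite -beta_mac !bK.
  by rewrite (ev_mac f v (a : A)) beta_mac.
by exists g => v; rewrite gE bK.
Qed.

Definition module_map M N (f : Mor M N) := sval (cid (module_map_ex f)).

Lemma module_mapE M N (f : Mor M N) v : module_map f ∘ beta v = beta (ev f v).
Proof. by rewrite /module_map; case: cid. Qed.

Definition to_heart M : H :=
  exist _ (to_all (module_object M))
    (proj2 (in_heart_all T_tri E_exc E_full E_strong T_fin S_sum (to_all (module_object M)))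
      (@module_object_heart M)).

Definition heart_functor : functor (mod_cat A) H.
Proof.
refine (@Functor K (mod_cat A) H to_heart (fun M N f => module_map f) _ _ _).
- move=> M; apply: (beta_ext (@module_object_heart M)) => v.
  by rewrite module_mapE ev_id; apply: esym; exact: comp1m.
- move=> L M N g f; apply: (beta_ext (@module_object_heart N)) => v.
  rewrite module_mapE ev_comp -!module_mapE; exact: compA.
- move=> M N f g; apply: (beta_ext (@module_object_heart N)) => v.
  rewrite module_mapE evD -[ev f v]scale1r beta_linear scale1r -!module_mapE.
  by rewrite -compDl.
Defined.

Lemma heart_functor_klinear : klinear heart_functor.
Proof.
move=> c M N f; apply: (beta_ext (@module_object_heart N)) => v.
rewrite module_mapE evZ -[c *: ev f v]addr0 beta_linear.
have -> : beta (0 : carrier N) = 0.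
  by apply: (addrI (beta (0 : carrier N))); rewrite -{1}[beta 0]scale1r -beta_linear scaler0 !addr0.
by rewrite addr0 -module_mapE -compZl.
Qed.

Lemma heart_functor_faithful : faithful heart_functor.
Proof.
move=> M N f f0; apply: ev_ext => v; apply: beta_inj.
by rewrite -!module_mapE; congr (_ ∘ _); rewrite [LHS]f0 -(functor0 heart_functor).
Qed.

Lemma heart_functor_full : full heart_functor.
Proof.
move=> M N g; have [_ [b' bK b'K] _ _] := betaP N.
pose g0 : Mor (module_object M) (module_object N) := g.
have gE v : beta (b' (g0 ∘ beta v)) = g0 ∘ beta v by rewrite b'K.
have [||f fE] := @exists_ev K A M N (fun v => b' (g0 ∘ beta v)).
- move=> c v w; apply: beta_inj; rewrite gE (@beta_linear M) (@beta_linear N) !gE.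
  by rewrite compDr compZr.
- move=> v a; apply: beta_inj; rewrite gE (@beta_mac M v (a : Mor S S)).
  by rewrite (@beta_mac N _ (a : Mor S S)) gE compA.
exists f; apply: (beta_ext (@module_object_heart N)) => v.
by rewrite module_mapE fE gE.
Qed.

(** A basis of [Hom(S, X)] turns this space into a module [M] on row vectors. The identification
    with the maps from [S] to [module_object M] and its inverse are both equivariant, so
    [heart_full] realizes them by morphisms. *)
Lemma exists_heart_module (X : T) : heart S X -> exists M, iso_ob (module_object M) X.
Proof.
move=> hX; have [m [b bspan]] := heart_fin T_fin S X.
have [d [phi phi_bij]] := finite_basis bspan.
have [psi phiK psiK] := phi_bij.
have ra : @right_action K A (Mor S X) (fun e a => e ∘ a).
  split=> *; [exact: compm1|exact: compA|exact: compDl|exact: compDr|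
              exact: compZl|exact: compZr].
have [|st stE] := submodule ra (can_inj phiK).
  by move=> v a; exists (psi (phi v ∘ a)).
pose M : mod_cat A := StdRMod st; have [_ [b' bK b'K] _ _] := betaP M.
have [e e'|e a|g gE] := heart_full T_tri E_exc E_full E_strong T_fin S_sum
    (phi := fun e => phi (b' e : 'rV[K]_d)) (@module_object_heart M) hX.
- have [v <-] := beta_surj e; have [w <-] := beta_surj e'.
  rewrite -[beta v]scale1r -beta_linear !bK scale1r.
  by rewrite linearP scale1r bK.
- have [v <-] := beta_surj e; rewrite -beta_mac !bK.
  exact: stE.
have [e e'|e a|g' g'E] := heart_full T_tri E_exc E_full E_strong T_fin S_sum
    (phi := fun e => @beta M (psi e)) hX (@module_object_heart M).
- have -> : psi (e + e') = 1 *: psi e + psi e'.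
    by apply: (can_inj phiK); rewrite linearP !psiK scale1r.
  by rewrite (beta_linear 1 (psi e : carrier M)) scale1r.
- rewrite -beta_mac; congr beta; apply: (can_inj phiK).
  by rewrite [RHS]stE !psiK.
have gbeta v : g ∘ @beta M v = phi v by rewrite gE bK.
exists M, g, g'; split.
- apply: (beta_ext (@module_object_heart M)) => v.
  by rewrite -compA gbeta g'E phiK comp1m.
- apply/subr0_eq/(heart_faithful T_tri E_exc E_full E_strong T_fin S_sum hX hX) => e.
  by rewrite compBl -compA g'E gbeta psiK comp1m subrr.
Qed.

Lemma heart_functor_ess (Y : H) : exists M, iso_ob (heart_functor M) Y.
Proof.
have hY : heart S (under Y).
  exact: (proj1 (in_heart_all T_tri E_exc E_full E_strong T_fin S_sum (sval Y)) (svalP Y)).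
have [M [f [g [gf fg]]]] := exists_heart_module hY.
by exists M, f, g.
Qed.

Definition module_functor : functor (mod_cat A) T.
Proof.
exists module_object (fun M N f => module_map f).
- exact: (fmap1 heart_functor).
- exact: (fmapM heart_functor).
- exact: (fmapD heart_functor).
Defined.

Lemma module_functor_faithful : faithful module_functor.
Proof. exact: heart_functor_faithful. Qed.

Lemma module_functor_full : full module_functor.
Proof. exact: heart_functor_full. Qed.

(** [U] is the regular module [A]; [rho] is evaluation at [1]. *)
Lemma exists_generator : exists (U : mod_cat A) (rho : forall M, Mor U M -> carrier M),
  [/\ iso_ob (module_object U) S, forall M, injective (@rho M),
      forall M v, exists f, @rho M f = v &
      forall M N (g : Mor M N) (f : Mor U M), rho N (g ∘ f) = ev g (rho M f)].
Proof.
have [U US] := exists_heart_module (heart_generator T_tri E_strong S_sum).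
have [i [j [ji ij]]] := US.
have ex M (f : Mor U M) : exists v, beta v = module_map f ∘ j by exact: beta_surj.
exists U, (fun M f => sval (cid (ex M f))); split=> // [M f g|M v|M N g f].
- case: cid => v /= vE; case: cid => w /= wE vw; subst w.
  apply: (faithful_inj module_functor_faithful) => /=.
  apply: (iso_cancelr (f := j)); first by exists i.
  by rewrite -vE.
- have [f fE] := module_functor_full (beta v ∘ i : Mor (module_functor U) (module_functor M)).
  exists f; case: cid => w /= wE; apply: beta_inj; rewrite wE.
  have fE' : module_map f = beta v ∘ i by exact: fE.
  by rewrite fE' -compA ij compm1.
- case: cid => v /= vE; case: cid => w /= wE; apply: beta_inj.
  rewrite vE -module_mapE wE compA; congr (_ ∘ _).
  exact: (fmapM module_functor g f).
Qed.

End HeartModules.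

(** * Stalk complexes under the induced functor *)

Section StalkComparison.
Variables (K : fieldType) (A B : kcat K) (F : functor A B).
Variables (O : B) (O0 : is_zero O).

Lemma stalk_conc (Y : B) : conc 0 (stalk_functor O0 Y : Cb B).
Proof. by move=> [[|m]|m]. Qed.

Lemma Cb_map_conc a (X : Cb A) : conc a X -> conc a (Cb_map F X).
Proof. by move=> cX i ia; apply: (functor_zero F (cX i ia)). Qed.

(** Outside degree [0] the terms of [Cb_map F X] are zero objects, but not the chosen object [O].
    This isomorphism bridges the gap, since a realization is described only on stalk complexes
    padded with [O]. *)
Lemma exists_stalk_iso (X : Cb A) : conc 0 X ->
  exists xi : Mor (Cb_map F X) (stalk_functor O0 (F X⌊0⌋)), is_iso xi /\ xi⌈0⌉ = idm (F X⌊0⌋).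
Proof.
move=> cX; have cF := Cb_map_conc cX; have cS := stalk_conc (F X⌊0⌋).
have [|xi xiE] := conc_map (a := 0) (X := Cb_map F X) (Y := stalk_functor O0 (F X⌊0⌋))
      (g := idm (F X⌊0⌋)) cF.
  by rewrite (conc_diff _ _ cS) comp0m.
have [|xi' xi'E] := conc_map (a := 0) (X := stalk_functor O0 (F X⌊0⌋)) (Y := Cb_map F X)
      (g := idm (F X⌊0⌋)) cS.
  by rewrite (conc_diff _ _ cF) comp0m.
exists xi; split=> //; exists xi'; split; [apply: (conc_ext cF)|apply: (conc_ext cS)];
  by rewrite ccompM xiE xi'E; exact: comp1m.
Qed.

Lemma stalk_iso_nat (X Y : Cb A) (f : Mor X Y) (xi : Mor (Cb_map F X) (stalk_functor O0 (F X⌊0⌋)))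
    (zeta : Mor (Cb_map F Y) (stalk_functor O0 (F Y⌊0⌋))) :
  conc 0 X -> xi⌈0⌉ = idm (F X⌊0⌋) -> zeta⌈0⌉ = idm (F Y⌊0⌋) ->
  zeta ∘ fmap (Cb_map F) f = fmap (stalk_functor O0) (fmap F f⌈0⌉) ∘ xi.
Proof.
move=> cX xiE zetaE; apply: (conc_ext (Cb_map_conc cX)); rewrite !ccompM xiE zetaE.
exact: (etrans (comp1m _) (esym (compm1 _))).
Qed.

End StalkComparison.

(** * Assembly from the realization functor *)

Theorem theorem5p6 (K : fieldType) (T : tridata K) (T_tri : triangulated T)
    (T_realized : realized T)
    (n : nat) (E : 'I_n -> T)
    (E_exc : exceptional_sequence E) (E_full : full_sequence E)
    (E_strong : strong_sequence E)
    (T_fin : forall X Y : T, dsum_fin_dim (fun i : int => Mor X (shiftn i Y)))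
    (S : T) (inj : forall i : 'I_n, Mor (E i) S)
    (proj : forall i : 'I_n, Mor S (E i))
    (S_sum : is_biproduct inj proj) :
  tri_equivalent T (Db (mod_cat (End_alg S))).
Proof.
have [real [real_exact [O [O0 [eta [eta_iso eta_nat]]]]]] := T_realized _ _
  (le0_all_tstructure T_tri E_exc E_full E_strong T_fin)
  (le0_all_bounded T_tri E_exc E_full E_strong T_fin).
pose F := heart_functor T_tri E_exc E_full E_strong T_fin S_sum.
have F_lin : klinear F by exact: heart_functor_klinear.
have F_faithful : faithful F by exact: heart_functor_faithful.
have F_full : full F by exact: heart_functor_full.
have F_ess := heart_functor_ess T_tri E_exc E_full E_strong T_fin S_sum.
pose DF := Db_map F_lin F_faithful F_full F_ess.
pose G : functor (Db (mod_cat (End_alg S))) T :=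
  comp_functor (incl_functor (all_sub T) : functor (sub_tridata (all_sub T)) T)
    (comp_functor real DF).
have [theta [theta_iso theta_nat G_dist]] : exact_functor G.
  apply: exact_comp; first exact: incl_exact.
  by apply: exact_comp; [exact: real_exact|exact: Db_map_exact].
pose J := module_functor T_tri E_exc E_full E_strong T_fin S_sum.
have J_faithful : faithful J by exact: module_functor_faithful.
have J_full : full J by exact: module_functor_full.
have [U [rho [[sigma sigma_iso] rho_inj rho_surj rho_nat]]] :=
  exists_generator T_tri E_exc E_full E_strong T_fin S_sum.
pose xi X (cX : conc 0 X) := sval (cid (exists_stalk_iso F O0 cX)).
have xi_iso X (cX : conc 0 X) : is_iso (xi X cX) := proj1 (svalP (cid (exists_stalk_iso F O0 cX))).
have xiE X (cX : conc 0 X) := proj2 (svalP (cid (exists_stalk_iso F O0 cX))).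
pose gamma (X : Cb (mod_cat (End_alg S))) (cX : conc 0 X) :
    Mor (Gc G X) (J X⌊0⌋) :=
  eta (F X⌊0⌋) ∘ fmap real (fmap (Db_functor _) (xi X cX)).
pose Sall := sub_tridata (all_sub T).
pose RD : functor (Cb (full_subcat (in_heart (le0_all E)))) Sall :=
  comp_functor (real : functor (Db_cat _) Sall) (Db_functor _).
(* Composition in the subcategory of all objects is that of [T] up to conversion, so the claim is
   proved there and then read in [T]. *)
have gamma_iso X (cX : conc 0 X) : is_iso (gamma X cX).
  have i1 : @is_iso K Sall _ _ (eta (F X⌊0⌋) ∘ fmap RD (xi X cX)).
    by apply: is_iso_comp (eta_iso _) _; apply: functor_iso; exact: xi_iso.
  by have [g gP] := i1; exists g.
have gamma_nat X Y (cX : conc 0 X) (cY : conc 0 Y) (f : Mor X Y) :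
    gamma Y cY ∘ fmap (Gc G) f = fmap J f⌈0⌉ ∘ gamma X cX.
  have e1 : fmap DF (fmap (Db_functor _) f) = fmap (Db_functor _) (fmap (Cb_map F) f).
    exact: Db_map_loc.
  have key : @comp K Sall _ _ _ (eta (F Y⌊0⌋) ∘ fmap RD (xi Y cY)) (fmap RD (fmap (Cb_map F) f))
     = @comp K Sall _ _ _ (fmap (incl_functor (in_heart (le0_all E))) (fmap F f⌈0⌉))
        (eta (F X⌊0⌋) ∘ fmap RD (xi X cX)).
    rewrite -compA -fmapM (stalk_iso_nat f cX (xiE X cX) (xiE Y cY)) fmapM !compA.
    by congr (_ ∘ _); exact: eta_nat.
  have e2 : fmap (Gc G) f = fmap RD (fmap (Cb_map F) f) by exact: (f_equal (fmap real) e1).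
  rewrite e2; exact: key.
have J_orth a M : a != 0 -> hom_zero (shiftn a (J U)) (J M).
  move=> a0; apply: (hom_zero_isol (X := shiftn a S)).
    by apply: shiftn_iso; apply: iso_ob_sym; exists sigma.
  exact: module_object_heart.
have J_gen (S' : tri_subcat T) : (forall P, in_add U P -> S' (J P)) -> forall X, S' X.
  move=> S'J; apply: (@E_full S') => i.
  have hE : heart S (E i) by exact: (heart_summand T_tri E_strong S_sum).
  have [M ME] := exists_heart_module T_tri E_exc E_full E_strong T_fin S_sum hE.
  (* [E i] is a retract of [S], to which [U] corresponds; the decomposition of its identity through
     copies of [S] is carried back along the fully faithful [J]. *)
  apply: (sub_iso ME); apply: S'J.
  have [pi _ _] := S_sum; have aE : in_add S (E i) := in_add_retract (pi i) (in_add_self S).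
  have [m [s [t st]]] : in_add (J U) (J M).
    apply: (in_add_iso ME); have [m [s [t st]]] := aE.
    have [sg [sg1 sg2]] := sigma_iso.
    exists m, (fun l => s l ∘ sigma), (fun l => sg ∘ t l).
    rewrite -st; apply: eq_bigr => l _.
    by rewrite compA -(compA (s l)) sg2 compm1.
  exists m, (fun l => sval (cid (J_full _ _ (s l)))), (fun l => sval (cid (J_full _ _ (t l)))).
  apply: (faithful_inj J_faithful); rewrite fmap1 -st functor_sum.
  apply: eq_bigr => l _; rewrite fmapM.
  by case: cid => x /= ->; case: cid => y /= ->.
have sums : has_sums (mod_cat (End_alg S)).
  by split; [exact: mod_zero|exact: mod_sum2].
(* Additivity of [rho] is not part of its specification; the value at zero comes from naturality
   along the zero endomorphism. *)
have rho0 M : rho M 0 = 0.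
  have := rho_nat M M 0 0; rewrite compm0 => ->.
  exact: ev0.
have U_exact M N Q (f : Mor M N) (p : Mor N Q) : is_cokernel f p ->
    (forall x : Mor U Q, exists y, p ∘ y = x) /\
    (forall y : Mor U N, p ∘ y = 0 -> exists x, f ∘ x = y).
  move=> /mod_cokernel_exact[surj ker]; split=> [x|y py].
    have [v vE] := surj (rho Q x); have [y yE] := rho_surj N v; exists y.
    by apply: rho_inj; rewrite rho_nat yE.
  have [|w wE] := ker (rho N y); first by rewrite -rho_nat py rho0.
  have [x xE] := rho_surj M w; exists x.
  by apply: rho_inj; rewrite rho_nat xE.
have U_cons M N (f : Mor M N) : (forall x : Mor U M, f ∘ x = 0 -> x = 0) ->
    (forall y : Mor U N, exists x, f ∘ x = y) -> is_iso f.
  move=> finj fsurj; apply: mod_iso => [v w vw|w].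
    have [x xE] := rho_surj M v; have [y yE] := rho_surj M w.
    suff : x - y = 0 by move=> /subr0_eq xy; rewrite -xE -yE xy.
    apply: finj; rewrite compBr.
    have -> : f ∘ x = f ∘ y by apply: rho_inj; rewrite !rho_nat xE yE.
    by rewrite subrr.
  have [y yE] := rho_surj N w; have [x xE] := fsurj y.
  by exists (rho M x); rewrite -rho_nat xE.
exact: (equivalence_of_realization T_tri sums (@mod_kernel _ _) (@mod_cokernel _ _)
  U_exact U_cons theta_iso theta_nat G_dist J_faithful J_full J_orth gamma_iso gamma_nat J_gen).
Qed.
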